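(* Let $\Delta$ be a finite reduced root system of rank $r$, let $\emptyset\neq I\subset\{1,\dots,r\}$, $\mathbf{s}=(s_\alpha)\in\mathcal{S}$ and $\mathbf{y}\in V$. Then $$\begin{aligned}S(\mathbf{s},\mathbf{y};I;\Delta)&=\sum_{w\in W^I}\Bigl(\prod_{\alpha\in\Delta_{w^{-1}}}(-1)^{-s_\alpha}\Bigr)\zeta_r(w^{-1}\mathbf{s},w^{-1}\mathbf{y};\Delta)\\&=(-1)^{\lvert\Delta_+\setminus\Delta_{I+}\rvert}\biggl(\prod_{\alpha\in\Delta_+\setminus\Delta_{I+}}\frac{(2\pi\sqrt{-1})^{s_\alpha}}{\Gamma(s_\alpha+1)}\biggr)\sum_{\lambda\in P_{I++}}e^{2\pi\sqrt{-1}\langle\mathbf{y},\lambda\rangle}\prod_{\alpha\in\Delta_{I+}}\frac{1}{\langle\alpha^\vee,\lambda\rangle^{s_\alpha}}\\&\quad\times\int_0^1\!\!\cdots\!\int_0^1\exp\Bigl(-2\pi\sqrt{-1}\sum_{\alpha\in\Delta_+\setminus(\Delta_{I+}\cup\Psi)}x_\alpha\langle\alpha^\vee,\lambda\rangle\Bigr)\Bigl(\prod_{\alpha\in\Delta_+\setminus(\Delta_{I+}\cup\Psi)}L_{s_\alpha}(x_\alpha,0)\Bigr)\\&\quad\times\biggl(\prod_{i\in I^c}L_{s_{\alpha_i}}\Bigl(\langle\mathbf{y},\lambda_i\rangle-\sum_{\alpha\in\Delta_+\setminus(\Delta_{I+}\cup\Psi)}x_\alpha\langle\alpha^\vee,\lambda_i\rangle,\,0\Bigr)\biggr)\prod_{\alpha\in\Delta_+\setminus(\Delta_{I+}\cup\Psi)}dx_\alpha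 ,\end{aligned}$$ where in the last expression the integral (which depends on $\lambda$) is inside the sum over $\lambda$. The sum over $w\in W^I$ consists of $\bigl(W(\Delta):W(\Delta_I)\bigr)$ terms.
   Context: Root systems: $V$ is an $r$-dimensional real inner product space, $V^*$ is identified with $V$; $\Delta\subset V$ is a finite reduced root system, $\Psi=\{\alpha_1,\dots,\alpha_r\}$ a fundamental system, $\Delta_\pm$ the positive/negative roots, $\alpha^\vee$ the coroot of $\alpha$; fundamental weights $\lambda_j$ satisfy $\langle\alpha_i^\vee,\lambda_j\rangle=\delta_{ij}$; $P=\bigoplus_i\mathbb{Z}\lambda_i$, $P_{++}=\{\sum_i m_i\lambda_i:m_i\in\mathbb{Z}_{\ge1}\}$. $W=W(\Delta)$ is the Weyl group; $W(\Delta_I)$ is generated by the reflections in $\Delta_I$. For $I\subset\{1,\dots,r\}$ with complement $I^c$: $\Delta_I$ is the set of roots in the span of $\{\alpha_i\}_{i\in I}$, $\Delta_{I+}=\Delta_I\cap\Delta_+$, $P_{I++}=\{\sum_{i\in I}m_i\lambda_i:m_i\in\mathbb{Z}_{\ge1}\}$, $W^I=\{w\in W:\Delta_{I+}^\vee\subset w\Delta_+^\vee\}$. For $w\in W$, $\Delta_w=\Delta_+\cap w^{-1}\Delta_-$. Variables: $\mathbf{s}=(s_\alpha)$ is indexed by $\overline\Delta=\Delta/\{\pm1\}$ (so $s_{-\alpha}=s_\alpha$), identified with $\mathbb{C}^{|\Delta_+|}$; $W$ acts by $(w\mathbf{s})_\alpha=s_{w^{-1}\alpha}$. $\mathcal{S}=\{\mathbf{s}:\Re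 s_\alpha>1\text{ for all }\alpha\in\Delta_+\}$. Functions (absolutely convergent for $\mathbf{s}\in\mathcal{S}$): $$\zeta_r(\mathbf{s},\mathbf{y};\Delta)=\sum_{\lambda\in P_{++}}e^{2\pi\sqrt{-1}\langle\mathbf{y},\lambda\rangle}\prod_{\alpha\in\Delta_+}\frac1{\langle\alpha^\vee,\lambda\rangle^{s_\alpha}},$$ $$S(\mathbf{s},\mathbf{y};I;\Delta)=\sum_{\lambda}e^{2\pi\sqrt{-1}\langle\mathbf{y},\lambda\rangle}\prod_{\alpha\in\Delta_+}\frac1{\langle\alpha^\vee,\lambda\rangle^{s_\alpha}},$$ the latter sum over all $\lambda\in P$ with $\langle\alpha_i^\vee,\lambda\rangle\ge0$ for $i\in I$ and $\langle\alpha^\vee,\lambda\rangle\ne0$ for all $\alpha\in\Delta$. For $\Re s>1$, $x\in\mathbb{R}$, $$L_s(x,0)=-\frac{\Gamma(s+1)}{(2\pi\sqrt{-1})^s}\sum_{n\in\mathbb{Z}\setminus\{0\}}\frac{e^{2\pi\sqrt{-1}nx}}{n^s}.$$ Powers of negative reals use one fixed branch, e.g. $(-x)^{-s}=(-1)^{-s}x^{-s}$ for $x>0$ with $(-1)^{-s}=e^{-\pi\sqrt{-1}s}$. *)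

(* Defs.v *)
From HB Require Import structures.
From mathcomp Require Import all_boot all_order all_algebra finmap complex.
From mathcomp Require Import all_classical all_reals all_analysis.

Set Implicit Arguments.
Unset Strict Implicit.
Unset Printing Implicit Defensive.

Import Order.TTheory GRing.Theory Num.Theory.
Import numFieldNormedType.Exports.

Local Open Scope classical_set_scope.
Local Open Scope complex_scope.
Local Open Scope ring_scope.

Section ComplexFunctions.
Context {R : realType}.

Definition cexp (z : R[i]) : R[i] :=
  (expR (complex.Re z) * cos (complex.Im z))
  +i* (expR (complex.Re z) * sin (complex.Im z)).

Definition e2pii (t : R) : R[i] := cexp ((2 * pi * t) *i).

(* The principal argument, with values in ]-pi, pi]. *)
Definition carg (z : R[i]) : R :=
  let theta := acos (complex.Re z / Normc.normc z) in
  if 0 <= complex.Im z then theta else - theta.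

Definition clog (z : R[i]) : R[i] := ln (Normc.normc z) +i* carg z.

(* Principal branch of z ^ s, for z != 0.  For x > 0 it gives
   (- x) ^ (- s) = (- 1) ^ (- s) * x ^ (- s)  and  (- 1) ^ (- s) = e^{- pi i s}. *)
Definition cpow (z s : R[i]) : R[i] := cexp (s * clog z).

(* Sums over arbitrary index sets; meaningful for absolutely summable families,
   where they are the unconditional sums. *)
Definition csummable {T : choiceType} (A : set T) (f : T -> R[i]) : Prop :=
  summable A (fun t => (Normc.normc (f t))%:E).

Definition rsum {T : choiceType} (A : set T) (f : T -> R) : R :=
  fine (\esum_(t in A) ((EFin \o f)^\+%E t)
        - \esum_(t in A) ((EFin \o f)^\-%E t))%E.

Definition csum {T : choiceType} (A : set T) (f : T -> R[i]) : R[i] :=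
  rsum A (fun t => complex.Re (f t)) +i* rsum A (fun t => complex.Im (f t)).

Definition cint (A : set R) (f : R -> R[i]) : R[i] :=
  (\int[lebesgue_measure]_(t in A) complex.Re (f t))
  +i* (\int[lebesgue_measure]_(t in A) complex.Im (f t)).

(* The integral of F over [0, 1]^E, one variable at a time; x gives the values
   of the variables outside E. *)
Fixpoint iterated_cint01 {T : eqType} (E : seq T) (F : (T -> R) -> R[i])
    (x : T -> R) : R[i] :=
  if E is a :: E' then
    cint `[0, 1] (fun t => iterated_cint01 E' F [eta x with a |-> t])
  else F x.

(* Euler's integral, for 0 < Re z. *)
Definition Gamma (z : R[i]) : R[i] :=
  cint `]0, +oo[ (fun t => cpow t%:C (z - 1) * (expR (- t))%:C).

(* This is L_s(x, 0), for 1 < Re s. *)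
Definition L (s : R[i]) (x : R) : R[i] :=
  - (Gamma (s + 1) / cpow ((2 * pi) *i) s)
  * csum [set n : int | n != 0] (fun n => e2pii (n%:~R * x) / cpow n%:~R s).

End ComplexFunctions.

Section RootSystems.
Context {R : realType} {V : vectType R} (dot : {dot V for idfun}).

Definition coroot (a : V) : V := (2 / dot a a) *: a.

Definition reflection (a : V) : 'End(V) :=
  linfun (fun v => v - dot (coroot a) v *: a).

Record reduced_root_system (D : {fset V}) : Prop := ReducedRootSystem {
  roots_neq0 : 0 \notin D;
  roots_span : <<D>>%VS = fullv;
  roots_reflection : {in D &, forall a b, reflection a b \in D};
  roots_integral : {in D &, forall a b, dot (coroot a) b \is a Num.int};
  roots_reduced : {in D, forall a (c : R), c *: a \in D -> c = 1 \/ c = -1} }.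

Section FundamentalSystem.
Context {r : nat} (D : {fset V}) (Psi : r.-tuple V) (lam : 'I_r -> V).

Record fundamental_system : Prop := FundamentalSystem {
  fundamental_basis : basis_of fullv Psi;
  fundamental_roots : {subset Psi <= D};
  fundamental_sign : {in D, forall a,
    (forall i, coord Psi i a \is a Num.nat) \/
    (forall i, - coord Psi i a \is a Num.nat)} }.

Definition fundamental_weights : Prop :=
  forall i j, dot (coroot (tnth Psi i)) (lam j) = (i == j)%:R.

Definition pos_roots : {fset V} :=
  [fset a in D | [forall i, 0 <= coord Psi i a]]%fset.

Definition neg_roots : {fset V} :=
  [fset a in D | [forall i, coord Psi i a <= 0]]%fset.

Definition parabolic_roots (I : {set 'I_r}) : {fset V} :=
  [fset a in D | a \in <<[seq tnth Psi i | i in I]>>%VS]%fset.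

Definition parabolic_pos_roots (I : {set 'I_r}) : {fset V} :=
  (parabolic_roots I `&` pos_roots)%fset.

Definition weight_lattice : set V :=
  [set v | exists m : 'I_r -> int, v = \sum_i lam i *~ m i].

Definition regular_dominant_weights : set V :=
  [set v | exists2 m : 'I_r -> int,
    forall i, 1 <= m i & v = \sum_i lam i *~ m i].

Definition parabolic_dominant_weights (I : {set 'I_r}) : set V :=
  [set v | exists2 m : 'I_r -> int,
    {in I, forall i, 1 <= m i} & v = \sum_(i in I) lam i *~ m i].

End FundamentalSystem.

Inductive reflection_group (X : {fset V}) : set 'End(V) :=
| Refl1 : reflection_group X \1%VF
| ReflGen a : a \in X -> reflection_group X (reflection a)
| ReflM v w : reflection_group X v -> reflection_group X w ->
    reflection_group X (v \o w)%VF
| ReflV w : reflection_group X w -> reflection_group X (w^-1)%VF.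

Definition right_cosets (H G : set 'End(V)) : set (set 'End(V)) :=
  [set [set (h \o g)%VF | h in H] | g in G].

Section ZetaFunctions.
Context {r : nat} (D : {fset V}) (Psi : r.-tuple V) (lam : 'I_r -> V).

Definition parabolic_reps (I : {set 'I_r}) : set 'End(V) :=
  [set w | reflection_group D w /\
    ([fset coroot a | a in parabolic_pos_roots D Psi I]
      `<=` [fset w (coroot a) | a in pos_roots D Psi])%fset].

Definition inversions (w : 'End(V)) : {fset V} :=
  (pos_roots D Psi `&` [fset (w^-1)%VF a | a in neg_roots D Psi])%fset.

(* A family (s_a) indexed by roots is a function on V; only its values at the
   roots matter. *)
Definition act (w : 'End(V)) (s : V -> R[i]) : V -> R[i] :=
  fun a => s ((w^-1)%VF a).

Definition zeta_term (s : V -> R[i]) (y v : V) : R[i] :=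
  e2pii (dot y v)
  * \prod_(a <- pos_roots D Psi) (cpow (dot (coroot a) v)%:C (s a))^-1.

Definition zeta (s : V -> R[i]) (y : V) : R[i] :=
  csum (regular_dominant_weights lam) (zeta_term s y).

Definition zetaS (s : V -> R[i]) (y : V) (I : {set 'I_r}) : R[i] :=
  csum [set v | [/\ weight_lattice lam v,
                    {in I, forall i, 0 <= dot (coroot (tnth Psi i)) v} &
                    {in D, forall a, dot (coroot a) v != 0}]]
       (zeta_term s y).

End ZetaFunctions.
End RootSystems.

(* Main.v *)
(* A regular weight lies in a unique chamber [w C], so the domain of summation
   of S is the disjoint union of the sets [w P_{++}] over the [w] whose chamber
   [w C] is on the positive side of the walls of [alpha_i], i in I, that is over
   W^I; transporting each piece to P_{++} gives the first expression.

   For the second one, write a weight as [lambda + mu] with [lambda] in P_{I++}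
   and [mu = sum_{i notin I} m_i lambda_i].  Expanding every L into its
   absolutely convergent Fourier series, the integral over [x_alpha] forces the
   frequency attached to alpha to be [<alpha^vee, lambda + mu>], which turns the
   integral into the sum over the [m_i] of the terms of S; the weights on a wall
   drop out because the Fourier series of L have no constant term.  Dividing by
   the Gamma factors requires Gamma to have no zero: by the functional equation
   it is enough to look far to the right, where the phase of [t ^ (i b)] is
   almost constant on the bulk of the density [t ^ c e^{- t}]. *)

Require Import Defs.
From HB Require Import structures.
From mathcomp Require Import all_boot all_order all_algebra finmap complex.
From mathcomp Require Import all_classical all_reals all_analysis.
From mathcomp Require Import measurable_realfun.
From mathcomp Require Import ring lra.

Set Implicit Arguments.
Unset Strict Implicit.
Unset Printing Implicit Defensive.

Import Order.TTheory GRing.Theory Num.Theory.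
Import numFieldNormedType.Exports.

Local Open Scope classical_set_scope.
Local Open Scope complex_scope.
Local Open Scope ring_scope.

(** * Complex exponentials and powers *)

Section ComplexPowers.
Context {R : realType}.
Implicit Types (x y t : R) (z s : R[i]).

(** Since [csum] has a meaning only for absolutely summable families, every exchange of sums and
    integrals rests on absolute convergence. One estimate provides it: the factors of the simple
    roots depend on one coordinate of the weight each, so their product is summable coordinate by
    coordinate, and every other factor is bounded because a nonzero integer has absolute value at
    least 1. The obstacle is that the regular weights do not form a product set. Giving the inverse
    power the value 0 at the integer 0 removes it, as the domain can then be enlarged to a product
    of two cones.

    For the Weyl group everything is reduced to words in the simple reflections. The exchange
    condition shows that only the identity keeps all simple roots positive, which gives the
    uniqueness of chambers and of coset representatives alike.

    For Gamma, real and imaginary parts are two values of one real integral depending on a phase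
    angle. A zero annihilates the integral for all angles at once, whereas a well chosen angle makes
    it positive. *)

Lemma cReD z s : complex.Re (z + s) = complex.Re z + complex.Re s.
Proof. by case: z; case: s. Qed.

Lemma cImD z s : complex.Im (z + s) = complex.Im z + complex.Im s.
Proof. by case: z; case: s. Qed.

Lemma cReN z : complex.Re (- z) = - complex.Re z.
Proof. by case: z. Qed.

Lemma cImN z : complex.Im (- z) = - complex.Im z.
Proof. by case: z. Qed.

Lemma cReM z s : complex.Re (z * s) =
  complex.Re z * complex.Re s - complex.Im z * complex.Im s.
Proof. by case: z; case: s. Qed.

Lemma cImM z s : complex.Im (z * s) =
  complex.Re z * complex.Im s + complex.Im z * complex.Re s.
Proof. by case: z; case: s. Qed.

Lemma complex_ext z s : complex.Re z = complex.Re s ->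
  complex.Im z = complex.Im s -> z = s.
Proof. by case: z; case: s => /= a b c d -> ->. Qed.

Lemma normc_ge0 z : 0 <= Normc.normc z.
Proof. by case: z => a b; exact: sqrtr_ge0. Qed.

Lemma normc_Re z : `|complex.Re z| <= Normc.normc z.
Proof.
case: z => a b /=; rewrite -sqrtr_sqr ler_wsqrtr // lerDl; exact: sqr_ge0.
Qed.

Lemma normc_Im z : `|complex.Im z| <= Normc.normc z.
Proof.
case: z => a b /=; rewrite -sqrtr_sqr ler_wsqrtr // lerDr; exact: sqr_ge0.
Qed.

Lemma normc_le z : Normc.normc z <= `|complex.Re z| + `|complex.Im z|.
Proof.
case: z => a b /=; rewrite -[leRHS]ger0_norm ?addr_ge0 // -sqrtr_sqr ler_wsqrtr //.
rewrite sqrrD !real_normK ?num_real // lerD2r lerDl.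
by rewrite mulrn_wge0 // mulr_ge0.
Qed.

Lemma normc_real x : Normc.normc x%:C = `|x|.
Proof. by rewrite /= expr0n /= addr0 sqrtr_sqr. Qed.

Lemma normc_eq0 z : (Normc.normc z == 0) = (z == 0).
Proof. by apply/eqP/eqP => [/Normc.eq0_normc|->]; rewrite ?Normc.normc0. Qed.

Lemma normc_gt0 z : (0 < Normc.normc z) = (z != 0).
Proof. by rewrite lt_neqAle normc_ge0 andbT eq_sym normc_eq0. Qed.

Lemma normc_prod (I : Type) (l : seq I) (F : I -> R[i]) :
  Normc.normc (\prod_(i <- l) F i) = \prod_(i <- l) Normc.normc (F i).
Proof. by elim/big_rec2: _ => [|i x z _ <-]; rewrite ?Normc.normc1 ?Normc.normcM. Qed.

Lemma cexpD z s : cexp (z + s) = cexp z * cexp s.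
Proof.
apply: complex_ext; rewrite /cexp ?cReM ?cImM /= cReD cImD expRD ?cosD ?sinD; ring.
Qed.

Lemma cexp0 : cexp (0 : R[i]) = 1.
Proof. by rewrite /cexp /= expR0 cos0 sin0 mulr1 mulr0. Qed.

Lemma normc_cexp z : Normc.normc (cexp z) = expR (complex.Re z).
Proof.
rewrite /cexp /= !exprMn -mulrDr cos2Dsin2 mulr1 sqrtr_sqr ger0_norm //.
Qed.

Lemma cexp_neq0 z : cexp z != 0.
Proof. by rewrite -normc_gt0 normc_cexp expR_gt0. Qed.

Lemma cexpN z : cexp (- z) = (cexp z)^-1.
Proof.
by apply: (mulIf (cexp_neq0 z)); rewrite -cexpD addNr cexp0 mulVf ?cexp_neq0.
Qed.

Lemma cpow_neq0 z s : cpow z s != 0.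
Proof. exact: cexp_neq0. Qed.

Lemma cpowN z s : cpow z (- s) = (cpow z s)^-1.
Proof. by rewrite /cpow mulNr cexpN. Qed.

Lemma clog_pos x : 0 < x -> clog x%:C = (ln x)%:C.
Proof.
move=> x0; rewrite /clog normc_real gtr0_norm // /carg normc_real /= lexx.
by rewrite gtr0_norm // divff ?gt_eqF // acos1.
Qed.

Lemma clog_neg x : 0 < x -> clog (- x)%:C = ln x +i* pi.
Proof.
move=> x0; rewrite /clog normc_real normrN gtr0_norm // /carg normc_real /= lexx.
by rewrite normrN gtr0_norm // mulNr divff ?gt_eqF // acosN1.
Qed.

(** The arguments of -1 and of [x] are pi and 0, and their sum stays in the range of [carg]; so the
    principal logarithm is additive on this product. *)
Lemma cpow_opp x s : 0 < x -> cpow (- x)%:C s = cpow (-1) s * cpow x%:C s.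
Proof.
move=> x0; rewrite /cpow clog_neg // clog_pos //.
have -> : (-1 : R[i]) = (- 1)%:C by apply: complex_ext => //=; rewrite oppr0.
rewrite clog_neg // ln1 -cexpD -mulrDr; congr (cexp (_ * _)).
by apply: complex_ext => /=; rewrite ?add0r ?addr0.
Qed.

(** A nonzero real number has argument 0 or pi, so the imaginary part of [s] changes the modulus of
    the power by a factor that is bounded independently of [x]. *)
Lemma normc_cpow_ge x s : x != 0 ->
  expR (complex.Re s * ln `|x|) <= expR (pi * `|complex.Im s|) * Normc.normc (cpow x%:C s).
Proof.
move=> x0; rewrite /cpow normc_cexp -expRD ler_expR cReM.
suff [k /andP[k0 k1] ->] : exists2 k : R, 0 <= k <= pi & clog x%:C = ln `|x| +i* k.
  rewrite /= addrC -addrA lerDl; have := ler_norm (complex.Im s).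
  have := normr_ge0 (complex.Im s); nra.
have [xp|xn|xe] := ltgtP x 0; last by rewrite xe eqxx in x0.
  exists pi; first by rewrite pi_ge0 /=.
  by rewrite -{1}[x]opprK clog_neg ?oppr_gt0 // ltr0_norm.
by exists 0; rewrite ?lexx ?pi_ge0 // clog_pos // gtr0_norm.
Qed.

Lemma e2piiD x y : e2pii (x + y) = e2pii x * e2pii y.
Proof.
by rewrite /e2pii -cexpD; congr cexp; apply: complex_ext => /=; rewrite ?addr0 // mulrDr.
Qed.

Lemma e2pii0 : e2pii 0 = 1 :> R[i].
Proof. by rewrite /e2pii mulr0 -cexp0. Qed.

Lemma e2piiN x : e2pii (- x) = (e2pii x)^-1.
Proof.
by rewrite /e2pii -cexpN; congr cexp; apply: complex_ext => /=; rewrite ?oppr0 // mulrN.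
Qed.

Lemma e2pii_sum (I : Type) (l : seq I) (P : pred I) (F : I -> R) :
  e2pii (\sum_(i <- l | P i) F i) = \prod_(i <- l | P i) e2pii (F i).
Proof. by elim/big_rec2: _ => [|i x z _ <-]; rewrite ?e2pii0 ?e2piiD. Qed.

Lemma normc_e2pii x : Normc.normc (e2pii x) = 1.
Proof. by rewrite /e2pii normc_cexp expR0. Qed.

Lemma e2pii_int (n : int) : e2pii (n%:~R : R) = 1.
Proof.
have hn (m : nat) : e2pii (m%:R : R) = 1.
  elim: m => [|m IH]; first by rewrite e2pii0.
  rewrite -natr1 e2piiD IH mul1r /e2pii /cexp /= expR0 !mul1r mulr1.
  by rewrite mulr_natl cos2pi -[pi *+ 2]add0r sinD2pi sin0.
case: n => m; first exact: hn.
by rewrite NegzE rmorphN /= e2piiN hn invr1.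
Qed.

End ComplexPowers.

(** * Root systems and parabolic subgroups *)

Section RootSystem.
Context {R : realType} {V : vectType R} (dot : {dot V for idfun}).
Implicit Types a b u v : V.

Lemma dotC u v : dot u v = dot v u.
Proof. by rewrite hermC expr0 mul1r. Qed.

Lemma dotDr u v w : dot u (v + w) = dot u v + dot u w.
Proof. exact: linearDr. Qed.

Lemma dotZr u c v : dot u (c *: v) = c * dot u v.
Proof. exact: linearZr_LR. Qed.

Lemma dotDl u v w : dot (u + v) w = dot u w + dot v w.
Proof. by rewrite dotC dotDr !(dotC w). Qed.

Lemma dotZl c u v : dot (c *: u) v = c * dot u v.
Proof. by rewrite dotC dotZr (dotC v). Qed.

Lemma dotNr u v : dot u (- v) = - dot u v.
Proof. by rewrite -scaleN1r dotZr mulN1r. Qed.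

Lemma dotNl u v : dot (- u) v = - dot u v.
Proof. by rewrite dotC dotNr dotC. Qed.

Lemma dot0r u : dot u 0 = 0.
Proof. by rewrite -(scale0r 0) dotZr mul0r. Qed.

Lemma dot_sumr I (l : seq I) P (F : I -> V) u :
  dot u (\sum_(i <- l | P i) F i) = \sum_(i <- l | P i) dot u (F i).
Proof. by elim/big_rec2: _ => [|i x y _ <-]; rewrite ?dot0r ?dotDr. Qed.

Lemma dot_suml I (l : seq I) P (F : I -> V) u :
  dot (\sum_(i <- l | P i) F i) u = \sum_(i <- l | P i) dot (F i) u.
Proof. by rewrite dotC dot_sumr; apply: eq_bigr => i _; rewrite dotC. Qed.

Lemma dot_gt0 u : u != 0 -> 0 < dot u u.
Proof. exact: neq0_dnorm_gt0. Qed.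

Lemma dot_eq0P u : (forall v, dot v u = 0) -> u = 0.
Proof. by move=> u0; apply/eqP/negPn/negP => /dot_gt0; rewrite u0 ltxx. Qed.

Lemma reflectionE a v : reflection dot a v = v - dot (coroot dot a) v *: a.
Proof.
(* [linfun] is known to return the given map only once that map is linear, hence the bundled [f]. *)
have lin : linear (fun v => v - dot (coroot dot a) v *: a).
  by move=> c u w; rewrite dotDr dotZr scalerDl scalerBr scalerA opprD addrACA.
pose A := GRing.isLinear.Build _ _ _ _ _ lin.
pose f : {linear V -> V} := HB.pack (fun v => v - dot (coroot dot a) v *: a) A.
exact: (lfunE f).
Qed.

Lemma dot_coroot a : a != 0 -> dot (coroot dot a) a = 2.
Proof. by move=> a0; rewrite /coroot dotZl divfK // gt_eqF ?dot_gt0. Qed.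

Lemma corootK a : a != 0 -> coroot dot (coroot dot a) = a.
Proof.
move=> a0; have d0 : dot a a != 0 by rewrite gt_eqF ?dot_gt0.
rewrite /coroot !(dotZl, dotZr) scalerA (_ : _ * _ = 1) ?scale1r //; field.
by [].
Qed.

Lemma corootN a : coroot dot (- a) = - coroot dot a.
Proof. by rewrite /coroot dotNl dotNr opprK scalerN. Qed.

Lemma reflection_root a : a != 0 -> reflection dot a a = - a.
Proof.
by move=> a0; rewrite reflectionE dot_coroot // scaler_nat mulr2n opprD addrA subrr sub0r.
Qed.

Lemma reflectionK a : a != 0 -> involutive (reflection dot a).
Proof.
move=> a0 v; rewrite !reflectionE dotDr dotNr dotZr dot_coroot //.
set d := dot _ v; rewrite -addrA -opprD -scalerDl.
by rewrite (_ : d + (d - d * 2) = 0) ?scale0r ?subr0 //; ring.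
Qed.

Definition isometric (w : 'End(V)) := forall u v, dot (w u) (w v) = dot u v.

Lemma reflection_isometric a : a != 0 -> isometric (reflection dot a).
Proof.
move=> a0 u v; rewrite !reflectionE !(dotDl, dotDr, dotNl, dotNr, dotZl, dotZr).
have d0 : dot a a != 0 by rewrite gt_eqF ?dot_gt0.
by rewrite /coroot ?dotZl (dotC u a); field.
Qed.

Lemma isometric_lker0 w : isometric w -> lker w == 0%VS.
Proof.
move=> iw; apply/lker0P => u v uv; apply/eqP; rewrite -subr_eq0; apply/eqP.
apply: dot_eq0P => x; rewrite -iw linearB /= uv subrr dot0r //.
Qed.

Lemma isometric_coroot w a : isometric w -> coroot dot (w a) = w (coroot dot a).
Proof. by move=> iw; rewrite /coroot iw linearZ. Qed.

Lemma isometric_reflection w a v : isometric w ->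
  w (reflection dot a v) = reflection dot (w a) (w v).
Proof.
by move=> iw; rewrite !reflectionE linearB linearZ /= isometric_coroot // iw.
Qed.

Context {r : nat} (D : {fset V}) (Psi : r.-tuple V) (lam : 'I_r -> V).
Implicit Types J : {set 'I_r}.
Hypothesis hD : reduced_root_system dot D.
Hypothesis hPsi : fundamental_system D Psi.

Local Notation al i := (tnth Psi i).
Local Notation co := (coroot dot).
Local Notation "''c_' i a" := (coord Psi i a) (at level 10, i at level 2, a at level 8).

Lemma root_neq0 a : a \in D -> a != 0.
Proof. by apply: contraTneq => ->; exact: roots_neq0 hD. Qed.

Lemma simple_root i : al i \in D.
Proof. by apply: (fundamental_roots hPsi); rewrite mem_tnth. Qed.

Lemma simple_neq0 i : al i != 0.
Proof. exact/root_neq0/simple_root. Qed.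

Lemma opp_root a : a \in D -> - a \in D.
Proof.
move=> aD; rewrite -reflection_root ?root_neq0 //.
exact: (roots_reflection hD).
Qed.

Lemma coord_simple i j : 'c_i (al j) = (i == j)%:R.
Proof.
rewrite (tnth_nth 0) coord_free //.
  by rewrite eq_sym.
exact: basis_free (fundamental_basis hPsi).
Qed.

Lemma coord_sum v : v = \sum_i 'c_i v *: al i.
Proof.
rewrite {1}(coord_basis (fundamental_basis hPsi) (memvf v)).
by apply: eq_bigr => i _; rewrite (tnth_nth 0).
Qed.

Lemma coord_ext u v : (forall i, 'c_i u = 'c_i v) -> u = v.
Proof. by move=> uv; rewrite (coord_sum u) (coord_sum v); under eq_bigr do rewrite uv. Qed.

(** * Signs of roots and simple reflections *)

Definition positive a := [forall i, 0 <= 'c_i a].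

Lemma root_sign a : a \in D ->
  (forall i, 'c_i a \is a Num.nat) \/ (forall i, 'c_i (- a) \is a Num.nat).
Proof.
by move=> /(fundamental_sign hPsi)[h|h]; [left|right] => i; rewrite ?linearN; exact: h.
Qed.

Lemma positiveN a : a \in D -> positive (- a) = ~~ positive a.
Proof.
move=> aD; apply/idP/idP => [/forallP pNa|].
  apply/negP => /forallP pa; have := root_neq0 aD; rewrite (_ : a = 0) ?eqxx //.
  apply: coord_ext => i; rewrite linear0; apply/eqP; rewrite eq_le pa andbT.
  by have := pNa i; rewrite linearN oppr_ge0.
have [h|h] := root_sign aD.
  by rewrite (_ : positive a) //; apply/forallP => i; exact: natr_ge0.
by move=> _; apply/forallP => i; exact: natr_ge0.
Qed.

Lemma positive_root a : a \in D -> (exists i, 0 < 'c_i a) -> positive a.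
Proof.
move=> aD [i ai]; rewrite -[positive a]negbK -positiveN //.
by apply/negP => /forallP/(_ i); rewrite linearN oppr_ge0 leNgt ai.
Qed.

Lemma positive_simple i : positive (al i).
Proof. by apply/forallP => j; rewrite coord_simple ler0n. Qed.

Lemma positive_coord_gt0 a : a \in D -> positive a -> exists i, 0 < 'c_i a.
Proof.
move=> aD /forallP pa; apply/existsP; apply: contraT; rewrite negb_exists => /forallP h.
have := root_neq0 aD; rewrite (_ : a = 0) ?eqxx //; apply: coord_ext => i.
by rewrite linear0; apply/eqP; rewrite eq_le pa andbT leNgt h.
Qed.

(* [coroot_coeff a i] is the coefficient of the simple coroot [al i]^vee in [a]^vee. *)
Definition coroot_coeff a i := 'c_i a * dot (al i) (al i) / dot a a.

Lemma coroot_sum a : co a = \sum_i coroot_coeff a i *: co (al i).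
Proof.
rewrite {1}/coroot {3}(coord_sum a) scaler_sumr; apply: eq_bigr => i _.
rewrite /coroot !scalerA; congr (_ *: _); rewrite /coroot_coeff.
have [->|a0] := eqVneq a 0; first by rewrite (linear0 (coord Psi i)) !mul0r mulr0.
have d0 : dot a a != 0 by rewrite gt_eqF ?dot_gt0.
have di : dot (al i) (al i) != 0 by rewrite gt_eqF ?dot_gt0 ?simple_neq0.
by field; rewrite d0 di.
Qed.

Lemma dot_coroot_sum a v : dot (co a) v = \sum_i coroot_coeff a i * dot (co (al i)) v.
Proof. by rewrite coroot_sum dot_suml; under eq_bigr do rewrite dotZl. Qed.

Lemma coroot_coeff_ge0 a i : a \in D -> positive a -> 0 <= coroot_coeff a i.
Proof.
move=> aD /forallP pa.
have h u : u \in D -> 0 <= dot u u by move=> uD; apply/ltW/dot_gt0/root_neq0.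
apply: divr_ge0; last exact: h.
by apply: mulr_ge0; [exact: pa|exact/h/simple_root].
Qed.

Lemma coroot_coeff_gt0 a i : a \in D -> 0 < 'c_i a -> 0 < coroot_coeff a i.
Proof.
have h u : u \in D -> 0 < dot u u by move=> uD; apply/dot_gt0/root_neq0.
move=> aD ai; apply: divr_gt0; last exact: h.
by apply: mulr_gt0; [|exact/h/simple_root].
Qed.

Lemma coord_reflection i j a :
  'c_i (reflection dot (al j) a) = 'c_i a - dot (co (al j)) a * (i == j)%:R.
Proof. by rewrite reflectionE linearB linearZ /= coord_simple. Qed.

Lemma reflection_simple_root j a : a \in D -> reflection dot (al j) a \in D.
Proof. exact: roots_reflection hD _ _ (simple_root j). Qed.

(* Membership in the span of the simple roots indexed by [J], in coordinates. *)
Definition supported (J : {set 'I_r}) a := [forall i, (i \notin J) ==> ('c_i a == 0)].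

Lemma supportedP J a :
  reflect (forall i, i \notin J -> 'c_i a = 0) (supported J a).
Proof.
by apply: (iffP forallP) => h i; [move=> iJ; apply/eqP/(implyP (h i))|apply/implyP=> /h ->].
Qed.

Lemma mem_parabolic_roots J a :
  (a \in parabolic_roots D Psi J) = (a \in D) && supported J a.
Proof.
rewrite !inE /=; congr (_ && _); apply/idP/supportedP.
  move=> aJ i iJ; have /coord_span -> := aJ.
  rewrite linear_sum big1 // => k _; rewrite linearZ /=.
  set x := _`_k; have : x \in [seq al i | i in J].
    by apply: mem_nth; rewrite (leq_trans (ltn_ord k)) // size_image.
  case/mapP => j; rewrite mem_enum => jJ ->; rewrite coord_simple; case: eqP iJ => [->|];
    by rewrite ?jJ // mulr0.
move=> h; suff : \sum_i 'c_i a *: al i \in <<[seq al i | i in J]>>%VS.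
  by rewrite -coord_sum.
apply: rpred_sum => i _.
have [iJ|iJ] := boolP (i \in J); last by rewrite h // scale0r rpred0.
by rewrite rpredZ // memv_span //; apply/mapP; exists i; rewrite ?mem_enum.
Qed.

Lemma supported_simple J j : supported J (al j) = (j \in J).
Proof.
apply/supportedP/idP => [h|jJ i iJ].
  by apply: contraT => /h /eqP; rewrite coord_simple eqxx oner_eq0.
by rewrite coord_simple; case: eqP iJ => // ->; rewrite jJ.
Qed.

Lemma supportedN J a : supported J (- a) = supported J a.
Proof.
by apply: eq_forallb => i; rewrite linearN oppr_eq0.
Qed.

Lemma supported_reflection J j a : j \in J -> supported J a ->
  supported J (reflection dot (al j) a).
Proof.
move=> jJ /supportedP h; apply/supportedP => i iJ; rewrite coord_reflection h //.
by case: eqP iJ => [->|]; rewrite ?jJ // mulr0 subr0.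
Qed.

(** Reducedness enters here: a positive root other than [al j] is not a multiple of [al j], so it
    has a positive coordinate away from [j], which the reflection leaves unchanged. *)
Lemma simple_reflection_positive j a : a \in D -> positive a -> a != al j ->
  positive (reflection dot (al j) a).
Proof.
move=> aD pa aj; apply: positive_root; first exact: reflection_simple_root.
have [i /andP[ij ai]] : exists i, (i != j) && (0 < 'c_i a).
  apply/existsP; apply: contraT; rewrite negb_exists => /forallP h.
  have ea : a = 'c_j a *: al j.
    apply: coord_ext => i; rewrite linearZ /= coord_simple.
    have [->|ij] := eqVneq i j; first by rewrite mulr1.
    rewrite mulr0; apply/eqP; rewrite eq_le (forallP pa) andbT leNgt.
    by have := h i; rewrite ij.
  have := aD; rewrite ea => /(roots_reduced hD (simple_root j)) [c1|c1].
    by rewrite ea c1 scale1r eqxx in aj.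
  by have /forallP/(_ j) := pa; rewrite c1 ler0N1.
by exists i; rewrite coord_reflection (negPf ij) mulr0 subr0.
Qed.

(** Otherwise [dot a a], expanded along the simple roots of [J] in its left argument, would be a sum
    of nonpositive terms. *)
Lemma exists_descent J a : a \in D -> positive a -> supported J a ->
  exists2 i, i \in J & 0 < dot (co (al i)) a.
Proof.
move=> aD /forallP pa /supportedP sa; apply/exists_inP; apply: contraT.
rewrite negb_exists_in => /forall_inP h.
have := dot_gt0 (root_neq0 aD); rewrite ltNge => /negP[].
rewrite [X in dot X a]coord_sum dot_suml sumr_le0 // => i _; rewrite dotZl.
have [iJ|iJ] := boolP (i \in J); last by rewrite sa // mul0r.
have := h i iJ; rewrite -leNgt /coroot dotZl pmulr_rle0; last first.
  by rewrite divr_gt0 ?dot_gt0 ?simple_neq0.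
by move=> ?; rewrite mulr_ge0_le0.
Qed.

(** * Words in the simple reflections *)

Definition wprod (t : seq 'I_r) : 'End(V) :=
  foldr (fun i f => (reflection dot (al i) \o f)%VF) \1%VF t.

Lemma wprod_nil v : wprod [::] v = v.
Proof. by rewrite /= id_lfunE. Qed.

Lemma wprod_cons i t v : wprod (i :: t) v = reflection dot (al i) (wprod t v).
Proof. by rewrite /= comp_lfunE. Qed.

Lemma wprod_cat t t' v : wprod (t ++ t') v = wprod t (wprod t' v).
Proof. by elim: t => [|i t IH]; rewrite ?wprod_nil // cat_cons !wprod_cons IH. Qed.

Lemma wprod1 i v : wprod [:: i] v = reflection dot (al i) v.
Proof. by rewrite wprod_cons wprod_nil. Qed.

Lemma wprod_isometric t : isometric (wprod t).
Proof.
elim: t => [|i t IH] u v; first by rewrite !wprod_nil.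
by rewrite !wprod_cons reflection_isometric ?IH ?simple_neq0.
Qed.

Lemma wprod_revK t v : wprod (rev t) (wprod t v) = v.
Proof.
elim: t v => [|i t IH] v; first by rewrite !wprod_nil.
by rewrite rev_cons -cats1 wprod_cat wprod1 wprod_cons reflectionK ?simple_neq0.
Qed.

Lemma wprod_Krev t v : wprod t (wprod (rev t) v) = v.
Proof. by rewrite -{1}(revK t) wprod_revK. Qed.

Lemma wprod_inv t : (wprod t)^-1%VF = wprod (rev t).
Proof.
apply/lfunP => v; have k0 := isometric_lker0 (wprod_isometric t).
by rewrite -{1}(wprod_Krev t v) lker0_lfunK.
Qed.

Lemma wprod_root t a : a \in D -> wprod t a \in D.
Proof.
move=> aD; elim: t => [|i t IH]; first by rewrite wprod_nil.
by rewrite wprod_cons reflection_simple_root.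
Qed.

Definition word_in (J : {set 'I_r}) (t : seq 'I_r) := all (mem J) t.

Lemma wprod_supported J t a : word_in J t -> supported J a -> supported J (wprod t a).
Proof.
move=> + sa; elim: t => [|i t IH]; first by rewrite wprod_nil.
by move=> /= /andP[iJ /IH]; rewrite wprod_cons; exact: supported_reflection.
Qed.

(** Induction on the height: the reflection found by [exists_descent] lowers it by a positive
    integer, and the root stays positive unless it is already the simple root of that reflection. *)
Lemma positive_root_conj J a : a \in D -> positive a -> supported J a ->
  exists t j, [/\ word_in J t, j \in J & a = wprod t (al j)].
Proof.
pose ht (a : V) := \sum_i 'c_i a.
have [n] : exists n : nat, ht a < n%:R.
  by exists (Num.truncn (ht a)).+1; exact: truncnS_gt.
elim: n a => [|n IH] a.
  move=> h0 aD /forallP pa; suff : 0 <= ht a by rewrite leNgt h0.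
  by apply: sumr_ge0.
move=> han aD pa sa; have [i iJ ia] := exists_descent aD pa sa.
have [ai|ai] := eqVneq a (al i).
  by exists [::], i; rewrite wprod_nil.
have bD := reflection_simple_root i aD.
have pb := simple_reflection_positive aD pa ai.
have sb := supported_reflection iJ sa.
have [||||t [j [tJ jJ e]]] := IH (reflection dot (al i) a); rewrite //.
  have -> : ht (reflection dot (al i) a) = ht a - dot (co (al i)) a.
    rewrite /ht; under eq_bigr do rewrite coord_reflection.
    rewrite big_split /= sumrN -mulr_sumr; congr (_ - _).
    rewrite (bigD1 i) //= eqxx big1 ?addr0 ?mulr1 //.
    by move=> j /negPf ->.
  have : 1 <= dot (co (al i)) a.
    have /intrP[m em] := roots_integral hD (simple_root i) aD.
    by move: ia; rewrite em -[0]/(0%:~R) ltr_int -[1]/(1%:~R) ler_int.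
  by move: han; rewrite -natr1; lra.
exists (i :: t), j; split=> //=; first by rewrite iJ.
by rewrite wprod_cons -e reflectionK ?simple_neq0.
Qed.

Lemma coroot_coeff_simple i j : coroot_coeff (al j) i = (i == j)%:R.
Proof.
rewrite /coroot_coeff coord_simple; case: eqP => [->|]; last by rewrite !mul0r.
by rewrite mul1r divff // gt_eqF ?dot_gt0 ?simple_neq0.
Qed.

(** Up to sign a root is the image of a simple root under a word, and a letter [k] changes only the
    coefficient at [k], by an integer multiple of a Cartan integer. This is what makes every pairing
    of a coroot with a weight an integer. *)
Lemma coroot_coeff_int a i : a \in D -> coroot_coeff a i \is a Num.int.
Proof.
have ccN b : coroot_coeff (- b) i =
  - coroot_coeff b i by rewrite /coroot_coeff linearN dotNl dotNr opprK !mulNr.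
wlog pa : a / positive a => [hw aD|aD].
  have [|pa] := boolP (positive a); first by move=> /hw; exact.
  by rewrite -[a]opprK ccN rpredN hw ?positiveN ?opp_root.
have sT : supported [set: 'I_r]%SET a by apply/supportedP => j; rewrite inE.
have [t [j [_ _ ->]]] := positive_root_conj aD pa sT.
elim: t => [|k t IH]; first by rewrite wprod_nil coroot_coeff_simple; case: eqP.
rewrite wprod_cons; set b := wprod t (al j) in IH *.
have bD : b \in D by rewrite wprod_root ?simple_root.
have b0 : dot b b != 0 by rewrite gt_eqF ?dot_gt0 ?root_neq0.
have k0 : dot (al k) (al k) != 0 by rewrite gt_eqF ?dot_gt0 ?simple_neq0.
have -> : coroot_coeff (reflection dot (al k) b) i =
  coroot_coeff b i - (i == k)%:R * dot (co b) (al k).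
  rewrite /coroot_coeff coord_reflection reflection_isometric ?simple_neq0 //.
  have [->|ik] := eqVneq i k; last by rewrite mul0r mulr0 !subr0.
  by rewrite mulr1 mul1r /coroot !dotZl (dotC b); field; rewrite b0 k0.
rewrite rpredB // rpredM ?(roots_integral hD) ?simple_root //; exact: natr_int.
Qed.

(** * Dominant vectors and the exchange condition *)

Definition dominant J v := forall j, j \in J -> 0 < dot (co (al j)) v.

Lemma dominant_coroot_gt0 J a v : dominant J v -> a \in D -> positive a ->
  supported J a -> 0 < dot (co a) v.
Proof.
move=> dv aD pa /supportedP sa; rewrite dot_coroot_sum.
have [i ai] := positive_coord_gt0 aD pa.
have iJ : i \in J by apply: contraTT ai => /sa ->; rewrite ltxx.
rewrite (bigD1 i) //=; apply: ltr_pwDl; first by apply: mulr_gt0;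
  [exact: coroot_coeff_gt0|exact: dv].
apply: sumr_ge0 => j _; have [jJ|jJ] := boolP (j \in J).
  by rewrite mulr_ge0 ?coroot_coeff_ge0 // ltW // dv.
by rewrite /coroot_coeff sa // !mul0r.
Qed.

(** Pairings are transported by isometries while signs are not; reading a sign off a pairing is how
    the signs of images of roots are computed later. *)
Lemma dominant_positive J a v : dominant J v -> a \in D -> supported J a ->
  positive a = (0 < dot (co a) v).
Proof.
move=> dv aD sa; have [pa|] := boolP (positive a).
  by rewrite (dominant_coroot_gt0 dv).
rewrite -positiveN // => pNa; apply/esym/negbTE; rewrite -leNgt.
have := dominant_coroot_gt0 dv (opp_root aD) pNa.
by rewrite supportedN => /(_ sa); rewrite corootN dotNl oppr_gt0 => /ltW.
Qed.

Lemma dot_reflection_coroot a b v : b != 0 ->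
  dot (co a) (reflection dot b v) = dot (co (reflection dot b a)) v.
Proof.
move=> b0; rewrite -{2}(reflectionK b0 v) isometric_coroot ?reflection_isometric //.
exact: reflection_isometric.
Qed.

(** A simple reflection permutes the positive roots other than its own. Reflecting at a simple root
    that is negative on [v] thus strictly decreases the number of positive roots supported on [J]
    that are negative on [v]. *)
Lemma dominant_conj J v :
  (forall a, a \in D -> supported J a -> dot (co a) v != 0) ->
  exists2 t, word_in J t & dominant J (wprod t v).
Proof.
pose N v := [fset a in D | [&& positive a, supported J a & dot (co a) v < 0]]%fset.
have [n] : exists n, (#|` N v| < n)%N by exists #|` N v|.+1.
elim: n v => // n IH v nv reg.
have [/forall_inP h|] := boolP [forall (j | j \in J), 0 < dot (co (al j)) v].
  by exists [::] => // j /h; rewrite wprod_nil.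
rewrite negb_forall_in => /exists_inP[j jJ]; rewrite -leNgt => jv.
have j0 := simple_neq0 j.
have {}jv : dot (co (al j)) v < 0.
  by rewrite lt_neqAle jv andbT reg ?simple_root // supported_simple.
have [|a aD sa|t tJ dt] := IH (reflection dot (al j) v).
- rewrite -ltnS; apply: leq_trans nv; rewrite ltnS.
  have jN : al j \in N v.
    by rewrite !inE simple_root positive_simple supported_simple jJ jv.
  rewrite (cardfsD1 (al j) (N v)) jN add1n ltnS.
  set s := reflection dot (al j).
  have sI : injective s by exact: can_inj (reflectionK j0).
  have <- : #|` [fset s a | a in N (s v)]%fset| = #|` N (s v)| by rewrite card_imfset.
  apply: fsubset_leq_card; apply/fsubsetP => b /imfsetP[a /=].
  rewrite !inE /= => /and4P[aD pa sa av] ->.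
  rewrite reflection_simple_root // supported_reflection //.
  have aj : a != al j.
    apply: contraTneq av => ->.
    by rewrite dot_reflection_coroot // reflection_root // corootN dotNl oppr_lt0 -leNgt
      ltW.
  rewrite simple_reflection_positive //= -dot_reflection_coroot // av !andbT.
  apply: contraTneq pa => /(congr1 s); rewrite /s reflectionK // => ->.
  by rewrite reflection_root // positiveN ?simple_root // positive_simple.
- by rewrite dot_reflection_coroot // reg ?reflection_simple_root ?supported_reflection.
exists (t ++ [:: j]); first by rewrite /word_in all_cat; apply/andP; split=> //=;
  rewrite jJ.
by move=> i /dt; rewrite wprod_cat wprod1.
Qed.

(* The exchange condition: a letter can be deleted from a word whose product
   sends a simple root to a negative one. *)
Lemma exchange J t i : word_in J t -> ~~ positive (wprod t (al i)) ->
  exists t', [/\ word_in J t', (size t' < size t)%N &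
    forall v, wprod t (reflection dot (al i) v) = wprod t' v].
Proof.
elim: t => [|j t IH]; first by rewrite wprod_nil positive_simple.
move=> /= /andP[jJ tJ]; rewrite wprod_cons => neg.
have [pt|/(IH tJ)[t' [t'J ts e]]] := boolP (positive (wprod t (al i))); last first.
  by exists (j :: t'); split=> //=; [rewrite jJ|move=> v; rewrite !wprod_cons e].
have tD : wprod t (al i) \in D by rewrite wprod_root ?simple_root.
exists t; split=> // v; rewrite wprod_cons.
have [ti|ti] := eqVneq (wprod t (al i)) (al j); last first.
  by rewrite (simple_reflection_positive tD pt ti) in neg.
rewrite isometric_reflection ?ti ?reflectionK ?simple_neq0 //.
exact: wprod_isometric.
Qed.

(** Remove the last letter [i] of the word: what remains sends [al i] to a negative root, so
    [exchange] yields a shorter word in [J] with the same product as the original one. *)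
Lemma wprod_positive_id J t : word_in J t ->
  (forall j, j \in J -> positive (wprod t (al j))) -> forall v, wprod t v = v.
Proof.
have [n] : exists n, (size t < n)%N by exists (size t).+1.
elim: n t => // n IH t; case/lastP: t => [|t i]; first by move=> *; rewrite wprod_nil.
rewrite size_rcons ltnS => tn; rewrite /word_in all_rcons => /andP[iJ tJ] pos v.
have ti : ~~ positive (wprod t (al i)).
  have := pos i iJ; rewrite -cats1 wprod_cat wprod1 reflection_root ?simple_neq0 //.
  by rewrite linearN positiveN // wprod_root ?simple_root.
have [t' [t'J ts e]] := exchange tJ ti.
have e' u : wprod (rcons t i) u = wprod t' u by rewrite -cats1 wprod_cat wprod1 e.
rewrite e' IH //; first exact: ltn_trans ts tn.
by move=> j /pos; rewrite e'.
Qed.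

(** A root is the image of a simple root under a word, so its reflection is that word, one letter,
    and the word reversed; reversal also gives inverses. *)
Lemma reflection_group_words J w :
  reflection_group dot (parabolic_roots D Psi J) w <->
  exists2 t, word_in J t & w = wprod t.
Proof.
split=> [|[t tJ ->]].
  elim=> {w} [|a|v w _ [t tJ ->] _ [t' t'J ->]|w _ [t tJ ->]].
  - by exists [::].
  - rewrite mem_parabolic_roots => /andP[aD sa].
    wlog pa : a aD sa / positive a => [hw|].
      have [|pa] := boolP (positive a); first exact: hw.
      have [||t tJ e] := hw _ (opp_root aD); rewrite ?supportedN ?positiveN //.
      exists t => //; rewrite -e; apply/lfunP => v.
      by rewrite !reflectionE corootN dotNl scalerN scaleNr opprK.
    have [t [j [tJ jJ ->]]] := positive_root_conj aD pa sa.
    exists (t ++ j :: rev t).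
      by rewrite /word_in all_cat /= all_rev; apply/and3P; split.
    apply/lfunP => v; rewrite -{1}(wprod_Krev t v) -isometric_reflection;
      last exact: wprod_isometric.
    by rewrite wprod_cat wprod_cons.
  - exists (t ++ t'); first by rewrite /word_in all_cat; apply/andP.
    by apply/lfunP => u; rewrite comp_lfunE wprod_cat.
  - exists (rev t); first by rewrite /word_in all_rev.
    exact: wprod_inv.
elim: t tJ => [|i t IH] /=; first by move=> _; exact: Refl1.
move=> /andP[iJ tJ]; apply: ReflM; last exact: IH.
by apply: ReflGen; rewrite mem_parabolic_roots simple_root supported_simple.
Qed.

Lemma supportedT a : supported [set: 'I_r]%SET a.
Proof. by apply/supportedP => j; rewrite inE. Qed.

Lemma parabolic_rootsT : parabolic_roots D Psi [set: 'I_r]%SET = D.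
Proof. by apply/fsetP => a; rewrite mem_parabolic_roots supportedT andbT. Qed.

Lemma reflection_groupP w :
  reflection_group dot D w <-> exists t, w = wprod t.
Proof.
rewrite -{1}parabolic_rootsT reflection_group_words.
by split=> -[t]; exists t => //; apply/allP => i; rewrite inE.
Qed.

Lemma mem_pos_roots a : (a \in pos_roots D Psi) = (a \in D) && positive a.
Proof. by rewrite !inE. Qed.

Lemma mem_neg_roots a : (a \in neg_roots D Psi) = (a \in D) && ~~ positive a.
Proof.
rewrite !inE; case: (boolP (a \in D)) => //= aD; rewrite -positiveN //.
by apply: eq_forallb => i; rewrite linearN oppr_ge0.
Qed.

Lemma mem_parabolic_pos_roots J a :
  (a \in parabolic_pos_roots D Psi J) = [&& a \in D, positive a & supported J a].
Proof.
by rewrite in_fsetI mem_parabolic_roots mem_pos_roots; case: (a \in D); rewrite //= andbC.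
Qed.

(** Taking coroots is involutive on nonzero vectors and commutes with isometries, which transfers
    the inclusion to roots. Simple roots suffice, the positive roots supported on [J] being
    nonnegative combinations of them. *)
Lemma parabolic_repsP J w :
  parabolic_reps dot D Psi J w <->
  exists2 t, w = wprod t & forall j, j \in J -> positive (wprod (rev t) (al j)).
Proof.
split=> [[/reflection_groupP[t ->] /fsubsetP h]|[t -> h]].
  exists t => // j jJ.
  have /h : co (al j) \in [fset co a | a in parabolic_pos_roots D Psi J]%fset.
    apply: in_imfset; rewrite /= mem_parabolic_pos_roots simple_root positive_simple.
    by rewrite supported_simple.
  case/imfsetP => a /=; rewrite mem_pos_roots => /andP[aD pa].
  rewrite -isometric_coroot; last exact: wprod_isometric.
  move/(congr1 co); rewrite !corootK ?simple_neq0 ?root_neq0 ?wprod_root // => ->.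
  by rewrite wprod_revK.
split; first by apply/reflection_groupP; exists t.
apply/fsubsetP => b /imfsetP[a /=]; rewrite mem_parabolic_pos_roots => /and3P[aD pa sa] ->.
apply/imfsetP; exists (wprod (rev t) a); last first.
  by rewrite /= -isometric_coroot ?wprod_Krev //; exact: wprod_isometric.
rewrite /= mem_pos_roots wprod_root //.
rewrite (coord_sum a) linear_sum; apply/forallP => i /=; rewrite linear_sum.
apply: sumr_ge0 => j _; rewrite !linearZ /=; have [jJ|jJ] := boolP (j \in J).
  by rewrite mulr_ge0 ?(forallP pa) ?(forallP (h _ jJ)).
by rewrite (supportedP _ _ sa) // mul0r.
Qed.

(** * Weights, chambers and coset representatives *)

Hypothesis hlam : fundamental_weights dot Psi lam.

(** The difference of the two sides is orthogonal to every simple root, and these form a basis. *)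
Lemma weight_sum v : v = \sum_i dot (co (al i)) v *: lam i.
Proof.
apply/eqP; rewrite -subr_eq0; apply/eqP/dot_eq0P => u.
have h i : dot (al i) (v - \sum_j dot (co (al j)) v *: lam j) = 0.
  have c0 : 2 / dot (al i) (al i) != 0.
    by rewrite mulf_neq0 // invr_eq0 gt_eqF // dot_gt0 // simple_neq0.
  apply: (mulfI c0); rewrite mulr0 -dotZl -/(co (al i)) dotDr dotNr dot_sumr.
  rewrite (bigD1 i) //= dotZr hlam eqxx mulr1 big1 ?addr0 ?subrr // => j /negPf ji.
  by rewrite dotZr hlam eq_sym ji mulr0.
by rewrite (coord_sum u) dot_suml big1 // => i _; rewrite dotZl h mulr0.
Qed.

Lemma mem_weight_lattice v :
  weight_lattice lam v <-> forall i, dot (co (al i)) v \is a Num.int.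
Proof.
split=> [[m ->] i|h].
  rewrite dot_sumr rpred_sum // => j _.
  by rewrite -scaler_int dotZr rpredM ?intr_int // hlam natr_int.
exists (fun i => Num.floor (dot (co (al i)) v)).
rewrite [LHS]weight_sum; apply: eq_bigr => i _.
by rewrite -scaler_int floorK.
Qed.

Lemma dot_coroot_int a v : a \in D -> weight_lattice lam v ->
  dot (co a) v \is a Num.int.
Proof.
move=> aD /mem_weight_lattice h; rewrite dot_coroot_sum rpred_sum // => i _.
by rewrite rpredM ?coroot_coeff_int.
Qed.

Lemma wprod_weight_lattice t v : weight_lattice lam v -> weight_lattice lam (wprod t v).
Proof.
move=> /mem_weight_lattice h; apply/mem_weight_lattice => i.
rewrite -(wprod_Krev t (co (al i))) wprod_isometric -isometric_coroot;
  last exact: wprod_isometric.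
by apply: dot_coroot_int; rewrite ?wprod_root ?simple_root //; exact/mem_weight_lattice.
Qed.

Lemma mem_regular_dominant_weights v :
  regular_dominant_weights lam v <->
  weight_lattice lam v /\ dominant [set: 'I_r]%SET v.
Proof.
have e (m : 'I_r -> int) i : dot (co (al i)) (\sum_j lam j *~ m j) = (m i)%:~R.
  rewrite dot_sumr (bigD1 i) //= -scaler_int dotZr hlam eqxx mulr1 big1 ?addr0 //.
  by move=> j /negPf ji; rewrite -scaler_int dotZr hlam eq_sym ji mulr0.
split=> [[m hm ->]|[[m ->] d]].
  split; first by exists m.
  by move=> i _; rewrite e ltr0z (lt_le_trans _ (hm i)).
by exists m => // i; have := d i (finset.in_setT i); rewrite e ltr0z.
Qed.

(* The domain of summation of [zetaS]. *)
Definition half_regular_weights J : set V :=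
  [set v | [/\ weight_lattice lam v,
              {in J, forall i, 0 <= dot (co (al i)) v} &
              {in D, forall a, dot (co a) v != 0}]].

(** If the word [t] makes [v] dominant, the coroot of [al j] is positive on [v] exactly when the
    root [wprod t (al j)] is positive, and for [j] in [J] this is the condition for [wprod (rev t)]
    to be a representative. *)
Lemma half_regular_decomposition J :
  half_regular_weights J =
  \bigcup_(w in parabolic_reps dot D Psi J) (w @` regular_dominant_weights lam).
Proof.
apply/seteqP; split=> v.
  move=> [vP vJ reg].
  have [|t _ dt] := @dominant_conj [set: 'I_r]%SET v; first by move=> a aD _; exact: reg.
  exists (wprod (rev t)).
    apply/parabolic_repsP; exists (rev t) => // j jJ; rewrite revK.
    rewrite (dominant_positive dt) ?supportedT ?wprod_root ?simple_root //.
    rewrite isometric_coroot ?wprod_isometric; last exact: wprod_isometric.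
    by rewrite lt_neqAle vJ // andbT eq_sym reg ?simple_root.
  exists (wprod t v); last by rewrite wprod_revK.
  by apply/mem_regular_dominant_weights; split=> //; exact: wprod_weight_lattice.
move=> [w /parabolic_repsP[t -> h]] [u /mem_regular_dominant_weights[uP du] <-].
have e a : dot (co a) (wprod t u) = dot (co (wprod (rev t) a)) u.
  rewrite -{1}(wprod_Krev t a) isometric_coroot ?wprod_isometric //.
  exact: wprod_isometric.
split=> [|j jJ|a aD].
- exact: wprod_weight_lattice.
- by rewrite e ltW // (dominant_coroot_gt0 du) ?supportedT ?h ?wprod_root ?simple_root.
- rewrite e; have aD' := wprod_root (rev t) aD.
  have := dominant_positive du aD' (supportedT _).
  have := dominant_positive du (opp_root aD') (supportedT _).
  rewrite positiveN // corootN dotNl oppr_gt0.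
  by case: (positive _) => h1 h2; [rewrite gt_eqF -?h2|rewrite lt_eqF -?h1].
Qed.

(** The action on the open chamber is free: an element carrying a dominant vector to a dominant
    vector keeps every simple root positive, hence is the identity. *)
Lemma dominant_wprod_inj t t' u u' :
  dominant [set: 'I_r]%SET u -> dominant [set: 'I_r]%SET u' ->
  wprod t u = wprod t' u' -> wprod t = wprod t'.
Proof.
move=> du du' e.
have e' : wprod (rev t' ++ t) u = u' by rewrite wprod_cat e wprod_revK.
apply/lfunP => v; rewrite -{1}(wprod_Krev t' (wprod t v)) -(wprod_cat (rev t')).
suff -> : wprod (rev t' ++ t) v = v by [].
apply: (@wprod_positive_id [set: 'I_r]%SET) => [|j _].
  by apply/allP => i; rewrite inE.
rewrite (dominant_positive du') ?supportedT ?wprod_root ?simple_root //.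
rewrite isometric_coroot -?e' ?wprod_isometric ?du ?inE //; exact: wprod_isometric.
Qed.

Lemma reps_trivIset J : trivIset (parabolic_reps dot D Psi J)
  (fun w : 'End(V) => w @` regular_dominant_weights lam).
Proof.
move=> w w' /parabolic_repsP[t -> _] /parabolic_repsP[t' -> _].
move=> [v [[u /mem_regular_dominant_weights[_ du] <-]]].
by move=> [u' /mem_regular_dominant_weights[_ du'] /esym]; exact: dominant_wprod_inj.
Qed.

Lemma finite_parabolic_reps J : finite_set (parabolic_reps dot D Psi J).
Proof.
(* An element is determined by the images of the simple roots, which lie in the finite set [D];
   [insub] turns them into members of a finite type. *)
pose f (w : 'End(V)) : {ffun 'I_r -> option D} := [ffun i => insub (w (al i))].
have fI : {in parabolic_reps dot D Psi J &, injective f}.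
  move=> w w' /set_mem/parabolic_repsP[t -> _] /set_mem/parabolic_repsP[t' -> _] e.
  apply/lfunP => v; rewrite (coord_sum v) !linear_sum; apply: eq_bigr => i _.
  rewrite !linearZ; congr (_ *: _); have := congr1 (fun g : {ffun _ -> _} => g i) e.
  rewrite !ffunE => /(congr1 (omap val)).
  have tD q : wprod q (al i) \in D by rewrite wprod_root ?simple_root.
  by rewrite (insubT (fun x => x \in D) (tD t)) (insubT (fun x => x \in D) (tD t')) => -[].
by apply: card_le_finite (finite_finset (X := f @` parabolic_reps dot D Psi J));
  rewrite (card_le_eqr (inj_card_eq fI)).
Qed.

(** The vector [mu] is regular, so its image under [t] can be made [J]-dominant by a word [u] in
    [J], and [u ++ t] is then a representative in the coset of [t]. Two representatives of one coset
    differ by an element of the parabolic subgroup that keeps the simple roots of [J] positive,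
    hence by the identity. *)
Lemma parabolic_reps_cosets J :
  (parabolic_reps dot D Psi J #=
   right_cosets (reflection_group dot (parabolic_roots D Psi J))
                (reflection_group dot D))%card.
Proof.
set H := reflection_group dot (parabolic_roots D Psi J).
pose f (w : 'End(V)) : set 'End(V) := [set (h \o w)%VF | h in H].
have -> : right_cosets H (reflection_group dot D) = f @` parabolic_reps dot D Psi J.
  apply/seteqP; split=> X [w].
    move=> /reflection_groupP[t ->] <-.
    pose mu := \sum_i lam i.
    have dmu : dominant [set: 'I_r]%SET mu.
      move=> j _; rewrite dot_sumr (bigD1 j) //= hlam eqxx big1 ?addr0 // => i.
      by rewrite hlam eq_sym => /negPf ->.
    have [|u uJ du] := @dominant_conj J (wprod t mu).
      move=> a aD sa; rewrite -(wprod_Krev t (co a)) wprod_isometric -isometric_coroot;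
        last exact: wprod_isometric.
      have aD' := wprod_root (rev t) aD.
      have := dominant_positive dmu aD' (supportedT _).
      have := dominant_positive dmu (opp_root aD') (supportedT _).
      rewrite positiveN // corootN dotNl oppr_gt0.
      by case: (positive _) => h1 h2; [rewrite gt_eqF -?h2|rewrite lt_eqF -?h1].
    exists (wprod (u ++ t)).
      apply/parabolic_repsP; exists (u ++ t) => // j jJ.
      rewrite (dominant_positive dmu) ?supportedT ?wprod_root ?simple_root //.
      rewrite isometric_coroot; last exact: wprod_isometric.
      by rewrite -(wprod_isometric (u ++ t)) wprod_Krev wprod_cat du.
    apply/seteqP; split=> _ [h hH <-].
      exists (h \o wprod u)%VF; last first.
        by apply/lfunP => v; rewrite !comp_lfunE wprod_cat.
      apply: ReflM => //; apply/reflection_group_words; by exists u.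
    exists (h \o wprod (rev u))%VF; last first.
      by apply/lfunP => v; rewrite !comp_lfunE wprod_cat wprod_revK.
    apply: ReflM => //; apply/reflection_group_words; exists (rev u) => //.
    by rewrite /word_in all_rev.
  by move=> [wW _] <-; exists w.
rewrite card_eq_sym; apply: inj_card_eq => w w' /set_mem/parabolic_repsP[t -> pt].
move=> /set_mem/parabolic_repsP[t' -> pt'] e.
have : f (wprod t') (wprod t).
  rewrite -e; exists \1%VF; first exact: Refl1.
  by apply/lfunP => v; rewrite comp_lfunE id_lfunE.
move=> [h /reflection_group_words[u uJ ->] eu].
suff hu v : wprod (rev u) v = v.
  by rewrite -eu; apply/lfunP => v; rewrite comp_lfunE -[LHS]hu wprod_revK.
apply: (@wprod_positive_id J) => [|j jJ]; first by rewrite /word_in all_rev.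
have e2 x : wprod (rev t) x = wprod (rev t') (wprod (rev u) x).
  have ex : x = wprod t (wprod (rev t') (wprod (rev u) x)).
    by rewrite -eu comp_lfunE !wprod_Krev.
  by rewrite {1}ex wprod_revK.
set b := wprod (rev u) (al j).
have bD : b \in D by rewrite wprod_root ?simple_root.
have sb : supported J b.
  by apply: wprod_supported; rewrite ?supported_simple // /word_in all_rev.
have pj := pt j jJ; rewrite e2 -/b in pj.
(* If [b] were negative, [- b] would be a nonnegative combination of the simple roots of [J], all of
   which [wprod (rev t')] makes positive, against [pj]. *)
apply: contraT => nb; have pNb : positive (- b) by rewrite positiveN.
have : positive (wprod (rev t') (- b)).
  rewrite (coord_sum (- b)) linear_sum; apply/forallP => i /=; rewrite linear_sum.
  apply: sumr_ge0 => k _; rewrite !linearZ /=; have [kJ|kJ] := boolP (k \in J).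
    by rewrite mulr_ge0 ?(forallP pNb) ?(forallP (pt' _ kJ)).
  by have := supportedN J b; rewrite sb => /supportedP -> //; rewrite mul0r.
have -> : wprod (rev t') (- b) = - wprod (rev t') b by exact: linearN.
by rewrite positiveN ?pj // wprod_root.
Qed.

End RootSystem.

(** * Nonvanishing of the Gamma function *)

Section GammaIntegrals.
Context {R : realType}.
Local Notation mu := (@lebesgue_measure R).
Local Notation P := (`]0, +oo[%classic : set R).
Implicit Types (b c t : R) (F f : R -> R).

Lemma integrable_scale (A : set R) f k : measurable A ->
  mu.-integrable A (EFin \o f) -> mu.-integrable A (EFin \o (fun t => k * f t)).
Proof.
move=> mA h; have q : mu.-integrable A (fun t => k%:E * (EFin \o f) t)%E by apply:
  integrableZl.
by apply: eq_integrable q.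
Qed.

Lemma integrable_add (A : set R) f g : measurable A ->
  mu.-integrable A (EFin \o f) -> mu.-integrable A (EFin \o g) ->
  mu.-integrable A (EFin \o (fun t => f t + g t)).
Proof.
move=> mA hf hg; have q : mu.-integrable A ((EFin \o f) \+ (EFin \o g))%E by apply:
  integrableD.
by apply: eq_integrable q.
Qed.

Lemma integrable_sub (A : set R) f g : measurable A ->
  mu.-integrable A (EFin \o f) -> mu.-integrable A (EFin \o g) ->
  mu.-integrable A (EFin \o (fun t => f t - g t)).
Proof.
move=> mA hf hg; have q : mu.-integrable A ((EFin \o f) \- (EFin \o g))%E by apply:
  integrableB.
by apply: eq_integrable q.
Qed.

Lemma cvg_expRN_half : expR (- (t / 2)) @[t --> +oo%R] --> (0 : R).
Proof.
apply/cvgrPdist_lt => /= e e0; near=> t.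
rewrite sub0r normrN gtr0_norm ?expR_gt0 //.
rewrite -(lnK (e0 : e \in Num.pos)) ltr_expR ltrNl.
have : -2 * ln e < t by near: t; apply: nbhs_pinfty_gt; rewrite num_real.
lra.
Unshelve. all: by end_near. Qed.

Lemma is_derive_expRN_half t : is_derive t (1 : R) (fun t => expR (- (t / 2))) (- (2^-1)
  * expR (- (t / 2))).
Proof.
have h : is_derive t (1 : R) (fun t => - (t / 2)) (- 2^-1).
  by apply: is_derive_eq; rewrite /GRing.scale /=; ring.
by apply: is_derive_eq; rewrite /GRing.scale /=; ring.
Qed.

(** The common majorant of the integrands below: half of the exponential decay is kept, the other
    half absorbs the power of [t]. *)
Lemma integral_expRN_half k : 0 <= k ->
  mu.-integrable P (EFin \o (fun t => k * expR (- (t / 2)))) /\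
  \int[mu]_(t in P) (k * expR (- (t / 2))) = 2 * k.
Proof.
move=> k0; pose f t := k * expR (- (t / 2)); pose F t := (- (2 * k)) * expR (- (t / 2)).
have dF t : is_derive t (1 : R) F (f t).
  have h := is_derive_expRN_half t.
  by apply: is_derive_eq; rewrite /GRing.scale /f /=; field.
have cf : continuous f.
  move=> t; apply: cvgM; first exact: cvg_cst.
  apply: continuous_comp; last exact: continuous_expR.
  by apply: cvgN; apply: cvgM; [exact: cvg_id|exact: cvg_cst].
have mf : measurable_fun P f by apply: measurable_funTS; exact: continuous_measurable_fun.
have e : (\int[mu]_(t in P) (f t)%:E = (2 * k)%:E)%E.
  rewrite integral_itv_obnd_cbnd; last exact/measurable_EFinP.
  rewrite (@ge0_continuous_FTC2y _ f F 0 0).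
  - by rewrite /F mul0r oppr0 expR0 mulr1 sub0e EFinN oppeK.
  - by move=> t _; rewrite mulr_ge0 // expR_ge0.
  - exact: continuous_subspaceT.
  - by rewrite -(mulr0 (- (2 * k))); apply: cvgM; [exact: cvg_cst|exact: cvg_expRN_half].
  - by move=> t _; have [] := dF t.
  - apply: cvg_at_right_filter.
    by have [/derivable1_diffP/differentiable_continuous + _] := dF 0.
  - by move=> t _; rewrite derive1E derive_val.
split; last by rewrite /Rintegral e.
apply/integrableP; split; first exact/measurable_EFinP.
suff -> : (\int[mu]_(t in P) `|(f t)%:E| = \int[mu]_(t in P) (f t)%:E)%E.
  by rewrite e ltry.
by apply: eq_integral => t _; rewrite gee0_abs // lee_fin mulr_ge0 // expR_ge0.
Qed.

Lemma dominated_integrable f k : 0 <= k -> (forall t, 0 < t -> {for t, continuous f}) ->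
  (forall t, 0 < t -> `|f t| <= k * expR (- (t / 2))) ->
  mu.-integrable P (EFin \o f).
Proof.
move=> k0 cf fk; apply: le_integrable (integral_expRN_half k0).1 => //.
  apply/measurable_EFinP; apply: open_continuous_measurable_fun; first exact: interval_open.
  by move=> t; rewrite inE /= in_itv /= andbT; exact: cf.
move=> t; rewrite /= in_itv /= andbT => t0; rewrite lee_fin.
by rewrite [leRHS]ger0_norm ?mulr_ge0 ?expR_ge0 // fk.
Qed.

(* The fundamental theorem of calculus on the half-line for a derivative of
   variable sign, by adding [k * expR (- (t / 2))] to make it nonnegative. *)
Lemma integral_derive_0y F f k : 0 <= k ->
  (forall t, 0 < t -> is_derive t (1 : R) F (f t)) ->
  (forall t, 0 < t -> {for t, continuous f}) ->
  (forall t, 0 < t -> `|f t| <= k * expR (- (t / 2))) ->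
  F t @[t --> 0^'+] --> (0 : R) -> f t @[t --> 0^'+] --> (0 : R) ->
  F t @[t --> +oo%R] --> (0 : R) ->
  \int[mu]_(t in P) f t = 0.
Proof.
move=> k0 dF cf fk F0 f0 Fy.
pose E t := k * expR (- (t / 2)).
have [iE eE] := integral_expRN_half k0.
have if_ := dominated_integrable k0 cf fk.
have cE : continuous E.
  move=> t; apply: cvgM; first exact: cvg_cst.
  apply: continuous_comp; last exact: continuous_expR.
  by apply: cvgN; apply: cvgM; [exact: cvg_id|exact: cvg_cst].
(* [F] and [f] are controlled only for [0 < t]; extending them by 0 gives them at 0 the values of
   their right limits, as the fundamental theorem on the closed half-line requires. *)
pose pt (h : R -> R) (t : R) : R := if 0 < t then h t else 0.
have ptE h t : 0 < t -> \near t, pt h t = h t.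
  move=> t0; have : \near t, 0 < t by exact: lt_nbhsr.
  by apply: filterS => u u0; rewrite /pt u0.
pose f1 t := pt f t + E t; pose F1 t := pt F t - 2 * E t.
have f1_ge0 t : 0 <= t -> 0 <= f1 t.
  rewrite /f1 /pt le_eqVlt => /predU1P[<-|t0].
    by rewrite ltxx add0r mulr_ge0 ?expR_ge0.
  by rewrite t0; have := fk t t0; rewrite ler_norml => /andP[]; rewrite /E; lra.
have dF1 t : 0 < t -> is_derive t (1 : R) F1 (f1 t).
  move=> t0; have h1 := is_derive_expRN_half t; have h2 := dF t t0.
  have h : is_derive t (1 : R) (F - (fun t => 2 * E t)) (f t + E t).
    by apply: is_derive_eq; rewrite /GRing.scale /E /=; field.
  rewrite /f1 /pt t0; apply: near_eq_is_derive h.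
  by near=> u; rewrite /F1 (near (ptE F t t0) u).
have pt0 h : h t @[t --> 0^'+] --> (0 : R) -> pt h t @[t --> 0^'+] --> (0 : R).
  apply: cvg_trans; apply: near_eq_cvg; near=> t.
  by rewrite /pt (_ : 0 < t) //; near: t; exact: nbhs_right_gt.
have cE0 : E t @[t --> 0^'+] --> E 0 by apply: cvg_at_right_filter; exact: cE.
have e1 : \int[mu]_(t in `[0, +oo[) f1 t = 2 * k.
  rewrite (@Rintegral_ge0_continuous_FTC2y _ f1 F1 0 0) //.
  - by rewrite /F1 /pt ltxx /E mul0r oppr0 expR0; ring.
  - apply/continuous_within_itvcyP; split.
      move=> t; rewrite in_itv /= andbT => t0; apply: cvgD; last exact: cE.
      have -> : pt f t = f t by rewrite /pt t0.
      apply: cvg_trans (cf t t0); apply: near_eq_cvg.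
      by have := ptE f t t0; apply: filterS => u ->.
    by rewrite /f1 (_ : pt f 0 = 0) /pt ?ltxx //; apply: cvgD => //; exact: pt0.
  - have h : (fun t => 2 * E t) t @[t --> +oo%R] --> (0 : R).
      rewrite -(mulr0 (2 : R)); apply: cvgM; first exact: cvg_cst.
      by rewrite -(mulr0 k); apply: cvgM; [exact: cvg_cst|exact: cvg_expRN_half].
    rewrite -(subr0 (0 : R)); apply: cvgB => //.
    apply: cvg_trans Fy; apply: near_eq_cvg; near=> t.
    by rewrite /pt (_ : 0 < t) //; near: t; apply: nbhs_pinfty_gt; rewrite num_real.
  - by move=> t /dF1[].
  - rewrite /F1 /F1 (_ : pt F 0 = 0); last by rewrite /pt ltxx.
    apply: cvgB; first exact: pt0.
    by apply: cvgM; [exact: cvg_cst|exact: cE0].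
  - by move=> t; rewrite in_itv /= andbT => /dF1 h; rewrite derive1E derive_val.
have i1 : mu.-integrable P (EFin \o f1).
  apply: eq_integrable (integrable_add _ if_ iE) => //= t;
    rewrite inE /= in_itv /= andbT => t0.
  by rewrite /f1 /pt t0.
have -> : \int[mu]_(t in P) f t = \int[mu]_(t in P) (f1 t - E t).
  apply: eq_Rintegral => t; rewrite inE /= in_itv /= andbT => t0.
  by rewrite /f1 /pt t0 addrK.
by rewrite RintegralB // Rintegral_itv_obnd_cbnd // e1 eE subrr.
Unshelve. all: by end_near. Qed.

(* The real functions underlying Euler's integrand: [t ^ (c + i b) * expR (- t)]
   has real part [gamma_kernel c b 0 t] and imaginary part [- gamma_kernel c b (pi / 2)
     t]. *)
Definition gamma_kernel c b th t : R := expR (c * ln t - t) * cos (b * ln t + th).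

Lemma gamma_kernel_continuous c b th t : 0 < t -> {for t, continuous (gamma_kernel c b th)}.
Proof.
move=> t0; have cl : {for t, continuous (@ln R)} by exact: continuous_ln.
apply: cvgM.
  apply: (@continuous_comp _ _ _ (fun u => c * ln u - u) expR).
    by apply: cvgB; [apply: cvgM; [exact: cvg_cst|exact: cl]|exact: cvg_id].
  exact: continuous_expR.
apply: (@continuous_comp _ _ _ (fun u => b * ln u + th) cos).
  by apply: cvgD; [apply: cvgM; [exact: cvg_cst|exact: cl]|exact: cvg_cst].
exact: continuous_cos.
Qed.

Lemma expR_ln_pred c t : 0 < t -> expR ((c - 1) * ln t - t) = expR (c * ln t - t) / t.
Proof.
move=> t0; have <- : expR (- ln t) = t^-1 by rewrite expRN lnK.
by rewrite -expRD; congr expR; ring.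
Qed.

(** Differentiating the cosine shifts its phase by [pi / 2], and the factor [1 / t] lowers [c] by
    one, so the derivative stays in the same family. *)
Lemma gamma_kernel_derive c b th t : 0 < t -> is_derive t (1 : R) (gamma_kernel c b th)
  (c * gamma_kernel (c - 1) b th t + b * gamma_kernel (c - 1) b (th + pi / 2) t -
    gamma_kernel c b th t).
Proof.
move=> t0; have dl := is_derive1_ln t0.
have d1 : is_derive t (1 : R) (fun u => c * ln u - u) (c / t - 1).
  by apply: is_derive_eq; rewrite /GRing.scale /=; ring.
have d2 : is_derive t (1 : R) (fun u => b * ln u + th) (b / t).
  by apply: is_derive_eq; rewrite /GRing.scale /=; ring.
have d3 := @is_derive1_comp _ expR _ _ _ _ (is_derive_expR _) d1.
have d4 := @is_derive1_comp _ cos _ _ _ _ (is_derive_cos _) d2.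
rewrite /gamma_kernel !expR_ln_pred // addrA cosDpihalf.
apply: is_derive_eq; rewrite /GRing.scale /=; field.
by rewrite gt_eqF.
Qed.

(** The logarithm of [t / (2 * c)] is below [t / (2 * c)], so [c * ln t] is at most
    [c * ln (2 * c) + t / 2]; this is the origin of the constant. *)
Lemma gamma_kernel_bound c b th : 0 < c -> forall t, 0 < t ->
  `|gamma_kernel c b th t| <= expR (c * ln (2 * c)) * expR (- (t / 2)).
Proof.
move=> c0 t t0; rewrite /gamma_kernel normrM ger0_norm ?expR_ge0 // -expRD.
apply: (@le_trans _ _ (expR (c * ln t - t))).
  by rewrite ler_piMr ?expR_ge0 // cos_max.
rewrite ler_expR; have c2 : 0 < 2 * c by rewrite mulr_gt0.
have := @ln_sublinear R (t / (2 * c)) (divr_gt0 t0 c2).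
rewrite ln_div ?posrE // -(ltr_pM2l c0) => /ltW.
have -> : c * (t / (2 * c)) = t / 2 by field; rewrite gt_eqF.
lra.
Qed.

Lemma gamma_kernel_integrable c b th : 0 < c -> mu.-integrable P (EFin \o gamma_kernel c
  b th).
Proof.
move=> c0; apply: dominated_integrable (gamma_kernel_bound b th c0); first exact: expR_ge0.
by move=> t; exact: gamma_kernel_continuous.
Qed.

Lemma gamma_kernel_cvg0 c b th : 0 < c -> gamma_kernel c b th t @[t --> 0^'+] --> (0 : R).
Proof.
move=> c0; apply/cvgrPdist_lt => /= e e0; near=> t.
have t0 : 0 < t by near: t; exact: nbhs_right_gt.
have te : t < expR (ln e / c) by near: t; apply: nbhs_right_lt; exact: expR_gt0.
rewrite sub0r normrN /gamma_kernel normrM ger0_norm ?expR_ge0 //.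
apply: (@le_lt_trans _ _ (expR (c * ln t - t))).
  by rewrite ler_piMr ?expR_ge0 // cos_max.
rewrite -(lnK (e0 : e \in Num.pos)) ltr_expR.
have : c * ln t < ln e.
  by rewrite mulrC -ltr_pdivlMr // -ltr_expR lnK.
by move: t0; lra.
Unshelve. all: by end_near. Qed.

Lemma gamma_kernel_cvgy c b th : 0 < c -> gamma_kernel c b th t @[t --> +oo%R] --> (0 : R).
Proof.
move=> c0; set k := expR (c * ln (2 * c)).
have : k * expR (- (t / 2)) @[t --> +oo%R] --> (0 : R).
  by rewrite -(mulr0 k); apply: cvgM; [exact: cvg_cst|exact: cvg_expRN_half].
move=> /cvgrPdist_lt h; apply/cvgrPdist_lt => /= e e0; near=> t.
have t0 : 0 < t by near: t; apply: nbhs_pinfty_gt; rewrite num_real.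
rewrite sub0r normrN; apply: (le_lt_trans (gamma_kernel_bound b th c0 t0)).
apply: le_lt_trans (ler_norm _) _.
by rewrite -normrN -sub0r; near: t; exact: h.
Unshelve. all: by end_near. Qed.

Definition gamma_integral c b th : R := \int[mu]_(t in P) gamma_kernel c b th t.

(** The functional equation of Gamma, for every phase: the derivative of the kernel has integral 0.
    With [1 < c] the kernels of exponent [c - 1] are still integrable and tend to 0 at 0. *)
Lemma gamma_integral_rec c b th : 1 < c ->
  gamma_integral c b th = c * gamma_integral (c - 1) b th + b * gamma_integral (c - 1) b
    (th + pi / 2).
Proof.
move=> c1; have c0 : 0 < c by lra.
have c10 : 0 < c - 1 by lra.
pose f t := c * gamma_kernel (c - 1) b th t + b * gamma_kernel (c - 1) b (th + pi / 2) t
  - gamma_kernel c b th t.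
pose K (a : R) := expR (a * ln (2 * a)).
have K0 (a : R) : 0 <= K a by exact: expR_ge0.
have i1 : mu.-integrable P (EFin \o (fun t => c * gamma_kernel (c - 1) b th t)).
  by apply: integrable_scale => //; exact: gamma_kernel_integrable.
have i2 : mu.-integrable P (EFin \o (fun t => b * gamma_kernel (c - 1) b (th + pi / 2) t)).
  by apply: integrable_scale => //; exact: gamma_kernel_integrable.
have i12 : mu.-integrable P (EFin \o
    (fun t => c * gamma_kernel (c - 1) b th t + b * gamma_kernel (c - 1) b (th + pi / 2)
      t)).
  exact: integrable_add.
have i3 := gamma_kernel_integrable b th c0.
have : \int[mu]_(t in P) f t = 0.
  apply: (@integral_derive_0y (gamma_kernel c b th) f (c * K (c - 1) + `|b| * K (c - 1) +
    K c)).
  - by rewrite !addr_ge0 ?mulr_ge0 // ltW.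
  - by move=> t; exact: gamma_kernel_derive.
  - move=> t t0; apply: cvgB; last exact: gamma_kernel_continuous.
    apply: cvgD; (apply: cvgM; [exact: cvg_cst|exact: gamma_kernel_continuous]).
  - move=> t t0; rewrite !mulrDl; apply: le_trans (ler_normB _ _) _.
    apply: lerD; last exact: gamma_kernel_bound.
    apply: le_trans (ler_normD _ _) _.
    apply: lerD; rewrite normrM -mulrA; apply: ler_pM => //; try exact: gamma_kernel_bound.
    by rewrite gtr0_norm.
  - exact: gamma_kernel_cvg0.
  - have hz a th' : a * gamma_kernel (c - 1) b th' t @[t --> 0^'+] --> a * 0.
      by apply: cvgM; [exact: cvg_cst|exact: gamma_kernel_cvg0].
    have := cvgB (cvgD (hz c th) (hz b (th + pi / 2))) (gamma_kernel_cvg0 b th c0);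
      rewrite !mulr0 addr0 subr0; apply.
  - exact: gamma_kernel_cvgy.
rewrite RintegralB // RintegralD // !RintegralZl // ?gamma_kernel_integrable //.
by move=> /eqP; rewrite subr_eq0 => /eqP.
Qed.

(** The addition formula for the cosine; when the real and imaginary parts vanish, so does the
    integral for every phase. *)
Lemma gamma_integral_phase c b th : 0 < c ->
  gamma_integral c b th = cos th * gamma_integral c b 0 + sin th * gamma_integral c b (pi
    / 2).
Proof.
move=> c0; rewrite /gamma_integral -!RintegralZl //; try exact: gamma_kernel_integrable.
rewrite -RintegralD //; try by apply: integrable_scale => //;
  exact: gamma_kernel_integrable.
apply: eq_Rintegral => t _; rewrite /gamma_kernel cosDpihalf addr0 cosD; ring.
Qed.

(** The kernel is nonnegative, and on [1, 2] it is at least exp(-2) because there [ln t] is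
    nonnegative and [t] is at most 2. *)
Lemma gamma_integral_gt0 c : 0 < c -> 0 < gamma_integral c 0 0.
Proof.
move=> c0; pose d := expR (- 2) : R.
have mI : measurable (`[1, 2] : set R) by [].
have sub : (`[1, 2] : set R) `<=` P.
  by move=> t; rewrite /= !in_itv /= andbT => /andP[]; lra.
have ig := gamma_kernel_integrable 0 0 c0.
have g0 t : 0 <= gamma_kernel c 0 0 t by rewrite /gamma_kernel mul0r addr0 cos0 mulr1
  expR_ge0.
have iD : mu.-integrable `[1, 2] (EFin \o gamma_kernel c 0 0) by apply: integrableS ig.
apply: (@lt_le_trans _ _ (\int[mu]_(t in `[1, 2]) gamma_kernel c 0 0 t)); last first.
  rewrite /gamma_integral /Rintegral; apply: fine_le; try exact: integrable_fin_num.
  apply: ge0_subset_integral => //; first by case/integrableP : ig.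
  by move=> t _; rewrite lee_fin.
apply: (@lt_le_trans _ _ (\int[mu]_(t in `[1, 2]) d)).
  have e : mu `[1, 2] = 1%:E.
    by rewrite lebesgue_measure_itv /= lte_fin ltr1n -EFinD; congr EFin; ring.
  by rewrite Rintegral_cst // [X in fine X](_ : _ = 1%:E) ?mulr1 ?expR_gt0.
apply: le_Rintegral => //.
  have cd : {within `[1, 2], continuous (fun _ : R => d)} by apply: continuous_subspaceT
    => x; exact: cvg_cst.
  by apply: continuous_compact_integrable cd; exact: segment_compact.
move=> t; rewrite /= in_itv /= => /andP[t1 t2].
rewrite /gamma_kernel mul0r addr0 cos0 mulr1 ler_expR.
have := ln_ge0 t1; nra.
Qed.

Lemma sin_sqr_le (x : R) : sin x ^+ 2 <= x ^+ 2.
Proof.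
wlog x0 : x / 0 <= x => [hw|].
  have [|x0] := leP 0 x; first exact: hw.
  by have := hw (- x); rewrite sinN !sqrrN oppr_ge0; apply; exact: ltW.
have [->|xn0] := eqVneq x 0; first by rewrite sin0.
have xp : 0 < x by rewrite lt_neqAle eq_sym xn0.
have dS (t : R) : t \in `]0, x[ -> is_derive t (1 : R) sin (cos t) by move=> _;
  exact: is_derive_sin.
have cS : {within `[0, x], continuous (@sin R)} by apply: continuous_subspaceT;
  exact: continuous_sin.
have [d _] := MVT xp dS cS; rewrite sin0 !subr0 => ->.
rewrite exprMn; apply: ler_piMl; first exact: sqr_ge0.
have := cos2Dsin2 d; have := sqr_ge0 (sin d); lra.
Qed.

Lemma cos_ge_sqr (x : R) : 1 - x ^+ 2 / 2 <= cos x.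
Proof.
have -> : x = (x / 2) *+ 2 by rewrite mulr2n; field.
rewrite cos_mulr2n; have := sin_sqr_le (x / 2); have := cos2Dsin2 (x / 2).
rewrite mulr2n; set u := x / 2; set C := cos u ^+ 2; set S := sin u ^+ 2.
have -> : (u + u) ^+ 2 / 2 = 2 * u ^+ 2 by field.
by rewrite mulr2n; lra.
Qed.

(** With [w] the square root of [u], the bracket is the square of [w - w^-1], which is at least half
    of [ln u] when [u] is at least 1. A majorant linear in [u] and its inverse can be integrated
    against the kernel by shifting [c] by one. *)
Lemma ln_sqr_le (u : R) : 0 < u -> ln u ^+ 2 <= 4 * (u + u^-1 - 2).
Proof.
wlog u1 : u / 1 <= u => [hw u0|u0].
  have [|u1] := leP 1 u; first by move=> /hw; exact.
  have := hw u^-1; rewrite invrK lnV ?posrE // sqrrN (addrC u^-1); apply.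
    by rewrite invf_ge1 // ltW.
  by rewrite invr_gt0.
have v0 := ln_ge0 u1; set v := ln u in v0 *.
have -> : u = expR (v / 2) ^+ 2 by rewrite -expRM_natl -[LHS]lnK // -/v; congr expR; field.
set w := expR (v / 2); have w0 : 0 < w by exact: expR_gt0.
have w1 : 1 + v / 2 <= w by exact: expR_ge1Dx.
have -> : w ^+ 2 + (w ^+ 2)^-1 - 2 = (w - w^-1) ^+ 2 by field; rewrite gt_eqF.
have wV : w^-1 <= 1 by rewrite invf_le1 //; lra.
have : v / 2 <= w - w^-1 by lra.
set z := w - w^-1; nra.
Qed.

(** The phase cancels the oscillation at [m = c + 1], the mean of the density proportional to t^c
    exp(-t). By [cos_ge_sqr] and [ln_sqr_le] the cosine is at least 1 - 2 b^2 (t/m + m/t - 2), and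
    the recursion evaluates the integral of this bound to A (1 - 2 b^2 / c). *)
Lemma gamma_integral_large c b : 1 < c -> 2 * b ^+ 2 < c -> 0 < gamma_integral c b (- (b
  * ln (c + 1))).
Proof.
move=> c1 bc; have c0 : 0 < c by lra.
have A0 := gamma_integral_gt0 c0; set A := gamma_integral c 0 0 in A0.
have e1 : gamma_integral (c + 1) 0 0 = (c + 1) * A.
  by rewrite gamma_integral_rec ?addrK ?mul0r ?addr0 //; lra.
have e2 : A = c * gamma_integral (c - 1) 0 0 by rewrite /A gamma_integral_rec // mul0r
  addr0.
set m := c + 1; have m0 : 0 < m by rewrite /m; lra.
pose h t := (1 + 4 * b ^+ 2) * gamma_kernel c 0 0 t - (2 * b ^+ 2 / m) * gamma_kernel (c
  + 1) 0 0 t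
  - (2 * b ^+ 2 * m) * gamma_kernel (c - 1) 0 0 t.
have cm : 0 < c - 1 by lra.
have cp : 0 < c + 1 by lra.
have i1 : mu.-integrable P (EFin \o (fun t => (1 + 4 * b ^+ 2) * gamma_kernel c 0 0 t)).
  by apply: integrable_scale => //; exact: gamma_kernel_integrable.
have i2 : mu.-integrable P (EFin \o (fun t => (2 * b ^+ 2 / m) * gamma_kernel (c + 1) 0 0
  t)).
  by apply: integrable_scale => //; exact: gamma_kernel_integrable.
have i3 : mu.-integrable P (EFin \o (fun t => (2 * b ^+ 2 * m) * gamma_kernel (c - 1) 0 0
  t)).
  by apply: integrable_scale => //; exact: gamma_kernel_integrable.
have i12 : mu.-integrable P (EFin \o (fun t => (1 + 4 * b ^+ 2) * gamma_kernel c 0 0 t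
    - (2 * b ^+ 2 / m) * gamma_kernel (c + 1) 0 0 t)).
  exact: integrable_sub.
have ih : mu.-integrable P (EFin \o h) by exact: integrable_sub.
have eh : \int[mu]_(t in P) h t = A * (1 - 2 * b ^+ 2 / c).
  rewrite RintegralB // RintegralB // !RintegralZl //; try exact: gamma_kernel_integrable.
  rewrite -/(gamma_integral c 0 0) -/(gamma_integral (c + 1) 0 0) -/(gamma_integral (c -
    1) 0 0) e1 -/A /m.
  have -> : gamma_integral (c - 1) 0 0 = A / c by rewrite e2 mulrC mulKf // gt_eqF.
  by field; rewrite !gt_eqF.
apply: (@lt_le_trans _ _ (\int[mu]_(t in P) h t)).
  rewrite eh mulr_gt0 // subr_gt0 ltr_pdivrMr ?mul1r //.
apply: le_Rintegral => //; first exact: gamma_kernel_integrable.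
move=> t; rewrite /= in_itv /= andbT => t0.
have ep : expR ((c + 1) * ln t - t) = expR (c * ln t - t) * t.
  by have := expR_ln_pred (c + 1) t0; rewrite addrK => ->; rewrite divfK // gt_eqF.
rewrite /h /gamma_kernel !mul0r !addr0 cos0 !mulr1 ep expR_ln_pred //.
set e := expR (c * ln t - t); have e0 : 0 <= e by exact: expR_ge0.
have -> : (1 + 4 * b ^+ 2) * e - 2 * b ^+ 2 / m * (e * t) - 2 * b ^+ 2 * m * (e / t) =
  e * (1 - 2 * b ^+ 2 * (t / m + m / t - 2)) by field; rewrite !gt_eqF.
apply: ler_wpM2l => //; apply: le_trans (cos_ge_sqr _).
have := @ln_sqr_le (t / m) (divr_gt0 t0 m0); rewrite ln_div ?posrE // invf_div.
rewrite -mulrBr exprMn => hl; have := ler_wpM2l (sqr_ge0 b) hl.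
rewrite -/m; lra.
Qed.

Lemma GammaE (z : R[i]) : 1 < complex.Re z -> Gamma z =
  gamma_integral (complex.Re z - 1) (complex.Im z) 0 +i* - gamma_integral (complex.Re z -
    1) (complex.Im z) (pi / 2).
Proof.
move=> z1; have e t : t \in P -> cpow t%:C (z - 1) * (expR (- t))%:C =
    gamma_kernel (complex.Re z - 1) (complex.Im z) 0 t +i*
    - gamma_kernel (complex.Re z - 1) (complex.Im z) (pi / 2) t.
  rewrite inE /= in_itv /= andbT => t0.
  rewrite /cpow clog_pos // /cexp /gamma_kernel cosDpihalf addr0.
  apply: complex_ext; rewrite !(cReM, cImM) /= !cReD !cImD !cReN !cImN /=
    !(mulr0, oppr0, addr0, subr0, add0r, mul0r) expRD; ring.
rewrite /Gamma /cint; congr (_ +i* _).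
  by apply: eq_Rintegral => t tP; rewrite e.
rewrite -[RHS]mulN1r /gamma_integral -RintegralZl //;
  last by apply: gamma_kernel_integrable; lra.
by apply: eq_Rintegral => t tP; rewrite e //= mulN1r.
Qed.

(** At a zero both components vanish, hence, by the recursion, at all integer shifts to the right
    and for all phases. Once the shift exceeds 2 b^2 this contradicts [gamma_integral_large]. *)
Lemma Gamma_neq0 (z : R[i]) : 2 < complex.Re z -> Gamma z != 0.
Proof.
move=> z2; apply/negP => /eqP; rewrite GammaE; last by apply: lt_trans z2; rewrite ltr1n.
set c := complex.Re z - 1; set b := complex.Im z => -[h0 h1].
have c1 : 1 < c by rewrite /c; lra.
have h n : gamma_integral (c + n%:R) b 0 = 0 /\ gamma_integral (c + n%:R) b (pi / 2) = 0.
  elim: n => [|n [IH0 IH1]]; first by rewrite addr0 h0 -[gamma_integral c b (pi /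
    2)]opprK h1 oppr0.
  have n0 : 0 <= n%:R :> R by [].
  have cn : 0 < c + n%:R by lra.
  have cn1 : 1 < c + n.+1%:R by rewrite -natr1; lra.
  have ec : c + n.+1%:R - 1 = c + n%:R by rewrite -natr1; ring.
  have J0 th : gamma_integral (c + n%:R) b th =
    0 by rewrite gamma_integral_phase // IH0 IH1 !mulr0 addr0.
  by rewrite !(gamma_integral_rec b _ cn1) ec !J0 !mulr0 addr0.
have [n hn] : exists n : nat, 2 * b ^+ 2 < n%:R.
  by exists (Num.truncn (2 * b ^+ 2)).+1; exact: truncnS_gt.
have n0 : 0 <= n%:R :> R by [].
have cn1 : 1 < c + n%:R by lra.
have := gamma_integral_large cn1 (lt_le_trans hn (ler_wpDl (ltW (lt_trans ltr01 c1))
  (lexx _))).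
have [e0 e1] := h n; rewrite gamma_integral_phase; last by lra.
by rewrite e0 e1 !mulr0 addr0 ltxx.
Qed.

End GammaIntegrals.

(** * Unconditional sums *)

Section RealSums.
Context {R : realType}.

(* An infinite sum gets the junk value 0: see [nnsummable]. *)
Definition nnsum {T : choiceType} (A : set T) (p : T -> R) : R :=
  fine (\esum_(t in A) (p t)%:E).

Definition nnsummable {T : choiceType} (A : set T) (p : T -> R) : Prop :=
  (forall t, 0 <= p t) /\ (\esum_(t in A) (p t)%:E < +oo)%E.

Lemma nnsumK {T : choiceType} (A : set T) (p : T -> R) : nnsummable A p ->
  (nnsum A p)%:E = \esum_(t in A) (p t)%:E.
Proof.
move=> [p0 ps]; rewrite fineK // ge0_fin_numE //.
by apply: esum_ge0 => t _; rewrite lee_fin p0.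
Qed.

Lemma nnsum_ge0 {T : choiceType} (A : set T) (p : T -> R) :
  (forall t, 0 <= p t) -> 0 <= nnsum A p.
Proof. by move=> p0; apply/fine_ge0/esum_ge0 => t _; rewrite lee_fin p0. Qed.

Lemma eq_nnsum {T : choiceType} (A : set T) (p q : T -> R) :
  (forall t, A t -> p t = q t) -> nnsum A p = nnsum A q.
Proof. by move=> pq; congr fine; apply: eq_esum => t At; rewrite pq. Qed.

Lemma nnsummable_le {T : choiceType} (A : set T) (p q : T -> R) :
  (forall t, 0 <= p t) -> (forall t, A t -> p t <= q t) ->
  nnsummable A q -> nnsummable A p.
Proof.
move=> p0 pq [q0 qs]; split=> //; apply: le_lt_trans qs.
by apply: le_esum => t At; rewrite lee_fin pq.
Qed.

Lemma nnsummable_sub {T : choiceType} (A B : set T) (p : T -> R) : A `<=` B ->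
  nnsummable B p -> nnsummable A p.
Proof.
move=> AB [p0 ps]; split=> //; apply: le_lt_trans ps.
have pE t : (0 <= (p t)%:E)%E by rewrite lee_fin p0.
rewrite [leRHS](esumID A) // setIidr //; apply: leeDl; exact: esum_ge0.
Qed.

Lemma le_nnsum {T : choiceType} (A : set T) (p q : T -> R) :
  (forall t, 0 <= p t) -> (forall t, A t -> p t <= q t) ->
  nnsummable A q -> nnsum A p <= nnsum A q.
Proof.
move=> p0 pq sq; rewrite -lee_fin !nnsumK //; last exact: nnsummable_le sq.
by apply: le_esum => t At; rewrite lee_fin pq.
Qed.

Lemma nnsumD {T : choiceType} (A : set T) (p q : T -> R) :
  nnsummable A p -> nnsummable A q ->
  nnsummable A (fun t => p t + q t) /\
  nnsum A (fun t => p t + q t) = nnsum A p + nnsum A q.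
Proof.
move=> sp sq; have [p0 ps] := sp; have [q0 qs] := sq.
have e : \esum_(t in A) (p t + q t)%:E = (nnsum A p + nnsum A q)%:E.
  rewrite EFinD !nnsumK // -esumD //.
    by move=> t At; rewrite lee_fin p0.
  by move=> t At; rewrite lee_fin q0.
split; last by rewrite /nnsum e.
by split=> [t|]; rewrite ?addr_ge0 // e ltry.
Qed.

Lemma nnsumZ {T : choiceType} (A : set T) (p : T -> R) c : 0 <= c ->
  nnsummable A p ->
  nnsummable A (fun t => c * p t) /\ nnsum A (fun t => c * p t) = c * nnsum A p.
Proof.
have le k q : 0 <= k -> nnsummable A q ->
    (\esum_(t in A) (k * q t)%:E <= (k * nnsum A q)%:E)%E.
  move=> k0 sq; apply: ge_ereal_sup => _ [X [finX XA] <-].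
  have -> : (\sum_(x \in X) (k * q x)%:E = (k%:E * \sum_(x \in X) (q x)%:E))%E.
    by rewrite ge0_mule_fsumr // => t; rewrite lee_fin sq.1.
  rewrite EFinM lee_wpmul2l ?lee_fin // nnsumK //.
  by apply: ereal_sup_ubound; exists X.
have sZ k q : 0 <= k -> nnsummable A q -> nnsummable A (fun t => k * q t).
  move=> k0 sq; split=> [t|]; first by rewrite mulr_ge0 // sq.1.
  by apply: le_lt_trans (le k q k0 sq) _; rewrite ltry.
move=> c0 sp; split; first exact: sZ.
have [->|cn0] := eqVneq c 0.
  by rewrite mul0r /nnsum esum1 // => t _; rewrite mul0r.
apply/eqP; rewrite eq_le; apply/andP; split.
  by rewrite -lee_fin nnsumK ?le //; exact: sZ.
(* The reverse inequality is the direct one for the factor [c^-1] and the family [c * p]. *)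
have cV : 0 <= c^-1 by rewrite invr_ge0.
rewrite -[X in _ <= X](mulKf cn0 _) mulrCA ler_wpM2l //.
rewrite -lee_fin; apply: le_trans (le c^-1 _ cV (sZ c p c0 sp)).
by rewrite nnsumK //; apply: le_esum => t _; rewrite lee_fin mulKf.
Qed.

Lemma nnsum_image {T U : choiceType} (A : set T) (h : T -> U) (p : U -> R) :
  set_inj A h -> nnsum (h @` A) p = nnsum A (p \o h) /\
  (nnsummable A (p \o h) -> (forall u, 0 <= p u) -> nnsummable (h @` A) p).
Proof.
move=> hI; rewrite /nnsum /nnsummable (esum_image A h) //.
by split=> // -[].
Qed.

Lemma nnsum_fubini {T U : choiceType} (A : set T) (B : set U) (p : T * U -> R) :
  nnsummable (A `*` B) p ->
  [/\ forall a, A a -> nnsummable B (fun b => p (a, b)),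
      nnsummable A (fun a => nnsum B (fun b => p (a, b))) &
      nnsum (A `*` B) p = nnsum A (fun a => nnsum B (fun b => p (a, b)))].
Proof.
move=> [p0 ps].
have e := @esum_esum R T U A (fun _ => B) (fun a b => (p (a, b))%:E).
have {}e : \esum_(a in A) \esum_(b in B) (p (a, b))%:E = \esum_(k in A `*` B) (p k)%:E.
  rewrite e => [|i j _ _]; last by rewrite lee_fin p0.
  by apply: eq_esum => -[].
have pB a b : (0 <= (p (a, b))%:E)%E by rewrite lee_fin p0.
have s1 a : A a -> nnsummable B (fun b => p (a, b)).
  move=> Aa; split=> //; move: ps; rewrite -e; apply: le_lt_trans.
  rewrite (esumID [set a]) => [|t _]; last by rewrite esum_ge0.
  rewrite (_ : A `&` [set a] = [set a]); last first.
    by apply/seteqP; split=> [x []|x ->].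
  rewrite esum_set1 ?esum_ge0 // leeDl // esum_ge0 // => t _.
  by rewrite esum_ge0.
have e2 : \esum_(a in A) (nnsum B (fun b => p (a, b)))%:E = \esum_(k in A `*` B) (p k)%:E.
  by rewrite -e; apply: eq_esum => a Aa; rewrite nnsumK //; exact: s1.
split=> //; last by rewrite /nnsum e2.
by split=> [a|]; [apply: nnsum_ge0|rewrite e2].
Qed.

Lemma nnsummable_fubini {T U : choiceType} (A : set T) (B : set U) (p : T * U -> R) :
  (forall k, 0 <= p k) -> (forall a, A a -> nnsummable B (fun b => p (a, b))) ->
  nnsummable A (fun a => nnsum B (fun b => p (a, b))) -> nnsummable (A `*` B) p.
Proof.
move=> p0 sB [_ sA]; split=> //; apply: le_lt_trans sA.
have e := @esum_esum R T U A (fun _ => B) (fun a b => (p (a, b))%:E).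
rewrite le_eqVlt; apply/orP; left; apply/eqP.
rewrite (_ : \esum_(t in _) _ = \esum_(k in A `*`` (fun=> B)) (p (k.1, k.2))%:E);
  last first.
  by apply: eq_esum => -[].
rewrite -e => [|i j _ _]; last by rewrite lee_fin p0.
by apply: eq_esum => a Aa; rewrite nnsumK //; exact: sB.
Qed.

(** * Absolutely summable real families *)

Definition rsummable {T : choiceType} (A : set T) (f : T -> R) : Prop :=
  nnsummable A (fun t => `|f t|).

(** Any splitting into summable nonnegative families computes the sum, and not only the positive and
    negative parts; linearity and Fubini are thereby inherited from the nonnegative case. *)
Lemma rsum_sub {T : choiceType} (A : set T) (f p q : T -> R) :
  nnsummable A p -> nnsummable A q -> (forall t, A t -> f t = p t - q t) ->
  rsum A f = nnsum A p - nnsum A q.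
Proof.
move=> sp sq e; rewrite /rsum.
have S r : nnsummable A r -> summable A (EFin \o r).
  by move=> [r0 rs]; rewrite /summable; under eq_esum do rewrite /= ger0_norm //.
have h := @esumB R T A (EFin \o p) (EFin \o q) (S _ sp) (S _ sq) _ _.
rewrite (@eq_esum _ _ A _ (((EFin \o p) \- (EFin \o q))%E ^\+)%E); last first.
  by move=> t At; rewrite !funeposE /= e // EFinB.
rewrite (@eq_esum _ _ A ((EFin \o f)^\-)%E (((EFin \o p) \- (EFin \o q))%E ^\-)%E);
  last first.
  by move=> t At; rewrite !funenegE /= e // EFinB.
rewrite h => [|i _|i _]; rewrite ?lee_fin ?sp.1 ?sq.1 //.
by rewrite /= -!nnsumK // -EFinB.
Qed.

Definition pos_part {T : Type} (f : T -> R) t := Num.max (f t) 0.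
Definition neg_part {T : Type} (f : T -> R) t := Num.max (- f t) 0.

Lemma pos_neg_part {T : Type} (f : T -> R) t :
  [/\ 0 <= pos_part f t, 0 <= neg_part f t, f t = pos_part f t - neg_part f t,
      pos_part f t <= `|f t| & neg_part f t <= `|f t|].
Proof.
rewrite /pos_part /neg_part.
have [f0|f0] := leP 0 (f t); rewrite ?(max_l f0) ?(max_r (ltW f0)).
  by rewrite max_r ?oppr_le0 // subr0 ger0_norm.
by rewrite max_l ?oppr_ge0 ?(ltW f0) // sub0r opprK ltr0_norm //;
  split=> //; rewrite oppr_ge0 ltW.
Qed.

Lemma rsummable_parts {T : choiceType} (A : set T) (f : T -> R) : rsummable A f ->
  nnsummable A (pos_part f) /\ nnsummable A (neg_part f).
Proof.
by move=> sf; split; apply: nnsummable_le sf => t; have [] := pos_neg_part f t.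
Qed.

Lemma rsumE {T : choiceType} (A : set T) (f : T -> R) : rsummable A f ->
  rsum A f = nnsum A (pos_part f) - nnsum A (neg_part f).
Proof.
by move=> /rsummable_parts[sp sn]; apply: rsum_sub => // t _; have [] := pos_neg_part f t.
Qed.

Lemma rsumD {T : choiceType} (A : set T) (f g : T -> R) : rsummable A f -> rsummable A g ->
  rsum A (fun t => f t + g t) = rsum A f + rsum A g.
Proof.
move=> sf sg; rewrite (rsumE sf) (rsumE sg).
have [[sf1 sf2] [sg1 sg2]] := (rsummable_parts sf, rsummable_parts sg).
have [s1 e1] := nnsumD sf1 sg1; have [s2 e2] := nnsumD sf2 sg2.
rewrite (rsum_sub s1 s2) ?e1 ?e2; first by ring.
move=> t _; have [_ _ ef _ _] := pos_neg_part f t.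
by have [_ _ eg _ _] := pos_neg_part g t; rewrite {1}ef {1}eg; ring.
Qed.

Lemma rsumZ {T : choiceType} (A : set T) (f : T -> R) c : rsummable A f ->
  rsum A (fun t => c * f t) = c * rsum A f.
Proof.
move=> sf; rewrite (rsumE sf); have [s1 s2] := rsummable_parts sf.
have ef t : f t = pos_part f t - neg_part f t by have [] := pos_neg_part f t.
have [c0|c0] := leP 0 c.
  have [t1 e1] := nnsumZ c0 s1; have [t2 e2] := nnsumZ c0 s2.
  rewrite (rsum_sub t1 t2) ?e1 ?e2; first by ring.
  by move=> t _; rewrite {1}ef mulrBr.
have c0' : 0 <= - c by rewrite oppr_ge0 ltW.
have [t1 e1] := nnsumZ c0' s1; have [t2 e2] := nnsumZ c0' s2.
rewrite (rsum_sub t2 t1) ?e1 ?e2; first by ring.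
by move=> t _; rewrite {1}ef; ring.
Qed.

Lemma rsum_norm_le {T : choiceType} (A : set T) (f : T -> R) : rsummable A f ->
  `|rsum A f| <= nnsum A (fun t => `|f t|).
Proof.
move=> sf; rewrite (rsumE sf); have [[p0 s1] [n0 s2]] := rsummable_parts sf.
have h1 : nnsum A (pos_part f) <= nnsum A (fun t => `|f t|).
  by apply: le_nnsum => // t _; have [] := pos_neg_part f t.
have h2 : nnsum A (neg_part f) <= nnsum A (fun t => `|f t|).
  by apply: le_nnsum => // t _; have [] := pos_neg_part f t.
have := nnsum_ge0 A p0; have := nnsum_ge0 A n0; rewrite ler_norml; lra.
Qed.

Lemma rsum_fubini {T U : choiceType} (A : set T) (B : set U) (f : T * U -> R) :
  rsummable (A `*` B) f ->
  [/\ forall a, A a -> rsummable B (fun b => f (a, b)),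
      nnsummable A (fun a => nnsum B (fun b => `|f (a, b)|)) &
      rsum (A `*` B) f = rsum A (fun a => rsum B (fun b => f (a, b)))].
Proof.
move=> sf; have [sB sA _] := nnsum_fubini sf.
have [/nnsum_fubini[p1 p2 p3] /nnsum_fubini[n1 n2 n3]] := rsummable_parts sf.
split=> //; rewrite (rsumE sf) p3 n3; symmetry; apply: rsum_sub => // a Aa.
by rewrite (rsumE (sB a Aa)).
Qed.

Lemma rsum_image {T U : choiceType} (A : set T) (h : T -> U) (f : U -> R) :
  set_inj A h -> rsum (h @` A) f = rsum A (f \o h).
Proof.
move=> hI; rewrite /rsum 2?(esum_image A h _ hI); congr (fine (_ - _)%E).
  by apply: eq_esum => t _; rewrite !funeposE.
by apply: eq_esum => t _; rewrite !funenegE.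
Qed.

Lemma eq_rsum {T : choiceType} (A : set T) (f g : T -> R) :
  (forall t, A t -> f t = g t) -> rsum A f = rsum A g.
Proof.
move=> fg; rewrite /rsum; congr (fine (_ - _)%E); apply: eq_esum => t At.
  by rewrite !funeposE /= fg.
by rewrite !funenegE /= fg.
Qed.

Lemma rsum_widen {T : choiceType} (A B : set T) (f : T -> R) : A `<=` B ->
  (forall t, B t -> ~ A t -> f t = 0) -> rsum A f = rsum B f.
Proof.
move=> AB f0; rewrite /rsum; congr (fine (_ - _)%E).
  rewrite [RHS](esumID A) => [|t _]; last by rewrite funeposE le_max lexx orbT.
  rewrite setIidr // [X in (_ + X)%E]esum1 ?adde0 // => t [Bt At].
  by rewrite funeposE /= f0 // maxxx.
rewrite [RHS](esumID A) => [|t _]; last by rewrite funenegE le_max lexx orbT.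
rewrite setIidr // [X in (_ + X)%E]esum1 ?adde0 // => t [Bt At].
by rewrite funenegE /= f0 // oppr0 maxxx.
Qed.

Lemma rsum_set1 {T : choiceType} (t : T) (f : T -> R) : rsum [set t] f = f t.
Proof.
rewrite /rsum !esum_set1 ?funenegE ?funeposE ?le_max ?lexx ?orbT //.
have [_ _ e _ _] := pos_neg_part f t; rewrite [RHS]e.
by rewrite -EFinN -!EFin_max -EFinB.
Qed.

Lemma rsummable_le {T : choiceType} (A : set T) (f : T -> R) (p : T -> R) :
  (forall t, A t -> `|f t| <= p t) -> nnsummable A p -> rsummable A f.
Proof. by move=> fp; apply: nnsummable_le. Qed.

Lemma rsum_split {T : choiceType} (A X : set T) (f : T -> R) : X `<=` A ->
  rsummable A f -> rsum A f = rsum X f + rsum (A `\` X) f.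
Proof.
move=> XA sf.
(* Extension by zero turns both pieces into families on all of [A], where additivity applies. *)
pose g t := if t \in X then f t else 0; pose h t := if t \in X then 0 else f t.
have sg : rsummable A g.
  by apply: rsummable_le sf => t _; rewrite /g; case: ifP; rewrite ?normr0.
have sh : rsummable A h.
  by apply: rsummable_le sf => t _; rewrite /h; case: ifP; rewrite ?normr0.
have -> : rsum X f = rsum A g.
  rewrite -(rsum_widen XA) => [|t _ nX]; last by rewrite /g memNset.
  by apply: eq_rsum => t Xt; rewrite /g mem_set.
have -> : rsum (A `\` X) f = rsum A h.
  rewrite -(@rsum_widen _ (A `\` X) A h) => [|t []//|t At Xt].
    by apply: eq_rsum => t [_ Xt]; rewrite /h memNset.
  by rewrite /h mem_set //; apply: contrapT => nX; apply: Xt.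
rewrite -rsumD //; apply: eq_rsum => t _; rewrite /g /h.
by case: ifP; rewrite ?addr0 ?add0r.
Qed.

Lemma nnsum_finite {T : choiceType} (X : set T) (p : T -> R) : finite_set X ->
  (forall t, 0 <= p t) ->
  nnsummable X p /\ nnsum X p = \sum_(t <- fset_set X) p t.
Proof.
move=> finX p0.
have e : \esum_(t in X) (p t)%:E = (\sum_(t <- fset_set X) p t)%:E.
  rewrite (_ : X = [set x | x \in X]); last by apply/seteqP; split=> x; rewrite /= inE.
  rewrite (@esum_fset R T [set x | x \in X]) ?fsbig_finite ?sumEFin //=.
  all: try by rewrite (_ : [set x | x \in X] = X) //; apply/seteqP; split=> x;
    rewrite /= inE.
  by move=> i _; rewrite lee_fin.
by split; [split=> //; rewrite e ltry|rewrite /nnsum e].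
Qed.

Lemma rsum_finite {T : choiceType} (X : set T) (f : T -> R) : finite_set X ->
  rsum X f = \sum_(t <- fset_set X) f t.
Proof.
move=> finX; have [|s1 e1] := @nnsum_finite _ X (pos_part f) finX.
  by move=> t; have [] := pos_neg_part f t.
have [|s2 e2] := @nnsum_finite _ X (neg_part f) finX.
  by move=> t; have [] := pos_neg_part f t.
rewrite (rsum_sub s1 s2) => [|t _]; last by have [] := pos_neg_part f t.
by rewrite e1 e2 -sumrB; apply: eq_bigr => t _; have [_ _ <-] := pos_neg_part f t.
Qed.

Lemma nnsum_tail {T : choiceType} (A : set T) (p : T -> R) e : 0 < e ->
  nnsummable A p ->
  exists X, [/\ finite_set X, X `<=` A & nnsum (A `\` X) p < e].
Proof.
move=> e0 sp; have [p0 _] := sp.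
have fin : (ereal_sup [set \sum_(x \in X) (p x)%:E | X in fsets A])%E \is a fin_num.
  by rewrite -[ereal_sup _]/(\esum_(x in A) (p x)%:E) -nnsumK.
have [_ [X [finX XA] <-] hX] := ub_ereal_sup_adherent e0 fin.
exists X; split=> //; have [sX eX] := nnsum_finite finX p0.
have eA : nnsum A p = nnsum X p + nnsum (A `\` X) p.
  apply/eqP; rewrite -eqe EFinD !nnsumK //; last by apply: nnsummable_sub sp => t [].
  rewrite (esumID X) => [|t _]; last by rewrite lee_fin.
  by rewrite setIidr.
move: hX; rewrite -[ereal_sup _]/(\esum_(x in A) (p x)%:E) -nnsumK // -EFinB.
rewrite fsbig_finite // sumEFin lte_fin -eX eA; lra.
Qed.

(** The error is a tail of the majorant alone, so it is uniform when [f] depends on a parameter. *)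
Lemma rsum_approx {T : choiceType} (A X : set T) (f : T -> R) (p : T -> R) :
  finite_set X -> X `<=` A -> nnsummable A p -> (forall t, A t -> `|f t| <= p t) ->
  `|rsum A f - \sum_(t <- fset_set X) f t| <= nnsum (A `\` X) p.
Proof.
move=> finX XA sp fp; have sf := rsummable_le fp sp.
have sAX : (A `\` X) `<=` A by move=> t [].
rewrite (rsum_split XA sf) rsum_finite // addrC addKr.
apply: le_trans (rsum_norm_le (nnsummable_sub sAX sf)) _.
by apply: le_nnsum => // [t [At _]|]; [exact: fp|exact: nnsummable_sub sp].
Qed.

(** * Absolutely summable complex families *)

Local Notation normc := Normc.normc.

Lemma csummableE {T : choiceType} (A : set T) (f : T -> R[i]) :
  csummable A f <-> nnsummable A (fun t => normc (f t)).
Proof.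
rewrite /csummable /summable /nnsummable.
have e t : (`|(normc (f t))%:E|)%E = (normc (f t))%:E.
  by rewrite gee0_abs // lee_fin normc_ge0.
under eq_esum do rewrite e.
by split=> [h|[]//]; split=> // t; exact: normc_ge0.
Qed.

Lemma csummable_le {T : choiceType} (A : set T) (f : T -> R[i]) (p : T -> R) :
  (forall t, A t -> normc (f t) <= p t) -> nnsummable A p -> csummable A f.
Proof.
by move=> fp sp; apply/csummableE; apply: nnsummable_le sp => // t; exact: normc_ge0.
Qed.

Lemma csummable_Re {T : choiceType} (A : set T) (f : T -> R[i]) :
  csummable A f -> rsummable A (fun t => complex.Re (f t)).
Proof. by move=> /csummableE; apply: rsummable_le => t _; exact: normc_Re. Qed.

Lemma csummable_Im {T : choiceType} (A : set T) (f : T -> R[i]) :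
  csummable A f -> rsummable A (fun t => complex.Im (f t)).
Proof. by move=> /csummableE; apply: rsummable_le => t _; exact: normc_Im. Qed.

Lemma csummable_sub {T : choiceType} (A B : set T) (f : T -> R[i]) : A `<=` B ->
  csummable B f -> csummable A f.
Proof. by move=> AB /csummableE s; apply/csummableE; exact: nnsummable_sub s. Qed.

Lemma eq_csummable {T : choiceType} (A : set T) (f g : T -> R[i]) :
  (forall t, A t -> f t = g t) -> csummable A f -> csummable A g.
Proof.
by move=> fg /csummableE s; apply: csummable_le s => t /fg ->.
Qed.

Lemma eq_csum {T : choiceType} (A : set T) (f g : T -> R[i]) :
  (forall t, A t -> f t = g t) -> csum A f = csum A g.
Proof. by move=> fg; congr (_ +i* _); apply: eq_rsum => t /fg ->. Qed.

Lemma csumZ {T : choiceType} (A : set T) (f : T -> R[i]) c : csummable A f ->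
  csummable A (fun t => c * f t) /\ csum A (fun t => c * f t) = c * csum A f.
Proof.
move=> sf; split.
  have /csummableE s := sf.
  apply: csummable_le (nnsumZ (normc_ge0 c) s).1 => t _.
  by rewrite Normc.normcM.
have [sR sI] := (csummable_Re sf, csummable_Im sf).
have Z k g : rsummable A g -> rsummable A (fun t => k * g t).
  by move=> sg; apply: rsummable_le (nnsumZ (normr_ge0 k) sg).1 => t _; rewrite normrM.
apply: complex_ext; rewrite /csum /= ?cReM ?cImM /=.
  rewrite -mulNr -!rsumZ // -rsumD; try exact: Z.
  by apply: eq_rsum => t _; rewrite cReM mulNr.
rewrite -!rsumZ // -rsumD; try exact: Z.
by apply: eq_rsum => t _; rewrite cImM.
Qed.

Lemma csumD {T : choiceType} (A : set T) (f g : T -> R[i]) :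
  csummable A f -> csummable A g ->
  csummable A (fun t => f t + g t) /\
  csum A (fun t => f t + g t) = csum A f + csum A g.
Proof.
move=> sf sg; split.
  have [/csummableE s1 /csummableE s2] := (sf, sg).
  apply: csummable_le (nnsumD s1 s2).1 => t _; exact: le_normcD.
apply: complex_ext; rewrite ?cReD ?cImD /=.
  rewrite -rsumD; [|exact: csummable_Re|exact: csummable_Re].
  by apply: eq_rsum => t _; rewrite cReD.
rewrite -rsumD; [|exact: csummable_Im|exact: csummable_Im].
by apply: eq_rsum => t _; rewrite cImD.
Qed.

Lemma csum_widen {T : choiceType} (A B : set T) (f : T -> R[i]) : A `<=` B ->
  (forall t, B t -> ~ A t -> f t = 0) -> csum A f = csum B f.
Proof.
by move=> AB f0; congr (_ +i* _); apply: rsum_widen => // t Bt At; rewrite f0.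
Qed.

Lemma csummable_widen {T : choiceType} (A B : set T) (f : T -> R[i]) : A `<=` B ->
  (forall t, B t -> ~ A t -> f t = 0) -> csummable A f -> csummable B f.
Proof.
move=> AB f0 /csummableE s; apply/csummableE; split; first by move=> t; exact: normc_ge0.
case: s => _; rewrite [X in (_ -> X < _)%E](esumID A) => [|t _]; last first.
  by rewrite lee_fin normc_ge0.
rewrite setIidr // [X in (_ + X)%E]esum1 ?adde0 // => t [Bt At].
by rewrite f0 // Normc.normc0.
Qed.

Lemma csum_set1 {T : choiceType} (t : T) (f : T -> R[i]) : csum [set t] f = f t.
Proof. by rewrite /csum !rsum_set1; case: (f t). Qed.

Lemma csummable_set1 {T : choiceType} (t : T) (f : T -> R[i]) : csummable [set t] f.
Proof. by apply/csummableE; apply: (nnsum_finite _ _).1 => // u; exact: normc_ge0. Qed.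

Lemma csum0 {T : choiceType} (A : set T) : csum A (fun=> 0 : R[i]) = 0.
Proof.
rewrite -(@csum_widen _ set0 A) //.
by rewrite /csum !rsum_finite // fset_set0 !big_nil.
Qed.

Lemma csummable0 {T : choiceType} (A : set T) : csummable A (fun=> 0 : R[i]).
Proof.
apply: (@csummable_widen _ set0) => //; apply/csummableE.
by apply: (nnsum_finite _ _).1 => // u; exact: normc_ge0.
Qed.

Lemma csum_sum {T : choiceType} (J : eqType) (l : seq J) (A : set T) (F : J -> T -> R[i]) :
  {in l, forall j, csummable A (F j)} ->
  csummable A (fun t => \sum_(j <- l) F j t) /\
  csum A (fun t => \sum_(j <- l) F j t) = \sum_(j <- l) csum A (F j).
Proof.
elim: l => [_|j l IH h].
  rewrite big_nil; under eq_fun do rewrite big_nil.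
  by rewrite csum0; split=> //; exact: csummable0.
have [s e] := IH (fun k kl => h k (mem_behead (kl : k \in behead (j :: l)))).
have [s' e'] := csumD (h j (mem_head _ _)) s.
rewrite big_cons -e -e'.
by split; [apply: eq_csummable s'|apply: eq_csum] => t _; rewrite big_cons.
Qed.

Lemma csum_image {T U : choiceType} (A : set T) (h : T -> U) (f : U -> R[i]) :
  set_inj A h -> csum (h @` A) f = csum A (f \o h) /\
  (csummable A (f \o h) -> csummable (h @` A) f).
Proof.
move=> hI; split; first by rewrite /csum !rsum_image.
move=> /csummableE s; apply/csummableE.
by apply: (nnsum_image (fun u => normc (f u)) hI).2 => // u; exact: normc_ge0.
Qed.

Lemma csummable_image {T U : choiceType} (A : set T) (h : T -> U) (f : U -> R[i]) :
  set_inj A h -> csummable (h @` A) f -> csummable A (f \o h).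
Proof.
move=> hI /csummableE[_]; rewrite (esum_image A h) // => s; apply/csummableE.
by split=> // t; exact: normc_ge0.
Qed.

Lemma csum_bigcup {T U : choiceType} (I : set U) (A : U -> set T) (f : T -> R[i]) :
  finite_set I -> trivIset I A -> csummable (\bigcup_(i in I) A i) f ->
  csum (\bigcup_(i in I) A i) f = \sum_(i \in I) csum (A i) f.
Proof.
move=> finI tA sf; set B := \bigcup_(i in I) A i.
(* Extended by zero, the pieces become finitely many families on one index set; by disjointness at
   most one of them is nonzero at each point. *)
pose F i t := if t \in A i then f t else 0.
have sF i : csummable B (F i).
  have /csummableE s := sf; apply: csummable_le s => t _; rewrite /F.
  by case: ifP; rewrite // Normc.normc0 normc_ge0.
have [_] := @csum_sum _ _ (fset_set I) B F (fun i _ => sF i).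
rewrite fsbig_finite // => e.
have -> : csum B f = csum B (fun t => \sum_(j <- fset_set I) F j t).
  apply: eq_csum => t [i Ii Ait].
  have iI : i \in fset_set I by rewrite in_fset_set // mem_set.
  rewrite (big_rem i) //= /F mem_set // big_seq big1 ?addr0 // => j.
  rewrite mem_rem_uniq ?fset_uniq // !inE => /andP[ji jI].
  case: ifP => // /set_mem Ajt; move: jI; rewrite in_fset_set // => /set_mem Ij.
  by rewrite (tA j i Ij Ii) ?eqxx // in ji; exists t.
rewrite e big_seq [RHS]big_seq; apply: eq_bigr => i.
rewrite in_fset_set // => /set_mem Ii.
rewrite -(@csum_widen _ (A i) B) => [|t At|t _ nA].
- by apply: eq_csum => t At; rewrite /F mem_set.
- by exists i.
- by rewrite /F memNset.
Qed.

(** Real and imaginary parts are bounded separately, whence the 2; this is enough for the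
    summability in [csum_fubini]. *)
Lemma normc_csum {T : choiceType} (A : set T) (f : T -> R[i]) : csummable A f ->
  normc (csum A f) <= 2 * nnsum A (fun t => normc (f t)).
Proof.
move=> sf; apply: le_trans (normc_le _) _; rewrite /csum /=.
have /csummableE s := sf.
have h1 : `|rsum A (fun t => complex.Re (f t))| <= nnsum A (fun t => normc (f t)).
  apply: le_trans (rsum_norm_le (csummable_Re sf)) _.
  by apply: le_nnsum => // t _; exact: normc_Re.
have h2 : `|rsum A (fun t => complex.Im (f t))| <= nnsum A (fun t => normc (f t)).
  apply: le_trans (rsum_norm_le (csummable_Im sf)) _.
  by apply: le_nnsum => // t _; exact: normc_Im.
lra.
Qed.

Lemma csum_fubini {T U : choiceType} (A : set T) (B : set U) (f : T * U -> R[i]) :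
  csummable (A `*` B) f ->
  [/\ forall a, A a -> csummable B (fun b => f (a, b)),
      csummable A (fun a => csum B (fun b => f (a, b))) &
      csum (A `*` B) f = csum A (fun a => csum B (fun b => f (a, b)))].
Proof.
move=> sf; have /csummableE s := sf; have [s1 s2 _] := nnsum_fubini s.
have s3 a : A a -> csummable B (fun b => f (a, b)) by move=> /s1 ?; apply/csummableE.
split=> //.
  apply: csummable_le (nnsumZ (ler0n R 2) s2).1 => a Aa.
  by apply: normc_csum; exact: s3.
congr (_ +i* _).
  by have [_ _ ->] := rsum_fubini (csummable_Re sf).
by have [_ _ ->] := rsum_fubini (csummable_Im sf).
Qed.

Lemma csum_swap {T U : choiceType} (A : set T) (B : set U) (f : T * U -> R[i]) :
  csummable (A `*` B) f ->
  csummable (B `*` A) (fun k => f (k.2, k.1)) /\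
  csum (B `*` A) (fun k => f (k.2, k.1)) = csum (A `*` B) f.
Proof.
pose sw (k : T * U) := (k.2, k.1).
have swI : set_inj (A `*` B) sw by move=> [a b] [a' b'] _ _ [-> ->].
have e : sw @` (A `*` B) = B `*` A.
  apply/seteqP; split=> [_ [[a b] [Aa Bb] <-]//|[b a] [/= Bb Aa]].
  by exists (a, b).
have [h1 h2] := csum_image (fun k => f (k.2, k.1)) swI.
rewrite -e h1 => sf; split; first by apply: h2; apply: eq_csummable sf => -[].
by apply: eq_csum => -[].
Qed.

Lemma csum_prod {T U : choiceType} (A : set T) (B : set U) (f : T -> R[i]) (g : U -> R[i]) :
  csummable A f -> csummable B g ->
  csummable (A `*` B) (fun k => f k.1 * g k.2) /\
  csum (A `*` B) (fun k => f k.1 * g k.2) = csum A f * csum B g.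
Proof.
move=> sf sg; have [/csummableE nf /csummableE ng] := (sf, sg).
have s : csummable (A `*` B) (fun k => f k.1 * g k.2).
  apply/csummableE; apply: nnsummable_fubini => [k|a Aa|]; first exact: normc_ge0.
    by apply/csummableE; have [] := csumZ (f a) sg.
  have e a : nnsum B (fun b => normc (f a * g b)) =
    nnsum B (fun b => normc (g b)) * normc (f a).
    rewrite mulrC -(nnsumZ (normc_ge0 _) ng).2.
    by apply: eq_nnsum => b _; rewrite Normc.normcM.
  rewrite (_ : (fun a => _) = fun a => nnsum B (fun b => normc (g b)) * normc (f a));
    last by apply/funext.
  by apply: (nnsumZ _ nf).1; apply: nnsum_ge0 => b; exact: normc_ge0.
split=> //; have [_ _ ->] := csum_fubini s.
rewrite mulrC -(csumZ _ sf).2; apply: eq_csum => a _ /=.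
by rewrite (csumZ _ sg).2 mulrC.
Qed.

End RealSums.

(** * Convergence and bounds for the Fourier coefficients *)

Section PSeries.
Context {R : realType}.

(* [(n + 1) ^ (- (d + 1))] is dominated by the telescoping difference
   [(n ^ (- d) - (n + 1) ^ (- d)) / d]. *)
Lemma pseries_partial (d : R) (N : nat) : 0 < d ->
  \sum_(0 <= n < N.+1) expR (- (d + 1) * ln n.+1%:R) <=
  1 + d^-1 - d^-1 * expR (- d * ln N.+1%:R).
Proof.
move=> d0; elim: N => [|N IH].
  by rewrite big_nat1 ln1 !mulr0 expR0; lra.
rewrite big_nat_recr //=; apply: le_trans (lerD IH (lexx _)) _.
set a := ln N.+2%:R; set b := ln N.+1%:R.
have N1 : 0 < N.+1%:R :> R by rewrite ltr0n.
have N2 : 0 < N.+2%:R :> R by rewrite ltr0n.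
have ab : N.+2%:R^-1 <= a - b.
  have e : b - a = ln (1 - N.+2%:R^-1).
    rewrite -ln_div ?posrE //; congr ln.
    have e2 : N.+2%:R = N.+1%:R + 1 :> R by rewrite natr1.
    rewrite e2; move: (N.+1%:R : R) N1 => x x0; field.
    by rewrite gt_eqF // addr_gt0.
  have lt1 : N.+2%:R^-1 < 1 :> R by rewrite invf_lt1 // ltr1n.
  have := @le_ln1Dx R (- N.+2%:R^-1); rewrite ltrN2 => /(_ lt1); rewrite -e.
  by rewrite -[a - b]opprB lerNr.
have eb : expR (- d * b) = expR (- d * a) * expR (d * (a - b)).
  by rewrite -expRD; congr expR; ring.
have ea : expR (- (d + 1) * a) = expR (- d * a) * N.+2%:R^-1.
  have <- : expR (- a) = N.+2%:R^-1 :> R by rewrite expRN lnK.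
  by rewrite -expRD; congr expR; ring.
move: (N.+2%:R^-1 : R) ab ea => w ab ea.
have h1 := expR_ge1Dx (d * (a - b)).
have A0 := expR_gt0 (- d * a).
rewrite eb ea; set A := expR (- d * a) in A0 *.
set q := expR (d * (a - b)) in h1 *.
have h2 : A * w <= d^-1 * (A * (q - 1)).
  rewrite mulrCA ler_pM2l // -(ler_pM2l d0) mulrA divff ?gt_eqF // mul1r.
  have := ler_wpM2l (ltW d0) ab; lra.
by move: h2; rewrite mulrBr mulr1 mulrBr; lra.
Qed.

Lemma pseries_nnsummable (sg : R) : 1 < sg ->
  nnsummable [set n : int | n != 0] (fun n => expR (- sg * ln `|n%:~R|)).
Proof.
move=> s1; pose q (n : nat) : R := expR (- sg * ln n.+1%:R).
have d0 : 0 < sg - 1 by rewrite subr_gt0.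
have q0 n : 0 <= q n by exact: expR_ge0.
have sq : nnsummable [set: nat] q.
  split=> //; rewrite -nneseries_esumT => [|n]; last by rewrite lee_fin.
  apply: (@le_lt_trans _ _ (1 + (sg - 1)^-1)%:E); last by rewrite ltry.
  apply: lime_le; first by apply: is_cvg_nneseries => n _ _; rewrite lee_fin.
  near=> N; have [M ->] : exists M, N = M.+1.
    by exists N.-1; rewrite prednK //; near: N; exists 1%N.
  rewrite sumEFin lee_fin; have := pseries_partial M d0.
  rewrite subrK; move/le_trans; apply.
  by rewrite lerBlDr lerDl mulr_ge0 ?expR_ge0 // invr_ge0 ltW.
(* The nonzero integers are covered by two injective images of the natural numbers. *)
pose hp (n : nat) : int := n.+1; pose hn (n : nat) : int := - (n.+1 : int).
have Ip : set_inj [set: nat] hp by move=> a b _ _ [].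
have In : set_inj [set: nat] hn by move=> a b _ _ /oppr_inj[].
pose p (n : int) : R := expR (- sg * ln `|n%:~R|).
have p0 n : 0 <= p n by exact: expR_ge0.
have sp : nnsummable (hp @` [set: nat]) p.
  apply: (nnsum_image p Ip).2 => //; apply: nnsummable_le sq => [n|n _]; first exact: p0.
  by rewrite /= /p /q /hp ger0_norm // ler0z.
have sn : nnsummable (hn @` [set: nat]) p.
  apply: (nnsum_image p In).2 => //; apply: nnsummable_le sq => [n|n _]; first exact: p0.
  by rewrite /= /p /q /hn rmorphN normrN ger0_norm // ler0z.
split=> //; rewrite (esumID (hp @` [set: nat])) => [|n _]; last by rewrite lee_fin.
apply: lte_add_pinfty.
  by have [] := @nnsummable_sub _ _ ([set n : int | n != 0] `&` hp @` [set: nat]) _ _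
    (@subIsetr _ _ _) sp.
suff sub : [set n : int | n != 0] `&` ~` (hp @` [set: nat]) `<=` hn @` [set: nat].
  by have [] := nnsummable_sub sub sn.
move=> [[|n]|n] [/= n0 nP]; [by []|by exfalso; apply: nP; exists n|].
by exists n => //; rewrite /hn NegzE.
Unshelve. all: by end_near. Qed.

(* The Fourier coefficients of [L], up to a constant; zero at [n = 0]. *)
Definition cinv (s : R[i]) (n : int) : R[i] :=
  if n == 0 then 0 else (cpow n%:~R s)^-1.

Lemma intr_complex (n : int) : (n%:~R : R[i]) = (n%:~R : R)%:C.
Proof. by rewrite rmorph_int. Qed.

Lemma normc_cinv (s : R[i]) (n : int) :
  Normc.normc (cinv s n) <= expR (pi * `|complex.Im s|) * expR (- complex.Re s * ln
    `|n%:~R|).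
Proof.
rewrite /cinv; have [_|n0] := eqVneq n 0.
  by rewrite Normc.normc0 mulr_ge0 // expR_ge0.
rewrite intr_complex Normc.normcV.
have nR : n%:~R != 0 :> R by rewrite intr_eq0.
have h := normc_cpow_ge s nR.
have p1 : 0 < Normc.normc (cpow (n%:~R : R)%:C s) by rewrite normc_gt0 cpow_neq0.
by rewrite mulNr expRN ler_pdivlMr ?expR_gt0 // mulrC ler_pdivrMr.
Qed.

(** A nonzero integer has absolute value at least 1. This controls the factors on which convergence
    does not rest. *)
Lemma normc_cinv_bounded (s : R[i]) (n : int) : 0 <= complex.Re s ->
  Normc.normc (cinv s n) <= expR (pi * `|complex.Im s|).
Proof.
move=> s0; apply: le_trans (normc_cinv s n) _.
rewrite ler_piMr ?expR_ge0 // expR_le1 mulNr oppr_le0 mulr_ge0 //.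
have [->|n0] := eqVneq n 0; first by rewrite normr0 ln0.
by apply: ln_ge0; rewrite -intr_norm -[1]/(1%:~R) ler_int -gtz0_ge1 normr_gt0.
Qed.

Lemma csummable_cinv (s : R[i]) : 1 < complex.Re s ->
  csummable [set n : int | n != 0] (cinv s).
Proof.
move=> s1; apply: csummable_le (nnsumZ (expR_ge0 (pi * `|complex.Im s|))
  (pseries_nnsummable s1)).1.
by move=> n _; exact: normc_cinv.
Qed.

End PSeries.

(** * Termwise integration of Fourier series *)

Section UnitIntegrals.
Context {R : realType}.
Local Notation mu := (@lebesgue_measure R).
Local Notation I01 := (`[0, 1]%classic : set R).
Local Notation normc := Normc.normc.

Lemma lebesgue_measure01 : mu I01 = 1%E.
Proof. by rewrite lebesgue_measure_itv /= lte_fin ltr01 sube0. Qed.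

Lemma Rintegral01_cst (c : R) : \int[mu]_(x in I01) c = c.
Proof.
have e := lebesgue_measure01.
by rewrite Rintegral_cst // [X in fine X](_ : _ = 1%E) ?mulr1.
Qed.

Lemma integrable01_cst (c : R) : mu.-integrable I01 (EFin \o (fun=> c)).
Proof.
have h : {within I01, continuous (fun=> c)} by apply: continuous_subspaceT => x;
  exact: cvg_cst.
by apply: continuous_compact_integrable h; exact: segment_compact.
Qed.

Lemma integrable01_bounded (f : R -> R) (c : R) : measurable_fun I01 f ->
  (forall x, I01 x -> `|f x| <= c) -> mu.-integrable I01 (EFin \o f).
Proof.
move=> mf fc; apply: le_integrable (integrable01_cst c) => //.
  exact/measurable_EFinP.
by move=> x Ix; rewrite lee_fin (le_trans (fc x Ix)) // ler_norm.
Qed.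

Lemma Rintegral01_dist_le (f g : R -> R) e :
  mu.-integrable I01 (EFin \o f) -> mu.-integrable I01 (EFin \o g) ->
  (forall x, I01 x -> `|f x - g x| <= e) ->
  `|\int[mu]_(x in I01) f x - \int[mu]_(x in I01) g x| <= e.
Proof.
move=> hf hg fg; have mI : measurable I01 by [].
have h : mu.-integrable I01 (EFin \o (fun x => f x - g x)) by apply: integrable_sub.
rewrite -RintegralB //; apply: le_trans (le_normr_Rintegral _ h) _ => //.
rewrite -[leRHS]Rintegral01_cst; apply: le_Rintegral => //.
- have h' : mu.-integrable I01 (abse \o (EFin \o (fun x => f x - g x))) by exact:
    integrable_abse.
  by apply: eq_integrable h'.
- exact: integrable01_cst.
Qed.

Lemma integrable01_sum {T : eqType} (l : seq T) (g : T -> R -> R) :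
  {in l, forall t, mu.-integrable I01 (EFin \o g t)} ->
  mu.-integrable I01 (EFin \o (fun x => \sum_(t <- l) g t x)) /\
  \int[mu]_(x in I01) (\sum_(t <- l) g t x) = \sum_(t <- l) \int[mu]_(x in I01) g t x.
Proof.
elim: l => [_|t l IH h].
  under eq_Rintegral do rewrite big_nil.
  rewrite big_nil; split; last exact: Rintegral01_cst.
  by apply: eq_integrable (integrable01_cst 0) => // x _; rewrite /= big_nil.
have [i e] := IH (fun k kl => h k (mem_behead (kl : k \in behead (t :: l)))).
have it := h t (mem_head _ _).
split; first by apply: eq_integrable (integrable_add _ it i) => // x _; rewrite /= big_cons.
by under eq_Rintegral do rewrite big_cons; rewrite RintegralD // big_cons e.
Qed.

(** The partial sums over finite sets [X n] leaving a tail of the majorant below 1/(n+1) converge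
    uniformly on the interval; this yields the measurability of the sum as well as the exchange. *)
Lemma rsum_integral {T : choiceType} (A : set T) (g : T -> R -> R) (p : T -> R) :
  nnsummable A p -> (forall t x, A t -> I01 x -> `|g t x| <= p t) ->
  (forall t, A t -> mu.-integrable I01 (EFin \o g t)) ->
  mu.-integrable I01 (EFin \o (fun x => rsum A (fun t => g t x))) /\
  \int[mu]_(x in I01) rsum A (fun t => g t x) =
  rsum A (fun t => \int[mu]_(x in I01) g t x).
Proof.
move=> sp gp ig; pose S x := rsum A (fun t => g t x).
have hX (n : nat) : {X : set T | [/\ finite_set X,
  X `<=` A & nnsum (A `\` X) p < n.+1%:R^-1]}.
  by apply: cid; apply: nnsum_tail; rewrite ?invr_gt0 ?ltr0n.
pose X n := sval (hX n).
have finX n : finite_set (X n) by have [] := svalP (hX n).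
have XA n : X n `<=` A by have [] := svalP (hX n).
have tX n : nnsum (A `\` X n) p < n.+1%:R^-1 by have [] := svalP (hX n).
have inX n t : t \in fset_set (X n) -> A t by rewrite in_fset_set // => /set_mem/XA.
pose Sn n x := \sum_(t <- fset_set (X n)) g t x.
have iSn n : mu.-integrable I01 (EFin \o Sn n) /\
    \int[mu]_(x in I01) Sn n x = \sum_(t <- fset_set (X n)) \int[mu]_(x in I01) g t x.
  by apply: integrable01_sum => t /inX/ig.
have app n x : I01 x -> `|S x - Sn n x| <= n.+1%:R^-1.
  move=> Ix; apply: le_trans (ltW (tX n)).
  by apply: rsum_approx => // t At; exact: gp.
have mS : measurable_fun I01 S.
  apply: (@measurable_fun_cvg _ _ _ _ Sn) => [n|x Ix].
    by apply/measurable_EFinP; exact: measurable_int (iSn n).1.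
  apply/cvgrPdist_le => /= e e0; near=> n; apply: le_trans (app n x Ix) _.
  by apply: ltW; near: n; exact: near_infty_natSinv_lt (PosNum e0).
have iS : mu.-integrable I01 (EFin \o S).
  apply: (integrable01_bounded (c := nnsum A p)) => // x Ix.
  apply: le_trans (rsum_norm_le (rsummable_le (fun t At => gp t x At Ix) sp)) _.
  by apply: le_nnsum => // t At; exact: gp.
split=> //.
have gI t : A t -> `|\int[mu]_(x in I01) g t x| <= p t.
  move=> At; have := @Rintegral01_dist_le (g t) (fun=> 0) (p t) (ig t At)
    (integrable01_cst 0).
  rewrite Rintegral01_cst subr0; apply => x Ix.
  by rewrite subr0 gp.
have d n : `|\int[mu]_(x in I01) S x - rsum A (fun t => \int[mu]_(x in I01) g t x)| <= 2
  * n.+1%:R^-1.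
  have h1 := Rintegral01_dist_le iS (iSn n).1 (app n).
  have h2 := le_trans (rsum_approx (finX n) (XA n) sp gI) (ltW (tX n)).
  rewrite -(iSn n).2 in h2.
  rewrite -[_ - rsum _ _](subrKA (\int[mu]_(x in I01) Sn n x)).
  by apply: le_trans (ler_normD _ _) _; rewrite [X in _ + X]distrC mulr_natl mulr2n lerD.
apply/eqP; rewrite -subr_eq0 -normr_le0 leNgt; apply/negP => h.
set D := `|_ - _| in h d.
(* For this index 2/(n+1) is smaller than [D]. *)
have := d (Num.truncn (2 / D)); rewrite leNgt => /negP; apply.
by rewrite ltr_pdivrMr ?ltr0n // mulrC -ltr_pdivrMr // truncnS_gt.
Unshelve. all: by end_near. Qed.

Lemma csum_integral {T : choiceType} (A : set T) (f : T -> R -> R[i]) (p : T -> R) :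
  nnsummable A p -> (forall t x, A t -> I01 x -> normc (f t x) <= p t) ->
  (forall t, A t -> mu.-integrable I01 (EFin \o (fun x => complex.Re (f t x)))) ->
  (forall t, A t -> mu.-integrable I01 (EFin \o (fun x => complex.Im (f t x)))) ->
  cint I01 (fun x => csum A (fun t => f t x)) = csum A (fun t => cint I01 (f t)).
Proof.
move=> sp fp iR iI.
have fR t x : A t -> I01 x -> `|complex.Re (f t x)| <= p t.
  by move=> At Ix; apply: le_trans (normc_Re _) (fp t x At Ix).
have fI t x : A t -> I01 x -> `|complex.Im (f t x)| <= p t.
  by move=> At Ix; apply: le_trans (normc_Im _) (fp t x At Ix).
by rewrite /cint /csum (rsum_integral sp fR iR).2 (rsum_integral sp fI iI).2.
Qed.

Lemma e2pii_parts (x : R) :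
  complex.Re (e2pii x) = cos (2 * pi * x) /\ complex.Im (e2pii x) = sin (2 * pi * x).
Proof. by rewrite /e2pii /cexp /= expR0 !mul1r. Qed.

(** The hypothesis on the sine is periodicity: the antiderivative takes the same value at both ends
    of the interval. *)
Lemma cos_scale_integral (k th : R) : sin (k + th) = sin th -> k != 0 ->
  \int[mu]_(x in I01) cos (k * x + th) = 0.
Proof.
move=> sk k0; pose F x := k^-1 * sin (k * x + th).
have dF (x : R) : is_derive x (1 : R) F (cos (k * x + th)).
  have d1 : is_derive x (1 : R) (fun u => k * u + th) k.
    by apply: is_derive_eq; rewrite /GRing.scale /=; ring.
  have d2 := @is_derive1_comp _ sin _ _ _ _ (is_derive_sin _) d1.
  by apply: is_derive_eq; rewrite /GRing.scale /=; field.
have ccos : continuous (fun x => cos (k * x + th)).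
  move=> x; apply: (@continuous_comp _ _ _ (fun u => k * u + th) cos).
    by apply: cvgD; [apply: cvgM; [exact: cvg_cst|exact: cvg_id]|exact: cvg_cst].
  exact: continuous_cos.
have cF : continuous F.
  by move=> x; have [/derivable1_diffP/differentiable_continuous] := dF x.
rewrite /Rintegral (@continuous_FTC2 _ _ F) ?ltr01 //.
- by rewrite /F mulr1 mulr0 add0r sk -EFinB subrr.
- exact: continuous_subspaceT.
- by split=> [x _||]; [have [] := dF x|apply: cvg_at_right_filter;
    exact: cF|apply: cvg_at_left_filter; exact: cF].
- by move=> x _; rewrite derive1E derive_val.
Qed.

(** Orthogonality of the characters of the circle. Writing the sine as a cosine of shifted phase
    lets the single real integral [iE] serve both parts. *)
Lemma cint_e2pii (c : R[i]) (n : int) :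
  [/\ mu.-integrable I01 (EFin \o (fun x => complex.Re (c * e2pii (n%:~R * x)))),
      mu.-integrable I01 (EFin \o (fun x => complex.Im (c * e2pii (n%:~R * x)))) &
      cint I01 (fun x => c * e2pii (n%:~R * x)) = if n == 0 then c else 0].
Proof.
pose k : R := 2 * pi * n%:~R.
have ct th : mu.-integrable I01 (EFin \o (fun x => cos (k * x + th))).
  apply: continuous_compact_integrable; first exact: segment_compact.
  apply: continuous_subspaceT => x.
  apply: (@continuous_comp _ _ _ (fun u => k * u + th) cos).
    by apply: cvgD; [apply: cvgM; [exact: cvg_cst|exact: cvg_id]|exact: cvg_cst].
  exact: continuous_cos.
have iE th : \int[mu]_(x in I01) cos (k * x + th) = if n == 0 then cos th else 0.
  have [n0|n0] := eqVneq n 0.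
    rewrite -[RHS]Rintegral01_cst; apply: eq_Rintegral => x _.
    by rewrite /k n0 mulr0 mul0r add0r.
  apply: cos_scale_integral; last first.
    by rewrite !mulf_neq0 ?intr_eq0 // gt_eqF ?pi_gt0.
  have [e1 e2] := e2pii_parts (n%:~R); rewrite e2pii_int /= in e1 e2.
  by rewrite sinD -e1 -e2 mul1r mul0r add0r.
have trig x : complex.Re (e2pii (n%:~R * x)) = cos (k * x + 0) /\
    complex.Im (e2pii (n%:~R * x)) = - cos (k * x + pi / 2).
  have [-> ->] := e2pii_parts (n%:~R * x).
  by rewrite cosDpihalf opprK addr0 /k !mulrA.
have Re_ : (fun x => complex.Re (c * e2pii (n%:~R * x))) =
    fun x => complex.Re c * cos (k * x + 0) + complex.Im c * cos (k * x + pi / 2).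
  by apply/funext => x; rewrite cReM !(trig x).1 !(trig x).2 mulrN opprK.
have Im_ : (fun x => complex.Im (c * e2pii (n%:~R * x))) =
    fun x => complex.Im c * cos (k * x + 0) - complex.Re c * cos (k * x + pi / 2).
  by apply/funext => x; rewrite cImM !(trig x).1 !(trig x).2 mulrN addrC.
have mI : measurable I01 by [].
have i1 (a : R) th : mu.-integrable I01 (EFin \o (fun x => a * cos (k * x + th))).
  by apply: integrable_scale.
split; first by rewrite Re_; apply: integrable_add.
  by rewrite Im_; apply: integrable_sub.
rewrite /cint Re_ Im_ RintegralD // RintegralB // !RintegralZl // !iE.
case: eqP => _; rewrite ?mulr0 ?addr0 ?subr0 //.
by rewrite cos0 cos_pihalf !mulr1 !mulr0 addr0 subr0; case: (c).
Qed.

End UnitIntegrals.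

(** * Iterated integrals of products of L against exponentials *)

Section IteratedIntegrals.
Context {R : realType}.
Local Notation I01 := (`[0, 1]%classic : set R).
Local Notation normc := Normc.normc.
Local Notation Nz := [set n : int | n != 0].

Lemma csummable_bounded {T : choiceType} (A : set T) (g h : T -> R[i]) (c : R) :
  csummable A g -> (forall m, A m -> normc (h m) <= c) ->
  csummable A (fun m => g m * h m).
Proof.
move=> /csummableE sg hc.
have [[m0 Am0]|A0] := pselect (exists m, A m); last first.
  apply/csummableE; apply: nnsummable_le sg => [m|m Am]; first exact: normc_ge0.
  by exfalso; apply: A0; exists m.
have c0 : 0 <= c by apply: le_trans (hc m0 Am0); exact: normc_ge0.
apply: csummable_le (nnsumZ c0 sg).1 => m Am.
by rewrite Normc.normcM mulrC ler_wpM2r ?normc_ge0 ?hc.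
Qed.

Definition L_factor (s : R[i]) : R[i] := - (Gamma (s + 1) / cpow ((2 * pi) *i) s).

Lemma L_fourier (s : R[i]) (x : R) :
  L s x = L_factor s * csum Nz (fun n => e2pii (n%:~R * x) * cinv s n).
Proof.
by rewrite /L; congr (_ * _); apply: eq_csum => n /= n0; rewrite /cinv (negPf n0).
Qed.

(** Expand both factors and integrate termwise: of the pairs [(k, m)] only those with [k = - n m]
    survive. If [n m = 0] there is no such [k] among the nonzero frequencies, in agreement with the
    value 0 of [cinv s 0]. *)
Lemma cint_L_csum {T : choiceType} (A : set T) (g : T -> R[i]) (n : T -> int) (s : R[i]) :
  1 < complex.Re s -> csummable A g ->
  cint I01 (fun t => L s t * csum A (fun m => g m * e2pii ((n m)%:~R * t))) =
  L_factor s * csum A (fun m => g m * cinv s (- n m)).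
Proof.
move=> s1 sg; have sc := csummable_cinv s1.
have [sp _] := csum_prod sc sg.
pose f (k : int * T) t := L_factor s * (cinv s k.1 * g k.2) * e2pii ((k.1 + n k.2)%:~R * t).
have [sf _] := csumZ (L_factor s) sp.
have e1 t : L s t * csum A (fun m => g m * e2pii ((n m)%:~R * t)) =
  csum (Nz `*` A) (fun k => f k t).
  have su : csummable Nz (fun k : int => e2pii (k%:~R * t) * cinv s k).
    apply: eq_csummable (@csummable_bounded _ _ (cinv s) (fun k : int => e2pii (k%:~R *
      t)) 1 sc _).
      by move=> k _; rewrite mulrC.
    by move=> k _; rewrite normc_e2pii.
  have sw : csummable A (fun m => g m * e2pii ((n m)%:~R * t)).
    by apply: (csummable_bounded (c := 1)) => // m _; rewrite normc_e2pii.
  have [sx ex] := csum_prod su sw.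
  rewrite L_fourier -mulrA -ex -(csumZ _ sx).2; apply: eq_csum => -[k m] _ /=.
  rewrite /f /= intrD mulrDl e2piiD; ring.
rewrite (_ : (fun t => _) = fun t => csum (Nz `*` A) (fun k => f k t));
  last by apply/funext.
have /csummableE sf' := sf.
rewrite (csum_integral (f := f) sf'); last 3 first.
- by move=> k t _ _; rewrite /f Normc.normcM normc_e2pii mulr1.
- by move=> k _; have [] := cint_e2pii (L_factor s * (cinv s k.1 * g k.2)) (k.1 + n k.2).
- by move=> k _; have [] := cint_e2pii (L_factor s * (cinv s k.1 * g k.2)) (k.1 + n k.2).
pose h (k : int * T) : R[i] := if k.1 + n k.2 == 0 then L_factor s * (cinv s k.1 * g k.2)
  else 0.
have sh : csummable (Nz `*` A) h.
  apply: csummable_le sf' => k _; rewrite /h.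
  by case: ifP => // _; rewrite Normc.normc0 normc_ge0.
rewrite (@eq_csum _ _ _ _ h) => [|k _]; last first.
  by have [_ _ ->] := cint_e2pii (L_factor s * (cinv s k.1 * g k.2)) (k.1 + n k.2).
have [sh' <-] := csum_swap sh; have [_ _ ->] := csum_fubini sh'.
have sgc : csummable A (fun m => g m * cinv s (- n m)).
  apply: (csummable_bounded (c := expR (pi * `|complex.Im s|))) => // m _.
  by apply: normc_cinv_bounded; apply/ltW/(lt_trans ltr01).
rewrite -(csumZ _ sgc).2; apply: eq_csum => m _; rewrite /h /=.
have [n0|n0] := eqVneq (n m) 0.
  rewrite (@eq_csum _ _ _ _ (fun=> 0)) => [|k /= k0]; last by rewrite n0 addr0 (negPf k0).
  by rewrite csum0 n0 oppr0 /cinv eqxx !mulr0.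
rewrite -(@csum_widen _ _ [set - n m]) => [|k ->|k _ /= kn].
- by rewrite csum_set1 addNr eqxx; ring.
- by rewrite /= oppr_eq0.
- by case: eqP => // /eqP; rewrite addr_eq0 => /eqP.
Qed.

(** Induction on [E] with [C], [g] and [x0] free: fixing the outer variable at [t] moves [L (s a) t]
    into [C] and the exponential in [t] into [g], and the outer integral is then an instance of
    [cint_L_csum]. *)
Lemma iterated_L {T : eqType} {M : choiceType} (E : seq T) (A : set M) (s : T -> R[i])
    (n : T -> M -> int) (F : (T -> R) -> R[i]) (x0 : T -> R) (C : R[i]) (g : M -> R[i]) :
  uniq E -> {in E, forall a, 1 < complex.Re (s a)} -> csummable A g ->
  (forall x : T -> R, (forall b, b \notin E -> x b = x0 b) ->
    F x = C * \prod_(a <- E) L (s a) (x a) *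
      csum A (fun m => g m * \prod_(a <- E) e2pii ((n a m)%:~R * x a))) ->
  iterated_cint01 E F x0 =
  C * \prod_(a <- E) L_factor (s a) * csum A (fun m => g m * \prod_(a <- E) cinv (s a) (-
    n a m)).
Proof.
elim: E x0 C g => [|a E IH] x0 C g /=.
  move=> _ _ _ -> //; rewrite !big_nil; congr (_ * _).
  by apply: eq_csum => m _; rewrite !big_nil.
move=> /andP[aE uE] hs sg hF.
have hs' : {in E, forall b, 1 < complex.Re (s b)}.
  by move=> b bE; apply: hs; rewrite inE bE orbT.
have sa : 1 < complex.Re (s a) by apply: hs; rewrite mem_head.
pose g'' m := g m * \prod_(b <- E) cinv (s b) (- n b m).
have sg'' : csummable A g''.
  apply: (csummable_bounded (c := \prod_(b <- E) expR (pi * `|complex.Im (s b)|))) => //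
    m _.
  rewrite normc_prod big_seq [leRHS]big_seq; apply: ler_prod => b bE.
  rewrite normc_ge0 normc_cinv_bounded //.
  by apply/ltW/(lt_trans ltr01)/hs'.
have e t : iterated_cint01 E F [eta x0 with a |-> t] =
    L (s a) t * csum A (fun m => C * \prod_(b <- E) L_factor (s b) * g'' m * e2pii ((n a
      m)%:~R * t)).
  have sgt : csummable A (fun m => g m * e2pii ((n a m)%:~R * t)).
    by apply: (csummable_bounded (c := 1)) => // m _; rewrite normc_e2pii.
  rewrite (IH _ (C * L (s a) t) (fun m => g m * e2pii ((n a m)%:~R * t))) //.
    have sgt'' : csummable A (fun m => g'' m * e2pii ((n a m)%:~R * t)).
      by apply: (csummable_bounded (c := 1)) => // m _; rewrite normc_e2pii.
    have -> : csum A (fun m => C * \prod_(b <- E) L_factor (s b) * g'' m * e2pii ((n a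
      m)%:~R * t)) =
        C * \prod_(b <- E) L_factor (s b) * csum A (fun m => g'' m * e2pii ((n a m)%:~R *
          t)).
      by rewrite -(csumZ _ sgt'').2; apply: eq_csum => m _; rewrite !mulrA.
    rewrite (@eq_csum _ _ A _ (fun m => g'' m * e2pii ((n a m)%:~R * t))); first by ring.
    by move=> m _; rewrite /g''; ring.
  move=> x hx; have xa : x a = t by rewrite hx //= eqxx.
  rewrite hF => [|b]; last first.
    by rewrite inE negb_or => /andP[ba bE]; rewrite hx //= (negPf ba).
  rewrite big_cons xa mulrA; congr (_ * _); apply: eq_csum => m _.
  by rewrite big_cons xa mulrA.
rewrite (_ : (fun t => _) = fun t => L (s a) t * csum A
  (fun m => C * \prod_(b <- E) L_factor (s b) * g'' m * e2pii ((n a m)%:~R * t)));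
    last exact/funext.
rewrite cint_L_csum //; last by have [] := csumZ (C * \prod_(b <- E) L_factor (s b)) sg''.
have sg3 : csummable A (fun m => g'' m * cinv (s a) (- n a m)).
  apply: (csummable_bounded (c := expR (pi * `|complex.Im (s a)|))) => // m _.
  by apply: normc_cinv_bounded; apply/ltW/(lt_trans ltr01).
rewrite (@eq_csum _ _ A _ (fun m => C * \prod_(b <- E) L_factor (s b) * (g'' m * cinv (s
  a) (- n a m)))); last first.
  by move=> m _; rewrite mulrA.
rewrite (csumZ _ sg3).2 big_cons (@eq_csum _ _ A _ (fun m => g'' m * cinv (s a) (- n a
  m))); first by ring.
by move=> m _; rewrite big_cons /g''; ring.
Qed.

End IteratedIntegrals.

(** * Sums over weights *)

Section WeightSums.
Context {R : realType} {V : vectType R} (dot : {dot V for idfun}).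
Context {r : nat} (D : {fset V}) (Psi : r.-tuple V) (lam : 'I_r -> V).
Hypothesis hlam : fundamental_weights dot Psi lam.
Implicit Types (u v : V) (l : seq 'I_r).
Local Notation al i := (tnth Psi i).
Local Notation co := (coroot dot).

(** A list of indices, with a set of allowed coefficients for each, makes sums over weights
    accessible to induction on the coordinates. *)
Definition weight_cone l (A : 'I_r -> set int) : set V :=
  [set v | exists2 m : 'I_r -> int, {in l, forall i, A i (m i)} &
    v = \sum_(i <- l) lam i *~ m i].

(** The floor only changes the type: a root's coroot takes integer values on the weight lattice. *)
Definition pairing (a v : V) : int := Num.floor (dot (co a) v).

Lemma dot_coroot_weights l (m : 'I_r -> int) i : uniq l ->
  dot (co (al i)) (\sum_(j <- l) lam j *~ m j) = if i \in l then (m i)%:~R else 0.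
Proof.
move=> ul; have e j : dot (co (al i)) (lam j *~ m j) = (i == j)%:R * (m j)%:~R.
  by rewrite -scaler_int dotZr hlam mulrC.
rewrite dot_sumr; under eq_bigr do rewrite e.
case: ifP => [il|/negbT il].
  rewrite (bigD1_seq i) //= eqxx mul1r big1 ?addr0 // => j /negPf.
  by rewrite eq_sym => ->; rewrite mul0r.
rewrite big_seq big1 // => j jl; case: eqP => [ij|]; last by rewrite mul0r.
by rewrite ij jl in il.
Qed.

Lemma pairing_weights l (m : 'I_r -> int) i : uniq l -> i \in l ->
  pairing (al i) (\sum_(j <- l) lam j *~ m j) = m i.
Proof. by move=> ul il; rewrite /pairing dot_coroot_weights // il intrKfloor. Qed.

Lemma weight_cone_cons i l A : i \notin l -> weight_cone (i :: l) A =
  (fun k : int * V => lam i *~ k.1 + k.2) @` (A i `*` weight_cone l A).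
Proof.
move=> il; apply/seteqP; split=> v.
  move=> [m hm ->]; rewrite big_cons; exists (m i, \sum_(j <- l) lam j *~ m j) => //.
  split=> /=; first by apply: hm; rewrite mem_head.
  by exists m => // j jl; apply: hm; rewrite inE jl orbT.
move=> [[n u] /= [An [m hm ->]] <-].
have ne j : j \in l -> (j == i) = false by apply: contraTF => /eqP ->.
exists (fun j => if j == i then n else m j) => [j|].
  rewrite inE; case: eqP => [->//|_ /= jl]; exact: hm.
rewrite big_cons eqxx; congr (_ + _); rewrite big_seq [RHS]big_seq.
by apply: eq_bigr => j /ne ->.
Qed.

Lemma weight_cone_pairing l A v : uniq l -> weight_cone l A v ->
  [/\ {in l, forall i, A i (pairing (al i) v)},
      forall i, dot (co (al i)) v = (pairing (al i) v)%:~R,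
      forall i, i \notin l -> pairing (al i) v = 0 &
      v = \sum_(i <- l) lam i *~ pairing (al i) v].
Proof.
move=> ul [m hm ->]; split=> [i il|i|i il|].
- by rewrite pairing_weights //; exact: hm.
- by rewrite /pairing dot_coroot_weights //; case: ifP; rewrite ?intrKfloor // floor0.
- by rewrite /pairing dot_coroot_weights // (negPf il) floor0.
- by rewrite [LHS]big_seq [RHS]big_seq; apply: eq_bigr => i il; rewrite pairing_weights.
Qed.

(** The cone over [i :: l] is in bijection with the product of the allowed coefficients at [i] and
    the cone over [l], so the sum factors one index at a time. *)
Lemma csum_weight_cone l A (f : 'I_r -> int -> R[i]) : uniq l ->
  {in l, forall i, csummable (A i) (f i)} ->
  csummable (weight_cone l A) (fun v => \prod_(i <- l) f i (pairing (al i) v)) /\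
  csum (weight_cone l A) (fun v => \prod_(i <- l) f i (pairing (al i) v)) =
  \prod_(i <- l) csum (A i) (f i).
Proof.
elim: l => [_ _|i l IH].
  have -> : weight_cone [::] A = [set 0].
    by apply/seteqP; split=> v => [[m _ ->]|->]; [rewrite big_nil|exists (fun=> 0);
      rewrite ?big_nil].
  by split; [exact: csummable_set1|rewrite csum_set1 !big_nil].
move=> /= /andP[il ul] hs.
have sl : {in l, forall j, csummable (A j) (f j)}.
  by move=> j jl; apply: hs; rewrite inE jl orbT.
have [s1 e1] := IH ul sl.
have [s2 e2] := csum_prod (hs i (mem_head _ _)) s1.
pose h (k : int * V) := lam i *~ k.1 + k.2.
have ph k : (A i `*` weight_cone l A) k -> pairing (al i) (h k) = k.1 /\
    {in l, forall j, pairing (al j) (h k) = pairing (al j) k.2}.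
  case: k => n u [/= _ /(weight_cone_pairing ul)[_ uE ul0 _]].
  have e j : dot (co (al j)) (h (n, u)) = (((j == i) : nat)%:Z * n + pairing (al j) u)%:~R.
    by rewrite /h dotDr -scaler_int dotZr hlam uE intrD intrM mulrC; case: (j == i).
  split=> [|j jl]; rewrite /pairing e intrKfloor.
    by rewrite eqxx mul1r ul0 ?addr0.
  by rewrite (_ : (j == i) = false) ?mul0r ?add0r //; apply: contraTF jl => /eqP ->.
have hI : set_inj (A i `*` weight_cone l A) h.
  move=> [n u] [n' u'] /set_mem k1 /set_mem k2 e.
  have [p1 _] := ph _ k1; have [p2 _] := ph _ k2; move: p1 p2; rewrite e => -> /= nn.
  by move: e; rewrite /h /= nn => /addrI ->.
have [e3 s3] := csum_image (fun v => \prod_(j <- i :: l) f j (pairing (al j) v)) hI.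
have eh k : (A i `*` weight_cone l A) k -> f i k.1 * \prod_(j <- l) f j (pairing (al j)
  k.2) =
    \prod_(j <- i :: l) f j (pairing (al j) (h k)).
  move=> /ph[p1 p2]; rewrite big_cons p1; congr (_ * _).
  by rewrite big_seq [RHS]big_seq; apply: eq_bigr => j /p2 ->.
rewrite weight_cone_cons // -/h e3; split.
  by apply: s3; apply: eq_csummable s2 => k kA; rewrite eh.
by rewrite big_cons -e1 -e2; apply: eq_csum => k kA; rewrite [RHS]eh.
Qed.

End WeightSums.

(** * The sum S over a product of two cones of weights *)

Section ParabolicSums.
Context {R : realType} {V : vectType R} (dot : {dot V for idfun}).
Context {r : nat} (D : {fset V}) (Psi : r.-tuple V) (lam : 'I_r -> V).
Context (I : {set 'I_r}) (s : V -> R[i]) (y : V).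
Hypothesis hD : reduced_root_system dot D.
Hypothesis hPsi : fundamental_system D Psi.
Hypothesis hlam : fundamental_weights dot Psi lam.
Hypothesis hsN : {in D, forall a, s (- a) = s a}.
Hypothesis hs : {in pos_roots D Psi, forall a, 1 < complex.Re (s a)}.
Implicit Types (a u v : V).
Local Notation al i := (tnth Psi i).
Local Notation co := (coroot dot).
Local Notation Dp := (pos_roots D Psi).
Local Notation DIp := (parabolic_pos_roots D Psi I).
Local Notation E := (Dp `\` (DIp `|` [fset a | a in (Psi : seq V)]))%fset.
Local Notation pairing := (pairing dot).
Local Notation Nz := [set n : int | n != 0].
Local Notation PI := (weight_cone lam (enum I) (fun=> [set n : int | 1 <= n])).
Local Notation Q := (weight_cone lam (enum (~: I)) (fun=> Nz)).

Lemma simple_inj : injective (fun i => al i).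
Proof.
move=> i j /(congr1 (coord Psi i)); rewrite !(coord_simple hPsi) eqxx.
by case: eqP => // _ /eqP; rewrite oner_eq0.
Qed.

Lemma uniq_simple (J : {set 'I_r}) : uniq [seq al i | i <- enum J].
Proof. by rewrite (map_inj_uniq simple_inj) enum_uniq. Qed.

Lemma mem_simple (J : {set 'I_r}) i : (al i \in [seq al i | i <- enum J]) = (i \in J).
Proof. by rewrite (mem_map simple_inj) mem_enum. Qed.

Lemma simple_pos_root i : al i \in Dp.
Proof. by rewrite mem_pos_roots (simple_root hPsi) (positive_simple hPsi). Qed.

Lemma simple_parabolic i : (al i \in DIp) = (i \in I).
Proof.
rewrite (mem_parabolic_pos_roots hPsi) (simple_root hPsi) (positive_simple hPsi).
by rewrite (supported_simple hPsi).
Qed.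

Lemma mem_E a : (a \in E) = [&& a \in Dp, a \notin DIp & a \notin (Psi : seq V)].
Proof.
rewrite in_fsetD in_fsetU negb_or andbC; congr [&& _, _ & ~~ _].
by apply/imfsetP/idP => [[b /= bP ->//]|aP]; exists a.
Qed.

Lemma parabolic_pos_rootsS a : a \in DIp -> a \in Dp.
Proof. by rewrite in_fsetI => /andP[]. Qed.

Lemma perm_complement_roots :
  perm_eq (Dp `\` DIp)%fset (E ++ [seq al i | i <- enum (~: I)]).
Proof.
apply: uniq_perm; first exact: fset_uniq.
  rewrite cat_uniq fset_uniq uniq_simple andbT /=; apply/hasPn => a /mapP[i _ ->].
  by rewrite /= mem_E mem_tnth !andbF.
move=> a; rewrite mem_cat mem_E in_fsetD; apply/andP/orP.
  move=> [aI aD]; have [/tnthP[i ai]|aP] := boolP (a \in (Psi : seq V)).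
    right; rewrite ai mem_simple inE -simple_parabolic -ai; exact: aI.
  by left; rewrite aI aD.
case=> [/and3P[]//|aS]; have [i + ->] := mapP aS.
by rewrite mem_enum inE -simple_parabolic simple_pos_root => ->.
Qed.

Lemma perm_pos_roots :
  perm_eq Dp (DIp ++ E ++ [seq al i | i <- enum (~: I)]).
Proof.
apply: (@perm_trans _ (DIp ++ (Dp `\` DIp)%fset)); last first.
  by rewrite perm_cat2l perm_complement_roots.
apply: uniq_perm; first exact: fset_uniq.
  rewrite cat_uniq !fset_uniq andbT /=; apply/hasPn => a.
  by rewrite in_fsetD => /andP[].
move=> a; rewrite mem_cat in_fsetD; have [aI|] := boolP (a \in DIp) => //=.
exact: parabolic_pos_rootsS.
Qed.

Lemma prod_pos_roots (F : V -> R[i]) : \prod_(a <- Dp) F a =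
  \prod_(a <- DIp) F a * \prod_(a <- E) F a * \prod_(i in ~: I) F (al i).
Proof.
by rewrite (perm_big _ perm_pos_roots) !big_cat big_map big_enum /= mulrA.
Qed.

Lemma prod_complement_roots (F : V -> R[i]) : \prod_(a <- (Dp `\` DIp)%fset) F a =
  \prod_(a <- E) F a * \prod_(i in ~: I) F (al i).
Proof. by rewrite (perm_big _ perm_complement_roots) big_cat big_map big_enum. Qed.

Lemma prod_pos_roots_simple (F : V -> R[i]) : \prod_(a <- Dp) F a =
  \prod_(i in I) F (al i) * \prod_(i in ~: I) F (al i) *
  \prod_(a <- Dp | a \notin (Psi : seq V)) F a.
Proof.
rewrite (bigID (fun a => a \in (Psi : seq V))) /=; congr (_ * _).
rewrite -(big_filter Dp (fun a => a \in (Psi : seq V))).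
rewrite (perm_big [seq al i | i <- enum [set: 'I_r]%SET]); last first.
  apply: uniq_perm; [by rewrite filter_uniq // fset_uniq|exact: uniq_simple|].
  move=> a; rewrite mem_filter; apply/andP/mapP => [[/tnthP[i ->] _]|[i _ ->]].
    by exists i => //; rewrite mem_enum inE.
  by rewrite mem_tnth simple_pos_root.
rewrite big_map big_enum /= (bigID (mem I)) /=; congr (_ * _); apply: eq_bigl => i.
  by rewrite inE.
by rewrite !inE.
Qed.

Lemma pos_root_sub a : a \in Dp -> a \in D.
Proof. by rewrite mem_pos_roots => /andP[]. Qed.

Lemma pairingE a v : a \in D -> weight_lattice lam v ->
  dot (co a) v = (pairing a v)%:~R.
Proof.
by move=> aD vP; rewrite /pairing floorK // (dot_coroot_int hD hPsi hlam).
Qed.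

Lemma weight_latticeD u v : weight_lattice lam u -> weight_lattice lam v ->
  weight_lattice lam (u + v).
Proof.
move=> [m ->] [m' ->]; exists (fun i => m i + m' i).
by rewrite -big_split; apply: eq_bigr => i _; rewrite mulrzDr.
Qed.

Lemma pairingD a u v : a \in D -> weight_lattice lam u -> weight_lattice lam v ->
  pairing a (u + v) = pairing a u + pairing a v.
Proof.
move=> aD uP vP; have := pairingE aD (weight_latticeD uP vP).
by rewrite dotDr !pairingE // -intrD => /intr_inj.
Qed.

Lemma weight_cone_lattice (J : {set 'I_r}) A v :
  weight_cone lam (enum J) A v -> weight_lattice lam v.
Proof.
move=> /(weight_cone_pairing hlam (enum_uniq _))[_ e _ _].
by apply/(mem_weight_lattice hD hPsi hlam) => i; rewrite e intr_int.
Qed.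

(** Such a coroot involves only the simple coroots with index in [J], which vanish on the weights of
    the complementary cone. *)
Lemma pairing_supported (J : {set 'I_r}) A a v : a \in D -> supported Psi J a ->
  weight_cone lam (enum (~: J)) A v -> dot (co a) v = 0.
Proof.
move=> aD /supportedP sa /(weight_cone_pairing hlam (enum_uniq _))[_ e e0 _].
rewrite (dot_coroot_sum hD hPsi) big1 // => i _; have [iJ|iJ] := boolP (i \in J).
  by rewrite e e0 ?mulr0 // mem_enum inE iJ.
by rewrite /coroot_coeff sa // !mul0r.
Qed.

(* The summand of the zeta functions, extended by zero to the weights lying on
   a wall. *)
Definition xterm v : R[i] := e2pii (dot y v) * \prod_(a <- Dp) cinv (s a) (pairing a v).

Lemma zeta_termE v : weight_lattice lam v -> {in D, forall a, dot (co a) v != 0} ->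
  zeta_term dot D Psi s y v = xterm v.
Proof.
move=> vP reg; rewrite /zeta_term /xterm; congr (_ * _).
rewrite big_seq [RHS]big_seq; apply: eq_bigr => a /pos_root_sub aD.
have := reg a aD; rewrite pairingE // intr_eq0 => /negPf p0.
by rewrite /cinv p0 intr_complex.
Qed.

(** One of [a] and [- a] is positive, so a factor [cinv] at 0 occurs in the product. *)
Lemma xterm_wall v a : weight_lattice lam v -> a \in D -> dot (co a) v = 0 -> xterm v = 0.
Proof.
move=> vP aD a0.
suff [b bD b0] : exists2 b, b \in Dp & dot (co b) v = 0.
  rewrite /xterm (big_rem b) //= /cinv.
  by have := pairingE (pos_root_sub bD) vP; rewrite b0 => /esym/eqP;
    rewrite intr_eq0 => ->; rewrite mul0r mulr0.
have [pa|na] := boolP (positive Psi a).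
  by exists a; rewrite ?mem_pos_roots ?aD.
exists (- a); last by rewrite corootN dotNl a0 oppr0.
by rewrite mem_pos_roots (opp_root hD) // (positiveN hD hPsi).
Qed.

Lemma Re_pos a : a \in Dp -> 0 <= complex.Re (s a).
Proof. by move=> /hs h; apply/ltW/(lt_trans ltr01). Qed.

(** Convergence comes from the simple roots alone: their pairings are the coordinates of the weight,
    so their factors split over [PI] and [Q]. The remaining factors are bounded by the constant
    [c]. *)
Lemma csummable_xterm : csummable (PI `*` Q) (fun k => xterm (k.1 + k.2)).
Proof.
have sA (i : 'I_r) : csummable Nz (cinv (s (al i))).
  by apply/csummable_cinv/hs/simple_pos_root.
have [s1 _] := @csum_weight_cone _ _ dot _ Psi lam hlam (enum I)
  (fun=> [set n : int | 1 <= n]) (fun i => cinv (s (al i))) (enum_uniq _)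
  (fun i _ => csummable_sub (fun n (n1 : 1 <= n) => lt0r_neq0 (lt_le_trans ltr01 n1)) (sA
    i)).
have [s2 _] := @csum_weight_cone _ _ dot _ Psi lam hlam (enum (~: I))
  (fun=> Nz) (fun i => cinv (s (al i))) (enum_uniq _) (fun i _ => sA i).
have [s12 _] := csum_prod s1 s2.
pose h (k : V * V) := e2pii (dot y (k.1 + k.2)) *
  \prod_(a <- Dp | a \notin (Psi : seq V)) cinv (s a) (pairing a (k.1 + k.2)).
pose c := \prod_(a <- Dp | a \notin (Psi : seq V)) expR (pi * `|complex.Im (s a)|).
have hc k : Normc.normc (h k) <= c.
  rewrite /h Normc.normcM normc_e2pii mul1r -big_filter normc_prod /c -[leRHS]big_filter.
  rewrite big_seq [leRHS]big_seq; apply: ler_prod => a; rewrite mem_filter => /andP[_ aD].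
  by rewrite normc_ge0 normc_cinv_bounded // Re_pos.
apply: eq_csummable (csummable_bounded s12 (fun k _ => hc k)) => -[u v] [/= uI vQ].
rewrite /h /xterm /= prod_pos_roots_simple !big_enum /=.
have uP := weight_cone_lattice uI; have vP := weight_cone_lattice vQ.
have [_ eu u0 _] := weight_cone_pairing hlam (enum_uniq _) uI.
have [_ ev v0 _] := weight_cone_pairing hlam (enum_uniq _) vQ.
rewrite [X in _ = _ * (X * _ * _)](_ : _ =
  \prod_(i in I) cinv (s (al i)) (pairing (al i) u)); last first.
  apply: eq_bigr => i iI; rewrite pairingD ?(simple_root hPsi) // v0 ?addr0 //.
  by rewrite mem_enum inE iI.
rewrite [X in _ = _ * (_ * X * _)](_ : _ =
  \prod_(i in ~: I) cinv (s (al i)) (pairing (al i) v)); last first.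
  apply: eq_bigr => i; rewrite inE => iI.
  by rewrite pairingD ?(simple_root hPsi) // u0 ?add0r // mem_enum.
ring.
Qed.

(** The pairings with the simple coroots recover both components of a sum ([hpair]), so addition is
    injective on the product of the cones. Its image consists of the regular weights in question and
    of weights on walls, where [xterm] vanishes. *)
Lemma zetaS_xterm : csummable (half_regular_weights dot D Psi lam I) (zeta_term dot D Psi
  s y) /\
  zetaS dot D Psi lam s y I = csum (PI `*` Q) (fun k => xterm (k.1 + k.2)).
Proof.
pose h (k : V * V) := k.1 + k.2.
have hpair k : (PI `*` Q) k ->
    k = (\sum_(i in I) lam i *~ pairing (al i) (h k),
      \sum_(i in ~: I) lam i *~ pairing (al i) (h k)).
  case: k => u v [/= uI vQ].
  have uP := weight_cone_lattice uI; have vP := weight_cone_lattice vQ.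
  have [_ _ u0 {1}->] := weight_cone_pairing hlam (enum_uniq _) uI.
  have [_ _ v0 {1}->] := weight_cone_pairing hlam (enum_uniq _) vQ.
  rewrite /h !big_enum /=; congr (_, _); apply: eq_bigr => i; rewrite ?inE => iI.
    by rewrite pairingD ?(simple_root hPsi) // v0 ?addr0 // mem_enum inE iI.
  by rewrite pairingD ?(simple_root hPsi) // u0 ?add0r // mem_enum.
have hI : set_inj (PI `*` Q) h.
  by move=> k k' /set_mem/hpair ek /set_mem/hpair ek' e; rewrite ek e -ek'.
have [e1 s1] := csum_image xterm hI.
have {}s1 := s1 csummable_xterm.
have sub : half_regular_weights dot D Psi lam I `<=` h @` (PI `*` Q).
  move=> v [vP vI reg].
  have pE i := pairingE (simple_root hPsi i) vP.
  exists (\sum_(i <- enum I) lam i *~ pairing (al i) v,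
    \sum_(i <- enum (~: I)) lam i *~ pairing (al i) v).
    split; (exists (fun i => pairing (al i) v) => // i; rewrite mem_enum => iI) => /=.
      rewrite -gtz0_ge1 lt_neqAle eq_sym -(intr_eq0 R) -pE reg ?(simple_root hPsi) //=.
      by rewrite -(ler_int R) -pE vI.
    by rewrite -(intr_eq0 R) -pE reg // (simple_root hPsi).
  rewrite /h /= !big_enum /= [RHS](weight_sum hD hPsi hlam) [RHS](bigID (mem I)) /=.
  congr (_ + _); last apply: eq_big => [i|i _]; rewrite ?inE //.
    by apply: eq_bigr => i _; rewrite pE scaler_int.
  by rewrite pE scaler_int.
have reg_term v : half_regular_weights dot D Psi lam I v -> xterm v =
  zeta_term dot D Psi s y v.
  by move=> [vP _ reg]; rewrite zeta_termE.
split.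
  by apply: eq_csummable (csummable_sub sub s1) => v vH; rewrite reg_term.
rewrite -[RHS]e1 -(csum_widen sub) => [|v [[u w] [/= uI wQ] <-] nH].
  by apply: eq_csum => v vH; rewrite reg_term.
apply: contrapT => /eqP x0; apply: nH.
have uP := weight_cone_lattice uI; have wP := weight_cone_lattice wQ.
have vP := weight_latticeD uP wP.
split=> // [i iI|a aD]; last by apply: contra_neq x0 => a0; exact: xterm_wall a0.
rewrite /h /= dotDr.
have [ui eu _ _] := weight_cone_pairing hlam (enum_uniq _) uI.
have [_ ew w0 _] := weight_cone_pairing hlam (enum_uniq _) wQ.
rewrite eu ew w0 ?mem_enum ?inE ?iI // addr0 ler0z.
by apply: le_trans (ui i _); rewrite ?mem_enum.
Qed.

(** The arguments of the functions [L] outside [I] are affine in the integration variables.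
    Expanding only these series puts the integrand in the form of [iterated_L], the variable [x a]
    having frequency [- pairing a (u + v)]. *)
Lemma iterated_term u : PI u ->
  iterated_cint01 E (fun x =>
     e2pii (- \sum_(a <- E) x a * dot (co a) u) * \prod_(a <- E) L (s a) (x a) *
     \prod_(i in ~: I) L (s (al i))
       (dot y (lam i) - \sum_(a <- E) x a * dot (co a) (lam i))) (fun=> 0) =
  \prod_(i in ~: I) L_factor (s (al i)) * \prod_(a <- E) L_factor (s a) *
  csum Q (fun v => e2pii (dot y v) * \prod_(i in ~: I) cinv (s (al i)) (pairing (al i) v) *
                   \prod_(a <- E) cinv (s a) (pairing a (u + v))).
Proof.
move=> uI; have uP := weight_cone_lattice uI.
have ED a : a \in E -> a \in D by rewrite mem_E => /and3P[/pos_root_sub].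
have hsE : {in E, forall a, 1 < complex.Re (s a)} by move=> a; rewrite mem_E => /and3P[/hs].
pose g v := e2pii (dot y v) * \prod_(i in ~: I) cinv (s (al i)) (pairing (al i) v).
have sA (i : 'I_r) : csummable Nz (cinv (s (al i))).
  by apply/csummable_cinv/hs/simple_pos_root.
have sg : csummable Q g.
  have [sQ _] := @csum_weight_cone _ _ dot _ Psi lam hlam (enum (~: I))
    (fun=> Nz) (fun i => cinv (s (al i))) (enum_uniq _) (fun i _ => sA i).
  have h := @csummable_bounded _ _ _ _ (fun v => e2pii (dot y v)) 1 sQ.
  apply: eq_csummable (h _) => v _; last by rewrite normc_e2pii.
  by rewrite big_enum /= mulrC.
rewrite (@iterated_L _ _ _ E Q s (fun a v => - pairing a (u + v)) _ _
  (\prod_(i in ~: I) L_factor (s (al i))) g) ?fset_uniq //.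
  by congr (_ * _); apply: eq_csum => v _; under eq_bigr do rewrite opprK.
move=> x _.
pose th i := dot y (lam i) - \sum_(a <- E) x a * dot (co a) (lam i).
pose f i (n : int) := e2pii (n%:~R * th i) * cinv (s (al i)) n.
have sf i : csummable Nz (f i).
  have h := @csummable_bounded _ _ _ _ (fun n : int => e2pii (n%:~R * th i)) 1 (sA i).
  apply: eq_csummable (h _) => n _; last by rewrite normc_e2pii.
  by rewrite /f mulrC.
have [sQ eQ] := @csum_weight_cone _ _ dot _ Psi lam hlam (enum (~: I))
    (fun=> Nz) f (enum_uniq _) (fun i _ => sf i).
have -> : \prod_(i in ~: I) L (s (al i)) (th i) =
    \prod_(i in ~: I) L_factor (s (al i)) * \prod_(i <- enum (~: I)) csum Nz (f i).
  by rewrite big_enum /= -big_split /=; apply: eq_bigr => i _; rewrite L_fourier.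
set e0 := e2pii (- _).
suff key : e0 * csum Q (fun v => \prod_(i <- enum (~: I)) f i (pairing (al i) v)) =
    csum Q (fun v => g v * \prod_(a <- E) e2pii ((- pairing a (u + v))%:~R * x a)).
  by rewrite -key -eQ; ring.
rewrite -(csumZ e0 sQ).2; apply: eq_csum => v vQ.
have vP := weight_cone_lattice vQ.
have [_ _ _ ev] := weight_cone_pairing hlam (enum_uniq _) vQ.
have dv w : \sum_(i <- enum (~: I)) (pairing (al i) v)%:~R * dot w (lam i) = dot w v.
  by rewrite [in RHS]ev dot_sumr; apply: eq_bigr => i _;
    rewrite -[lam i *~ _]scaler_int dotZr.
(* The coefficient of [x a] has two sources, [u] in the exponential prefactor and [v] in the
   arguments of the [L]; together they give the pairing with [u + v], up to sign. *)
have expo : - \sum_(a <- E) x a * dot (co a) u +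
    \sum_(i <- enum (~: I)) (pairing (al i) v)%:~R * th i =
    dot y v + \sum_(a <- E) (- pairing a (u + v))%:~R * x a.
  have -> : \sum_(a <- E) (- pairing a (u + v))%:~R * x a =
      - \sum_(a <- E) x a * dot (co a) u - \sum_(a <- E) x a * dot (co a) v.
    rewrite -opprD -big_split -sumrN big_seq [RHS]big_seq; apply: eq_bigr => a /ED aD.
    by rewrite rmorphN /= -(pairingE aD (weight_latticeD uP vP)) dotDr /=; ring.
  have -> : \sum_(i <- enum (~: I)) (pairing (al i) v)%:~R * th i =
      dot y v - \sum_(a <- E) x a * dot (co a) v.
    rewrite -[dot y v]dv; under eq_bigr do rewrite mulrBr.
    rewrite sumrB; congr (_ - _).
    under eq_bigr do rewrite mulr_sumr.
    rewrite exchange_big /=; apply: eq_bigr => a _; rewrite -dv mulr_sumr.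
    by apply: eq_bigr => i _; ring.
  by ring.
rewrite /f big_split /= -e2pii_sum mulrA -e2piiD expo e2piiD e2pii_sum /g !big_enum /=.
by ring.
Qed.

(** The condition on [s a] puts [s a + 1] in the half-plane covered by [Gamma_neq0], so both
    quotients cancel. *)
Lemma complement_factor_neq0 a : a \in Dp ->
  -1 * (cpow ((2 * pi) *i) (s a) / Gamma (s a + 1)) * L_factor (s a) = 1.
Proof.
move=> aD; have G0 : Gamma (s a + 1) != 0.
  by apply: Gamma_neq0; rewrite cReD /=; have := hs aD; lra.
have c0 : cpow ((2 * pi) *i) (s a) != 0 by exact: cpow_neq0.
by rewrite /L_factor; field; rewrite G0 c0.
Qed.

Lemma prod_complement_factor : (-1) ^+ #|` (Dp `\` DIp)%fset| *
  (\prod_(a <- (Dp `\` DIp)%fset) (cpow ((2 * pi) *i) (s a) / Gamma (s a + 1))) *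
  (\prod_(i in ~: I) L_factor (s (al i)) * \prod_(a <- E) L_factor (s a)) = 1.
Proof.
rewrite [X in _ * X]mulrC -prod_complement_roots.
have -> : (-1) ^+ #|` (Dp `\` DIp)%fset| = \prod_(a <- (Dp `\` DIp)%fset) (-1 : R[i]).
  elim: (enum_fset _) => [|a l IH]; first by rewrite big_nil.
  by rewrite big_cons -IH -exprS.
rewrite -!big_split big_seq big1 // => a; rewrite in_fsetD => /andP[_ aD].
exact: complement_factor_neq0.
Qed.

(** The roots of [DIp] do not see [v] and are positive on [u], so their factors leave the sum over
    [v]; the simple roots outside [I] do not see [u]; the roots of [E] see [u + v], as produced by
    the integral. *)
Lemma term_xterm u : PI u ->
  e2pii (dot y u) * \prod_(a <- DIp) (cpow (dot (co a) u)%:C (s a))^-1 *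
  iterated_cint01 E (fun x =>
     e2pii (- \sum_(a <- E) x a * dot (co a) u) * \prod_(a <- E) L (s a) (x a) *
     \prod_(i in ~: I) L (s (al i))
       (dot y (lam i) - \sum_(a <- E) x a * dot (co a) (lam i))) (fun=> 0) =
  \prod_(i in ~: I) L_factor (s (al i)) * \prod_(a <- E) L_factor (s a) *
  csum Q (fun v => xterm (u + v)).
Proof.
move=> uI; rewrite (iterated_term uI) mulrCA; congr (_ * _).
have uP := weight_cone_lattice uI.
have [ui eu u0 _] := weight_cone_pairing hlam (enum_uniq _) uI.
pose C := e2pii (dot y u) * \prod_(a <- DIp) (cpow (dot (co a) u)%:C (s a))^-1.
pose G v := e2pii (dot y v) * \prod_(i in ~: I) cinv (s (al i)) (pairing (al i) v) *
  \prod_(a <- E) cinv (s a) (pairing a (u + v)).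
have C0 : C != 0.
  rewrite mulf_neq0 ?cexp_neq0 // prodf_seq_neq0; apply/allP => a _ /=.
  by rewrite invr_eq0 cpow_neq0.
have eG v : Q v -> xterm (u + v) = C * G v.
  move=> vQ; have vP := weight_cone_lattice vQ.
  have [_ _ v0 _] := weight_cone_pairing hlam (enum_uniq _) vQ.
  rewrite /xterm dotDr e2piiD prod_pos_roots.
  have -> : \prod_(a <- DIp) cinv (s a) (pairing a (u + v)) =
      \prod_(a <- DIp) (cpow (dot (co a) u)%:C (s a))^-1.
    rewrite big_seq [RHS]big_seq; apply: eq_bigr => a.
    rewrite (mem_parabolic_pos_roots hPsi) => /and3P[aD pa sa].
    have a0 : 0 < dot (co a) u.
      apply: (dominant_coroot_gt0 hD hPsi (J := I)) => // j jI.
      by rewrite eu ltr0z (lt_le_trans _ (ui j _)) // mem_enum.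
    have e : pairing a (u + v) = pairing a u.
      have := pairingE aD (weight_latticeD uP vP);
        rewrite dotDr (pairing_supported aD sa vQ).
      by rewrite addr0 (pairingE aD uP) => /intr_inj.
    rewrite e /cinv; move: a0; rewrite (pairingE aD uP) ltr0z => /lt0r_neq0/negPf ->.
    by rewrite intr_complex.
  have -> : \prod_(i in ~: I) cinv (s (al i)) (pairing (al i) (u + v)) =
      \prod_(i in ~: I) cinv (s (al i)) (pairing (al i) v).
    apply: eq_bigr => i; rewrite inE => iI.
    by rewrite pairingD ?(simple_root hPsi) // u0 ?add0r // mem_enum.
  by rewrite /C /G; ring.
have [sx _ _] := csum_fubini csummable_xterm.
(* On [Q] the family [G] is a slice of [xterm] divided by the nonzero constant [C]. *)
have sG : csummable Q G.
  apply: eq_csummable (csumZ C^-1 (sx u uI)).1 => v vQ /=.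
  by rewrite eG // mulKf.
by rewrite -/C -(csumZ C sG).2; apply: eq_csum => v vQ; rewrite eG.
Qed.

(** * Transport of the summand by the Weyl group *)

Lemma mem_inversions t a : (a \in inversions D Psi ((wprod dot Psi t)^-1)%VF) =
  (a \in Dp) && ~~ positive Psi (wprod dot Psi (rev t) a).
Proof.
have wi : (((wprod dot Psi t)^-1)^-1)%VF = wprod dot Psi t.
  by rewrite !(wprod_inv hD hPsi) revK.
rewrite in_fsetI wi; have [aD|//] /= := boolP (a \in Dp).
have aD' := pos_root_sub aD.
apply/imfsetP/idP => [[b /=]|na].
  rewrite (mem_neg_roots hD hPsi) => /andP[bD nb] ->.
  by rewrite (wprod_revK hD hPsi).
exists (wprod dot Psi (rev t) a); last by rewrite (wprod_Krev hD hPsi).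
by rewrite /= (mem_neg_roots hD hPsi) (wprod_root hD hPsi).
Qed.

(** The positive representative of a root modulo sign; these classes are the true indices of [s]. *)
Definition root_abs a := if positive Psi a then a else - a.

Lemma root_abs_pos a : a \in D -> root_abs a \in Dp.
Proof.
move=> aD; rewrite /root_abs mem_pos_roots; have [pa|na] := boolP (positive Psi a).
  by rewrite aD.
by rewrite (opp_root hD) // (positiveN hD hPsi).
Qed.

(** The Weyl group permutes the roots modulo sign, the inverse permutation being given by the
    inverse element. *)
Lemma perm_root_abs t :
  perm_eq [seq root_abs (wprod dot Psi (rev t) a) | a <- Dp] Dp.
Proof.
pose w' a := wprod dot Psi (rev t) a; pose w a := wprod dot Psi t a.
have wN u : w (- u) = - w u by exact: linearN.
have w'N u : w' (- u) = - w' u by exact: linearN.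
have ww' u : w (w' u) = u by rewrite /w /w' (wprod_Krev hD hPsi).
have w'w u : w' (w u) = u by rewrite /w /w' (wprod_revK hD hPsi).
have wD u : u \in D -> w u \in D by exact: wprod_root.
have w'D u : u \in D -> w' u \in D by exact: wprod_root.
have inv a : a \in Dp -> root_abs (w (root_abs (w' a))) = a.
  rewrite mem_pos_roots => /andP[aD pa]; rewrite {2}/root_abs.
  case: ifP => _; rewrite ?wN ww' /root_abs; first by rewrite pa.
  by rewrite (positiveN hD hPsi aD) pa opprK.
have inv' a : a \in Dp -> root_abs (w' (root_abs (w a))) = a.
  rewrite mem_pos_roots => /andP[aD pa]; rewrite {2}/root_abs.
  case: ifP => _; rewrite ?w'N w'w /root_abs; first by rewrite pa.
  by rewrite (positiveN hD hPsi aD) pa opprK.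
apply: uniq_perm; last 2 first.
- exact: fset_uniq.
- move=> b; apply/mapP/idP => [[a aD ->]|bD].
    exact/root_abs_pos/w'D/pos_root_sub.
  exists (root_abs (w b)); first exact/root_abs_pos/wD/pos_root_sub.
  by rewrite -/(w' _) inv'.
rewrite map_inj_in_uniq ?fset_uniq // => a b aD bD e.
by rewrite -(inv a aD) -(inv b bD) /w' e.
Qed.

(** Move the element to the other side of the pairings. A positive root with negative image under
    the inverse gives a power of a negative number, whence a factor at -1 by [cpow_opp]; by [hsN]
    the rest is a product over positive roots again. *)
Lemma zeta_term_conj t u : regular_dominant_weights lam u ->
  zeta_term dot D Psi s y (wprod dot Psi t u) =
  (\prod_(a <- inversions D Psi ((wprod dot Psi t)^-1)%VF) cpow (-1) (- s a)) *
  zeta_term dot D Psi (act ((wprod dot Psi t)^-1)%VF s) (((wprod dot Psi t)^-1)%VF y) u.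
Proof.
move=> /(mem_regular_dominant_weights hlam)[uP du].
pose w' a := wprod dot Psi (rev t) a.
have iso := wprod_isometric hD hPsi t.
rewrite /zeta_term /act !(wprod_inv hD hPsi) revK.
rewrite (_ : dot (wprod dot Psi (rev t) y) u = dot y (wprod dot Psi t u)); last first.
  by rewrite -iso (wprod_Krev hD hPsi).
rewrite mulrCA; congr (_ * _).
have -> : \prod_(a <- inversions D Psi (wprod dot Psi (rev t))) cpow (-1) (- s a) =
    \prod_(a <- Dp) (if positive Psi (w' a) then 1 else cpow (-1) (- s a)).
  rewrite [RHS](eq_bigr (fun a => if ~~ positive Psi (w' a) then cpow (-1) (- s a) else
    1)) => [|a _]; last by case: (positive _ _).
  rewrite -big_mkcond -[RHS]big_filter /=; apply: perm_big; apply: uniq_perm.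
  - exact: fset_uniq.
  - by rewrite filter_uniq // fset_uniq.
  by move=> a; rewrite -(wprod_inv hD hPsi) mem_inversions mem_filter andbC.
rewrite -[X in _ = _ * X](perm_big _ (perm_root_abs t)) big_map -big_split /=.
rewrite big_seq [RHS]big_seq; apply: eq_bigr => a aDp; have aD := pos_root_sub aDp.
have -> : dot (co a) (wprod dot Psi t u) = dot (co (w' a)) u.
  by rewrite -{1}(wprod_Krev hD hPsi t a) (isometric_coroot _ iso) iso.
have w'aD : w' a \in D by exact: wprod_root.
rewrite -/(w' a) /root_abs; case: ifP => [_|/negbT na].
  by rewrite mul1r /w' (wprod_Krev hD hPsi).
have wN v : wprod dot Psi t (- v) = - wprod dot Psi t v by exact: linearN.
rewrite wN /w' (wprod_Krev hD hPsi) hsN // -/(w' a).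
have pos : 0 < dot (co (- w' a)) u.
  apply: (dominant_coroot_gt0 hD hPsi du); rewrite ?(supportedT) ?(opp_root hD) //.
  by rewrite (positiveN hD hPsi).
have -> : dot (co (w' a)) u = - dot (co (- w' a)) u by rewrite corootN dotNl opprK.
by rewrite cpow_opp // invfM cpowN.
Qed.

Lemma zetaS_reps : zetaS dot D Psi lam s y I =
  \sum_(w \in parabolic_reps dot D Psi I)
    (\prod_(a <- inversions D Psi (w^-1)%VF) cpow (-1) (- s a)) *
    zeta dot D Psi lam (act (w^-1)%VF s) ((w^-1)%VF y).
Proof.
have [sH _] := zetaS_xterm.
rewrite /zetaS -[X in csum X _]/(half_regular_weights dot D Psi lam I).
have eH := half_regular_decomposition hD hPsi hlam I.
have sH' := sH; rewrite eH in sH'.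
rewrite eH csum_bigcup //; last 2 first.
- exact: (finite_parabolic_reps hD hPsi I).
- exact: (reps_trivIset hD hPsi hlam (J := I)).
apply: eq_fsbigr => w /set_mem wI.
have sw : csummable (w @` regular_dominant_weights lam) (zeta_term dot D Psi s y).
  by apply: csummable_sub sH' => v vw; exists w.
have [t et _] := (parabolic_repsP hD hPsi I w).1 wI.
have wJ : set_inj (regular_dominant_weights lam) w.
  move=> u v _ _; rewrite et => e.
  by rewrite -(wprod_revK hD hPsi t u) e (wprod_revK hD hPsi).
have [-> _] := csum_image (zeta_term dot D Psi s y) wJ.
have sz := csummable_image wJ sw.
pose c : R[i] := \prod_(a <- inversions D Psi (w^-1)%VF) cpow (-1) (- s a).
have c0 : c != 0.
  by rewrite prodf_seq_neq0; apply/allP => a _ /=; rewrite cpow_neq0.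
(* The summability of this zeta series is inherited from the corresponding piece of S, after
   division by the nonzero [c]. *)
have sZ : csummable (regular_dominant_weights lam)
    (zeta_term dot D Psi (act (w^-1)%VF s) ((w^-1)%VF y)).
  apply: eq_csummable (csumZ c^-1 sz).1 => u uP /=.
  by rewrite /c et zeta_term_conj // mulKf // -et.
rewrite -/c /zeta -(csumZ c sZ).2; apply: eq_csum => u uP /=.
by rewrite /c et zeta_term_conj.
Qed.

End ParabolicSums.

Lemma parabolic_dominant_cone {R : realType} {V : vectType R} {r : nat}
    (lam : 'I_r -> V) (I : {set 'I_r}) :
  parabolic_dominant_weights lam I =
  weight_cone lam (enum I) (fun=> [set n : int | 1 <= n]).
Proof.
apply/seteqP; split=> v [m hm ->]; exists m; rewrite ?big_enum // => i.
  by rewrite mem_enum => /hm.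
by move=> iI; apply: hm; rewrite mem_enum.
Qed.

Theorem theorem4p3 (R : realType) (V : vectType R) (dot : {dot V for idfun})
    (r : nat) (D : {fset V}) (Psi : r.-tuple V) (lam : 'I_r -> V)
    (I : {set 'I_r}) (s : V -> R[i]) (y : V)
    (hD : reduced_root_system dot D)
    (hPsi : fundamental_system D Psi)
    (hlam : fundamental_weights dot Psi lam)
    (hI : I != finset.set0)
    (hsN : {in D, forall a, s (- a) = s a})
    (hs : {in pos_roots D Psi, forall a, 1 < complex.Re (s a)}) :
  let Dp := pos_roots D Psi in
  let DIp := parabolic_pos_roots D Psi I in
  let E := (Dp `\` (DIp `|` [fset a | a in (Psi : seq V)]))%fset in
  let WI := parabolic_reps dot D Psi I in
  let term (v : V) : R[i] :=
    e2pii (dot y v)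
    * \prod_(a <- DIp) (cpow (dot (coroot dot a) v)%:C (s a))^-1
    * iterated_cint01 E
        (fun x =>
           e2pii (- \sum_(a <- E) x a * dot (coroot dot a) v)
           * \prod_(a <- E) L (s a) (x a)
           * \prod_(i in ~: I)
               L (s (tnth Psi i))
                 (dot y (lam i)
                  - \sum_(a <- E) x a * dot (coroot dot a) (lam i)))
        (fun=> 0) in
  [/\ zetaS dot D Psi lam s y I
      = \sum_(w \in WI)
          (\prod_(a <- inversions D Psi (w^-1)%VF) cpow (-1) (- s a))
          * zeta dot D Psi lam (act (w^-1)%VF s) ((w^-1)%VF y),
      csummable (parabolic_dominant_weights lam I) term,
      zetaS dot D Psi lam s y I
      = (-1) ^+ #|` (Dp `\` DIp)%fset|
        * (\prod_(a <- (Dp `\` DIp)%fset)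
             (cpow ((2 * pi) *i) (s a) / Gamma (s a + 1)))
        * csum (parabolic_dominant_weights lam I) term,
      finite_set WI &
      (WI #= right_cosets (reflection_group dot (parabolic_roots D Psi I))
                          (reflection_group dot D))%card].
Proof.
move=> Dp DIp E WI term.
have PIE := parabolic_dominant_cone lam I.
(* The constants in front of all the Fourier series involved; the prefactor in the statement is the
   inverse of [K], by [prod_complement_factor]. *)
pose K : R[i] :=
  \prod_(i in ~: I) L_factor (s (tnth Psi i)) * \prod_(a <- E) L_factor (s a).
have sx := csummable_xterm I y hD hPsi hlam hs.
have [_ sC eC] := csum_fubini sx.
have [sK eK] := csumZ K sC.
have eT u : parabolic_dominant_weights lam I u -> K * csum (weight_cone lam (enum (~: I))
    (fun=> [set n : int | n != 0])) (fun v => xterm dot D Psi s y (u + v)) = term u.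
  by rewrite PIE => uI; rewrite /term term_xterm.
have [_ eS] := zetaS_xterm I y hD hPsi hlam hs.
split.
- exact: zetaS_reps.
- by apply: (eq_csummable eT); rewrite PIE.
- rewrite -(eq_csum eT) PIE eK mulrA eS eC.
  by rewrite (prod_complement_factor I hPsi hs) mul1r.
- exact: (finite_parabolic_reps hD hPsi).
- exact: (parabolic_reps_cosets hD hPsi hlam).
Qed.
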